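(* Let $v^{\mathrm{in}}\in\mathbb{L}^2(\mathcal{O})$, $\tau>0$, and let $(v^n_{\mathcal{D}})_{n\in\mathbb{N}_0}$ be the discrete velocity generated by the algorithm (discrete Helmholtz initialisation followed by Crank--Nicolson time-stepping) described in the context, with $v_{\mathcal{D}}^{n+1/2}=\tfrac12(v_{\mathcal{D}}^{n+1}+v_{\mathcal{D}}^n)$. Let $q>0$. Then there exists a constant $C>0$, depending only on $q$, the noise coefficient $\sigma$, the boundary datum $g$, the parameters $p$ and $\kappa$, the volume of $\mathcal{O}$, and the stability constant $\Gamma$ of the Gradient Discretisation, such that for all $N\in\mathbb{N}$: $$\mathbb{E}\left[\max_{n\le N}\|\Pi_{\mathcal{D}}v^n_{\mathcal{D}}\|_{L^2(\mathcal{O})}^{2q}+\left(\sum_{n=0}^{N-1}\tau\,\|\varepsilon_{\mathcal{D}}v_{\mathcal{D}}^{n+1/2}\|_{L^p(\mathcal{O})}^p\right)^{q}\right]\le C\left(\|v^{\mathrm{in}}\|_{L^2(\mathcal{O})}^{2q}+(\tau N)^q\right).$$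
   Context: Setting. $(\Omega,(\mathcal{F}_t)_{t\ge0},\mathcal{F},\mathbb{P})$ is a filtered probability space satisfying the usual conditions and $W$ is a real-valued $(\mathcal{F}_t)$-Wiener process. $\mathcal{O}\subset\mathbb{R}^d$ is a bounded polygonal domain. $p\in(1,\infty)$, $p'=p/(p-1)$, $p\wedge p'=\min(p,p')$, $\kappa\ge0$. For $A\in\mathbb{R}^{d\times d}$ (with Euclidean norm $|A|$), $S(A)=(\kappa+|A|^2)^{(p-2)/2}A$ (with $S(0)=0$). $\mathbb{L}^2(\mathcal{O})$ is the space of $L^2$ vector fields $\mathcal{O}\to\mathbb{R}^d$; $(\cdot,\cdot)$ is the $L^2(\mathcal{O})$ pairing $\int_{\mathcal{O}}$ of (scalar, vector or matrix) functions. $\mathbb{W}^{k,\infty}_{\mathrm{div}}(\mathcal{O})$ is the $W^{k,\infty}$-closure of smooth vector fields on $\mathcal{O}$ with zero divergence. The data are deterministic and time-independent: $g\in\mathbb{W}^{2,\infty}_{\mathrm{div}}(\mathcal{O})$, $\sigma\in\mathbb{W}^{1,\infty}_{\mathrm{div}}(\mathcal{O})$. $\varepsilon g=\tfrac12(\nabla g+(\nabla g)^T)$ and $(\sigma\cdot\nabla)g=\sum_j\sigma_j\partial_jg$. Gradient Discretisation (GD). $\mathcal{D}=(X_{\mathcal{D},0},Y_{\mathcal{D}},\nabla_{\mathcal{D}},\varepsilon_{\mathcal{D}},\chi_{\mathcal{D}},\mathrm{div}_{\mathcal{D}},\Pi_{\mathcal{D}})$ where $X_{\mathcal{D},0},Y_{\mathcal{D}}$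 are finite-dimensional real vector spaces; $\nabla_{\mathcal{D}},\varepsilon_{\mathcal{D}}:X_{\mathcal{D},0}\to L^p(\mathcal{O})^{d\times d}$, $\mathrm{div}_{\mathcal{D}}:X_{\mathcal{D},0}\to L^p(\mathcal{O})$, $\Pi_{\mathcal{D}}:X_{\mathcal{D},0}\to L^2(\mathcal{O})^d$, $\chi_{\mathcal{D}}:Y_{\mathcal{D}}\to L^{p\wedge p'}(\mathcal{O})$ are linear; $\nabla_{\mathcal{D}},\varepsilon_{\mathcal{D}},\mathrm{div}_{\mathcal{D}},\Pi_{\mathcal{D}}$ moreover take values in $L^p\cap L^{p'}$, so that all pairings and constants below make sense. $\|\varepsilon_{\mathcal{D}}\cdot\|_{L^p(\mathcal{O})}$ is a norm on $X_{\mathcal{D},0}$. With $Y_{\mathcal{D},0}=\{q\in Y_{\mathcal{D}}:\int_{\mathcal{O}}\chi_{\mathcal{D}}q\,dx=0\}$, $\|\chi_{\mathcal{D}}\cdot\|_{L^{p\wedge p'}(\mathcal{O})}$ is a norm on $Y_{\mathcal{D},0}$. $E_{\mathcal{D},0}=\{v\in X_{\mathcal{D},0}:(\chi_{\mathcal{D}}q,\mathrm{div}_{\mathcal{D}}v)=0\ \forall q\in Y_{\mathcal{D},0}\}$, and $\Pi_{\mathcal{D}}$ is one-to-one on $E_{\mathcal{D},0}$. The $L^2$-projection $\mathcal{K}_{\mathcal{D}}:\mathbb{L}^2(\mathcal{O})\to E_{\mathcal{D},0}$ is defined by $(u-\Pi_{\mathcal{D}}\mathcal{K}_{\mathcal{D}}u,\Pi_{\mathcal{D}}\xi)=0$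 for all $\xi\in E_{\mathcal{D},0}$. For $r\in\{p,p'\}$ put $C_{\mathcal{D}}(r)=\sup_{v\in X_{\mathcal{D},0}\setminus\{0\}}\frac{\|\Pi_{\mathcal{D}}v\|_{L^r}+\|\mathrm{div}_{\mathcal{D}}v\|_{L^r}+\|\nabla_{\mathcal{D}}v\|_{L^r}}{\|\varepsilon_{\mathcal{D}}v\|_{L^r}}$, $C^{\mathrm{Sob}}_{\mathcal{D}}(r)=\sup_{z\in W^{1,r}(\mathcal{O})^d\setminus\{0\}}\frac{\|\varepsilon_{\mathcal{D}}\mathcal{K}_{\mathcal{D}}z\|_{L^r}}{\|z\|_{W^{1,r}}}$, and $\beta_{\mathcal{D}}(p)=\inf_{q\in Y_{\mathcal{D},0}\setminus\{0\}}\sup_{v\in X_{\mathcal{D},0}\setminus\{0\}}\frac{(\chi_{\mathcal{D}}q,\mathrm{div}_{\mathcal{D}}v)}{\|\chi_{\mathcal{D}}q\|_{L^{p\wedge p'}}(\|\varepsilon_{\mathcal{D}}v\|_{L^p}+\|\varepsilon_{\mathcal{D}}v\|_{L^{p'}})}$. Standing assumption: $\mathcal{D}$ is $\Gamma$-stable, i.e. for some $\Gamma\in[1,\infty)$: $C_{\mathcal{D}}(p)+C_{\mathcal{D}}(p')\le\Gamma$, $\beta_{\mathcal{D}}(p)\ge\Gamma^{-1}$, $C^{\mathrm{Sob}}_{\mathcal{D}}(p)+C^{\mathrm{Sob}}_{\mathcal{D}}(p')\le\Gamma$. Discrete noise form: $B^\sigma_{\mathcal{D}}(v,\xi)=\tfrac12(\sigma^T\nabla_{\mathcal{D}}v,\Pi_{\mathcal{D}}\xi)-\tfrac12(\Pi_{\mathcal{D}}v,\sigma^T\nabla_{\mathcal{D}}\xi)$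 for $v,\xi\in X_{\mathcal{D},0}$, where $(\sigma^T\nabla_{\mathcal{D}}v)_i=\sum_j\sigma_j(\nabla_{\mathcal{D}}v)_{ji}$ is the discrete counterpart of $(\sigma\cdot\nabla)v$. Algorithm. Given $v^{\mathrm{in}}\in\mathbb{L}^2(\mathcal{O})$ and a time step $\tau>0$, $t_n=n\tau$, $\Delta_{n+1}W=W(t_{n+1})-W(t_n)$. Step 1 (initialisation): $(v^0_{\mathcal{D}},\pi^0_{\mathcal{D}})\in X_{\mathcal{D},0}\times Y_{\mathcal{D},0}$ solves $(\Pi_{\mathcal{D}}v^0_{\mathcal{D}},\Pi_{\mathcal{D}}\xi)+(\chi_{\mathcal{D}}\pi^0_{\mathcal{D}},\mathrm{div}_{\mathcal{D}}\xi)=(v^{\mathrm{in}},\Pi_{\mathcal{D}}\xi)$ for all $\xi\in X_{\mathcal{D},0}$ and $(\mathrm{div}_{\mathcal{D}}v^0_{\mathcal{D}},\chi_{\mathcal{D}}q)=0$ for all $q\in Y_{\mathcal{D},0}$. Step 2 (time-stepping): for $n\in\mathbb{N}_0$, $(v^{n+1}_{\mathcal{D}},\pi^{n+1}_{\mathcal{D}})\in X_{\mathcal{D},0}\times Y_{\mathcal{D},0}$ satisfies $\mathbb{P}$-a.s. for all $(\xi,q)\in X_{\mathcal{D},0}\times Y_{\mathcal{D},0}$ $$(\Pi_{\mathcal{D}}v^{n+1}_{\mathcal{D}}-\Pi_{\mathcal{D}}v^n_{\mathcal{D}},\Pi_{\mathcal{D}}\xi)+\tau(S(\varepsilon_{\mathcal{D}}v^{n+1/2}_{\mathcal{D}}+\varepsilon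 g),\varepsilon_{\mathcal{D}}\xi)-(\chi_{\mathcal{D}}\pi^{n+1}_{\mathcal{D}}-\chi_{\mathcal{D}}\pi^n_{\mathcal{D}},\mathrm{div}_{\mathcal{D}}\xi)=[B^\sigma_{\mathcal{D}}(v^{n+1/2}_{\mathcal{D}},\xi)+((\sigma\cdot\nabla)g,\Pi_{\mathcal{D}}\xi)]\Delta_{n+1}W,$$ $$(\mathrm{div}_{\mathcal{D}}v^{n+1/2}_{\mathcal{D}},\chi_{\mathcal{D}}q)=0,\qquad v^{n+1/2}_{\mathcal{D}}=\tfrac12(v^{n+1}_{\mathcal{D}}+v^n_{\mathcal{D}}).$$ The algorithm is well-posed (unique solutions). *)

(* Defs.v *)
(* MathComp / MathComp-Analysis. *)
From HB Require Import structures.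
From mathcomp Require Import all_boot all_order all_algebra.
From mathcomp Require Import all_classical all_reals all_analysis.
Set Implicit Arguments.
Unset Strict Implicit.
Unset Printing Implicit Defensive.
Import Order.TTheory GRing.Theory Num.Theory.
Import numFieldNormedType.Exports.
Local Open Scope classical_set_scope.
Local Open Scope ring_scope.

Section rV_measurable.
Context (R : realType) (n : nat).
Let coor : 'I_n -> 'rV[R]_n -> measurableTypeR R := fun i x => x ord0 i.
(* The Borel (= product) sigma-algebra of R^n. *)
HB.instance Definition _ :=
  @isMeasurable.Build (measure_tuple_display default_measure_display) 'rV[R]_n
    (g_sigma_preimage coor) (@sigma_algebra0 _ _ _) (@sigma_algebraC _ _)
    (@sigma_algebra_bigcup _ _ _).
End rV_measurable.

Section lebesgue_rV.
Variable R : realType.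

Lemma measurable_rV_coord n (i : 'I_n) :
  measurable_fun [set: 'rV[R]_n] (fun x : 'rV[R]_n => x ord0 i).
Proof.
move=> _ Y mY; rewrite setTI; apply: sub_sigma_algebra => /=.
rewrite -bigcup_seq/=; exists i => /=; first by rewrite mem_index_enum.
by exists Y => //; rewrite setTI.
Qed.

Lemma measurable_fun_rV d (T : measurableType d) n (f : T -> 'rV[R]_n) :
  (forall i, measurable_fun [set: T] (fun t => f t ord0 i)) ->
  measurable_fun [set: T] f.
Proof.
move=> mf.
have pre : g_sigma_preimage (fun i (t : T) => f t ord0 i : measurableTypeR R)
    `<=` @measurable d T.
  apply: smallest_sub; first exact: sigma_algebra_measurable.
  case: n => [|n] in f mf *; first by rewrite big_ord0.
  rewrite -bigcup_mkord_ord; apply: bigcup_sub => i _.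
  by move=> A [B mB <-]; exact: mf.
have E := @g_sigma_preimage_comp _ (measurableTypeR R) n _
  (fun i (x : 'rV[R]_n) => x ord0 i) _ f.
move: pre; rewrite [X in X `<=` _](E : _ = _) => pre _ A mA.
by apply: pre; exists A.
Qed.

Definition rV_rcons n (xy : 'rV[R]_n * R) : 'rV[R]_n.+1 :=
  \row_j (if unlift ord_max j is Some k then xy.1 ord0 k else xy.2).

Lemma measurable_rV_rcons n : measurable_fun [set: 'rV[R]_n * R] (@rV_rcons n).
Proof.
apply: measurable_fun_rV => i; rewrite /rV_rcons.
under eq_fun do rewrite mxE.
case: (unlift ord_max i) => [k|]; last exact: measurable_snd.
exact: (measurableT_comp (@measurable_rV_coord n k) measurable_fst).
Qed.

(* Lebesgue measure on R^n, as an iterated product of lebesgue_measure. *)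
Fixpoint leb n : {measure set 'rV[R]_n -> \bar R}.
Proof.
refine (match n with
  | 0 => \d_(0 : 'rV[R]_0)
  | m.+1 => pushforward (leb m \x (@lebesgue_measure R))%E (@rV_rcons m)
  end).
exact: measurable_rV_rcons.
Defined.

End lebesgue_rV.

Section domain.
Context (R : realType) (d : nat).

Definition polytope (vs : seq 'rV[R]_d) : set 'rV[R]_d :=
  [set x | exists w : 'I_(size vs) -> R,
    [/\ forall i, 0 <= w i, \sum_i w i = 1 & x = \sum_i w i *: vs`_i]].

(* Bounded polygonal (polytopal) domain: a nonempty connected open set that is
   the interior of a finite union of compact convex polytopes. *)
Definition polygonal_domain (O : set 'rV[R]_d) :=
  [/\ O !=set0, connected O &
      exists s : seq (seq 'rV[R]_d),
        O = interior (\bigcup_(vs in [set` s]) polytope vs)].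

End domain.

Section fields.
Context (R : realType) (d : nat) (O : set 'rV[R]_d).
Local Notation point := 'rV[R]_d.

(* Euclidean (Frobenius) inner product and norm. *)
Definition mdot m n (A B : 'M[R]_(m, n)) : R := \sum_i \sum_j A i j * B i j.
Definition mabs m n (A : 'M[R]_(m, n)) : R := Num.sqrt (mdot A A).

(* The L^2(O) pairings, of scalar and of vector or matrix fields. *)
Definition spair (f g : point -> R) : R :=
  \int[leb R d]_(x in O) (f x * g x).
Definition mpair m n (F G : point -> 'M[R]_(m, n)) : R :=
  \int[leb R d]_(x in O) mdot (F x) (G x).

Definition sLp (r : \bar R) (f : point -> R) : Prop :=
  (f \_ O) \in Lfun (leb R d) r.
Definition mLp m n (r : \bar R) (F : point -> 'M[R]_(m, n)) : Prop :=
  forall i j, sLp r (fun x => F x i j).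

(* L^r(O) norms as real numbers; only used on elements of L^r(O), where the
   norm is finite. *)
Definition snorm (r : \bar R) (f : point -> R) : R :=
  fine ('N[leb R d]_r[EFin \o (f \_ O)])%E.
Definition mnorm m n (r : \bar R) (F : point -> 'M[R]_(m, n)) : R :=
  snorm r (fun x => mabs (F x)).

(* The classical iterated partial derivative along the multi-index s, given as
   a list of coordinate directions. *)
Definition pder (s : seq 'I_d) (f : point -> R) : point -> R :=
  foldr (fun i (h : point -> R) x => 'D_(delta_mx ord0 i) h x) f s.

Definition smooth (A : set point) (f : point -> R) :=
  forall s x, A x -> {for x, continuous (pder s f)} /\
    forall i : 'I_d, derivable (pder s f) x (delta_mx ord0 i).

Definition test_fun (phi : point -> R) :=
  smooth setT phi /\
  exists K : set point,
    [/\ compact K, K `<=` O & forall x, ~ K x -> phi x = 0].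

Definition weak_der (s : seq 'I_d) (f h : point -> R) :=
  forall phi, test_fun phi ->
    spair f (pder s phi) = (-1) ^+ size s * spair h phi.

(* A Sobolev vector field is handled together with (representatives of) its
   weak derivatives, which are unique almost everywhere on O: U s is the weak
   derivative of U [::] along the multi-index s. *)
Definition jet := seq 'I_d -> point -> 'rV[R]_d.

Definition sobolev (k : nat) (r : \bar R) (U : jet) :=
  forall s, (size s <= k)%N ->
    mLp r (U s) /\
    forall j, weak_der s (fun x => U [::] x ord0 j) (fun x => U s x ord0 j).

(* (grad U)_{ij} = \partial_i U_j *)
Definition grad (U : jet) (x : point) : 'M[R]_d :=
  \matrix_(i, j) U [:: i] x ord0 j.

Definition symgrad (U : jet) (x : point) : 'M[R]_d :=
  2^-1 *: (grad U x + (grad U x)^T).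

Definition W1norm (r : \bar R) (U : jet) : R :=
  mnorm r (U [::]) + mnorm r (grad U).

(* The W^{k,oo}(O)-closure of the divergence free smooth vector fields on O
   that lie in W^{k,oo}(O). *)
Definition Wdiv (k : nat) (U : jet) :=
  sobolev k +oo%E U /\
  forall e : R, 0 < e -> exists phi : 'I_d -> point -> R,
    [/\ forall j, smooth O (phi j),
        forall x, O x -> \sum_j pder [:: j] (phi j) x = 0 &
        forall s, (size s <= k)%N ->
          let D := fun x => \row_j pder s (phi j) x in
          mLp +oo%E D /\ mnorm +oo%E (fun x => U s x - D x) <= e].

(* The derivatives of order at most k are extended by zero outside O, so that a
   field on O becomes a function on the whole of R^d. *)
Definition zero_outside (k : nat) (U : jet) :=
  forall s x, (size s <= k)%N -> ~ O x -> U s x = 0.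

(* Linearity as a map into a space of classes of functions on O modulo
   equality almost everywhere. *)
Definition ae_linear (V U : lmodType R) (F : V -> point -> U) :=
  forall (a : R) (v w : V),
    {ae leb R d, forall x, O x -> F (a *: v + w) x = a *: F v x + F w x}.

End fields.
Arguments jet : clear implicits.

Definition conj_exp (R : realType) (p : R) : R := p / (p - 1).

(* Of the two "is a norm" requirements only definiteness is listed: the other
   norm axioms hold for every linear map into an L^r space. *)
Record gradDisc (R : realType) (d : nat) (O : set 'rV[R]_d) (p : R) := GradDisc {
  gdX : vectType R;
  gdY : vectType R;
  gdgrad : gdX -> 'rV[R]_d -> 'M[R]_d;
  gdeps : gdX -> 'rV[R]_d -> 'M[R]_d;
  gddiv : gdX -> 'rV[R]_d -> R;
  gdPi : gdX -> 'rV[R]_d -> 'rV[R]_d;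
  gdchi : gdY -> 'rV[R]_d -> R;
  gdgrad_lin : ae_linear O gdgrad;
  gdeps_lin : ae_linear O gdeps;
  gddiv_lin : ae_linear O (gddiv : gdX -> 'rV[R]_d -> R^o);
  gdPi_lin : ae_linear O gdPi;
  gdchi_lin : ae_linear O (gdchi : gdY -> 'rV[R]_d -> R^o);
  gdgrad_Lp : forall v,
    mLp O p%:E (gdgrad v) /\ mLp O (conj_exp p)%:E (gdgrad v);
  gdeps_Lp : forall v,
    mLp O p%:E (gdeps v) /\ mLp O (conj_exp p)%:E (gdeps v);
  gddiv_Lp : forall v,
    sLp O p%:E (gddiv v) /\ sLp O (conj_exp p)%:E (gddiv v);
  gdPi_Lp : forall v, [/\ mLp O 2%:E (gdPi v), mLp O p%:E (gdPi v) &
    mLp O (conj_exp p)%:E (gdPi v)];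
  gdchi_Lp : forall q, sLp O (Num.min p (conj_exp p))%:E (gdchi q);
  gdeps_norm : forall v, mnorm O p%:E (gdeps v) = 0 -> v = 0;
  gdchi_norm : forall q, \int[leb R d]_(x in O) gdchi q x = 0 ->
    snorm O (Num.min p (conj_exp p))%:E (gdchi q) = 0 -> q = 0;
  gdPi_inj : forall v w,
    let E0 u := forall q, \int[leb R d]_(x in O) gdchi q x = 0 ->
      spair O (gdchi q) (gddiv u) = 0 in
    E0 v -> E0 w ->
    {ae leb R d, forall x, O x -> gdPi v x = gdPi w x} -> v = w
}.

Section gradient_discretisation.
Context (R : realType) (d : nat) (O : set 'rV[R]_d) (p : R).
Variable D : gradDisc O p.

Definition gdY0 : set (gdY D) :=
  [set q | \int[leb R d]_(x in O) gdchi q x = 0].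

Definition gdE0 : set (gdX D) :=
  [set v | forall q : gdY D, gdY0 q -> spair O (gdchi q) (gddiv v) = 0].

(* The L^2-projection K_D; since gdPi takes values in L^p and L^{p'}, the
   defining pairing also makes sense for u in L^p(O) or L^{p'}(O). *)
Definition gdK (u : 'rV[R]_d -> 'rV[R]_d) : gdX D :=
  xget 0 [set w | gdE0 w /\ forall xi : gdX D, gdE0 xi ->
    mpair O (fun x => u x - gdPi w x) (gdPi xi) = 0].

Definition stabC (r : R) : \bar R :=
  ereal_sup [set ((mnorm O r%:E (gdPi v) + snorm O r%:E (gddiv v)
      + mnorm O r%:E (gdgrad v)) / mnorm O r%:E (gdeps v))%:E
    | v in [set v : gdX D | v != 0]].

Definition stabSob (r : R) : \bar R :=
  ereal_sup [set (mnorm O r%:E (gdeps (gdK (Z [::]))) / W1norm O r%:E Z)%:E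
    | Z in [set Z : jet R d | sobolev O 1 r%:E Z /\
        ~ {ae leb R d, forall x, O x -> Z [::] x = 0}]].

Definition stabBeta : \bar R :=
  ereal_inf [set
    ereal_sup [set (spair O (gdchi q) (gddiv v) /
        (snorm O (Num.min p (conj_exp p))%:E (gdchi q) *
         (mnorm O p%:E (gdeps v) + mnorm O (conj_exp p)%:E (gdeps v))))%:E
      | v in [set v : gdX D | v != 0]]
    | q in [set q : gdY D | gdY0 q /\ q != 0]].

Definition stable (Gam : R) :=
  [/\ (stabC p + stabC (conj_exp p) <= Gam%:E)%E,
      ((Gam^-1)%:E <= stabBeta)%E &
      (stabSob p + stabSob (conj_exp p) <= Gam%:E)%E].

(* The scaling gives S(0) = 0 whatever the value of powR at 0. *)
Definition stress (kappa : R) (A : 'M[R]_d) : 'M[R]_d :=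
  ((kappa + mdot A A) `^ ((p - 2) / 2)) *: A.

Definition noise_form (sigma : 'rV[R]_d -> 'rV[R]_d) (v xi : gdX D) : R :=
  2^-1 * mpair O (fun x => sigma x *m gdgrad v x) (gdPi xi)
  - 2^-1 * mpair O (gdPi v) (fun x => sigma x *m gdgrad xi x).

Definition helmholtz_init (vin : 'rV[R]_d -> 'rV[R]_d)
    (v : gdX D) (pr : gdY D) :=
  [/\ gdY0 pr,
      forall xi : gdX D, mpair O (gdPi v) (gdPi xi) + spair O (gdchi pr) (gddiv xi)
        = mpair O vin (gdPi xi) &
      forall q : gdY D, gdY0 q -> spair O (gddiv v) (gdchi q) = 0].

Definition midpoint (v v' : gdX D) : gdX D := 2^-1 *: (v' + v).

(* One step from (v, pr) to (v', pr') with Wiener increment dW. *)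
Definition crank_nicolson (kappa : R) (sigma g : jet R d) (tau dW : R)
    (v : gdX D) (pr : gdY D) (v' : gdX D) (pr' : gdY D) :=
  let vh := midpoint v v' in
  [/\ gdY0 pr',
      forall xi : gdX D,
        mpair O (fun x => gdPi v' x - gdPi v x) (gdPi xi)
        + tau * mpair O (fun x => stress kappa (gdeps vh x + symgrad g x))
                        (gdeps xi)
        - spair O (fun x => gdchi pr' x - gdchi pr x) (gddiv xi)
        = (noise_form (sigma [::]) vh xi
           + mpair O (fun x => sigma [::] x *m grad g x) (gdPi xi)) * dW &
      forall q : gdY D, gdY0 q -> spair O (gddiv vh) (gdchi q) = 0].

End gradient_discretisation.

Section stochastic_basis.
Context (R : realType) (dO : measure_display) (Om : measurableType dO).
Variables (P : probability Om R) (F : R -> set (set Om)).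

Definition usual_filtration :=
  [/\ forall t : R, 0 <= t -> sigma_algebra setT (F t) /\ F t `<=` measurable,
      forall s t : R, 0 <= s -> s <= t -> F s `<=` F t,
      forall t : R, 0 <= t -> \bigcap_(s in [set s | t < s]) F s `<=` F t &
      forall N, P.-negligible N -> F 0 N].

(* normal_prob takes the standard deviation as its last parameter. *)
Definition wiener (W : R -> Om -> R) :=
  [/\ {ae P, forall w, W 0 w = 0},
      forall t : R, 0 <= t -> forall B : set R, measurable B -> F t (W t @^-1` B),
      {ae P, forall w, {within `[0, +oo[, continuous (fun t => W t w)}} &
      forall s t : R, 0 <= s -> s < t ->
        (forall B : set R, measurable B ->
          P [set w | B (W t w - W s w)%R] = normal_prob 0 (Num.sqrt (t - s)) B) /\
        (forall (A : set Om) (B : set R), F s A -> measurable B ->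
          P (A `&` [set w | B (W t w - W s w)%R])
          = (P A * P [set w | B (W t w - W s w)%R])%E)].

Definition cn_algorithm (d : nat) (O : set 'rV[R]_d) (p : R) (D : gradDisc O p)
    (kappa : R) (sigma g : jet R d) (W : R -> Om -> R)
    (vin : 'rV[R]_d -> 'rV[R]_d) (tau : R)
    (v : nat -> Om -> gdX D) (pr : nat -> Om -> gdY D) :=
  (forall w, helmholtz_init vin (v 0 w) (pr 0 w)) /\
  forall n, {ae P, forall w,
    crank_nicolson kappa sigma g tau (W (n.+1%:R * tau) w - W (n%:R * tau) w)
      (v n w) (pr n w) (v n.+1 w) (pr n.+1 w)}.

End stochastic_basis.

(* Main.v *)
Require Import Defs.
From HB Require Import structures.
From mathcomp Require Import all_boot all_order all_algebra.
From mathcomp Require Import all_classical all_reals all_analysis.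
From mathcomp Require Import measurable_realfun ess_sup_inf.
From mathcomp Require Import ring lra.
Import Order.TTheory GRing.Theory Num.Theory.
Import numFieldNormedType.Exports.
Local Open Scope classical_set_scope.
Local Open Scope ring_scope.
Set Implicit Arguments.
Unset Strict Implicit.
Unset Printing Implicit Defensive.

(* Discretely divergence-free test functions eliminate the pressure. Testing a
   step with its midpoint, where the noise form vanishes by antisymmetry, gives
   for X_n = |Pi v^n|^2 and k = K_D((sigma . grad) g), with d_n = |eps v^{n+1/2}|_p^p,
     X_{n+1} + c tau d_n <= X_n + A tau + (Pi k, Pi v^{n+1} + Pi v^n) dW.
   Testing the same step with k replaces v^{n+1} by v^n in the last term, up to
   quantities that Young's inequality absorbs into tau d_n, so that
     X_{n+1} + c tau d_n <= X_n + 2 (Pi k, Pi v^n) dW + A tau (1 + |dW / sqrt tau|)^m.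
   The coefficient of the martingale increment is at most A sqrt(X_n), hence the
   integer moments of X_n and, by a pathwise form of Doob's inequality, those of
   its running maximum grow like (X_0 + tau N)^j; arbitrary q > 0 follow by
   comparing powers. Monotonicity of the stress makes v^{n+1} a continuous
   function of v^n and dW, which yields the adaptedness of v^n. *)

(** The midpoint test leaves a noise term with [v^{n+1}], which anticipates the increment; the test
    with [k] exists to trade it for a coefficient known at time [t_n]. The price is a bound on
    [gdeps k] in both [L^p] and [L^{p'}], and stability of [gdK] gives one only for fields in
    [W^{1,r}]: hence the weak product rule for [(sigma . grad) g]. The trade also creates the
    product of [tau * dW] with a stress pairing, harmless only for [tau <= 1]; for larger steps the
    dissipation absorbs the whole noise and no martingale is left.

    Two devices keep the constant free of [tau] and [N]. The energy is divided by [tau * N] and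
    shifted by 1, so that each of the [N] steps has drift of order [1 / N] and fluctuation of order
    [1 / sqrt N] relative to the current value. And the probabilistic argument runs on a majorant
    defined by an exact recursion: the [v^n] are functions on the sample space without assumed
    measurability, tied to the scheme only almost surely, and of them only the pairing with [k] has
    to be shown adapted. *)

Section product_rule.
Context {R : realType} {d} {T : measurableType d} (P : probability T R).

(** Independence identifies the joint law with the product of the laws, by uniqueness of the product
    measure on rectangles; Tonelli then factors the integral. *)
Lemma integral_prod_indep (X Y : T -> R) (g : R -> R) :
  measurable_fun setT X -> measurable_fun setT Y -> measurable_fun setT g ->
  (forall w, 0 <= X w) -> (forall y, 0 <= g y) ->
  (forall A B : set R, measurable A -> measurable B ->
     P (X @^-1` A `&` Y @^-1` B) = (P (X @^-1` A) * P (Y @^-1` B))%E) ->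
  (\int[P]_w (X w * g (Y w))%:E = \int[P]_w (X w)%:E * \int[P]_w (g (Y w))%:E)%E.
Proof.
move=> mX mY mg X0 g0 XY.
have mXY : measurable_fun setT (fun w => (X w, Y w)).
  exact: measurable_fun_pair.
pose X' : {mfun T >-> R} := HB.pack X (isMeasurableFun.Build _ _ _ _ _ mX).
pose Y' : {mfun T >-> R} := HB.pack Y (isMeasurableFun.Build _ _ _ _ _ mY).
pose XY' : {mfun T >-> (R * R)%type} :=
  HB.pack (fun w => (X w, Y w)) (isMeasurableFun.Build _ _ _ _ _ mXY).
pose muX := distribution P X'; pose muY := distribution P Y'.
pose muXY := distribution P XY'.
have E A : measurable A -> (muX \x muY)%E A = muXY A.
  by move=> mA; apply: product_measure_unique => // A1 B1; exact: XY.
(* The law of [X] is a measure on the whole line; truncating the first coordinate keeps the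
   integrand nonnegative there and changes nothing along [X]. *)
pose h (z : R * R) : R := Num.max z.1 0 * g z.2.
pose f := EFin \o h.
have f0 z : (0 <= f z)%E by rewrite lee_fin mulr_ge0// le_max lexx orbT.
have mf : measurable_fun setT f.
  apply/measurable_EFinP; apply: measurable_funM.
    by apply: measurable_maxr => //; exact: measurable_fst.
  exact: (measurableT_comp mg measurable_snd).
transitivity (\int[muXY]_z f z)%E.
  rewrite ge0_integral_pushforward//=.
  by apply: eq_integral => w _; rewrite /f /h /= max_l.
transitivity (\int[(muX \x muY)%E]_z f z)%E.
  by apply: eq_measure_integral => A mA _; exact/esym/E.
rewrite fubini_tonelli1//= /fubini_F.
transitivity (\int[muX]_x ((Num.max x 0)%:E * \int[muY]_y (g y)%:E))%E.
  apply: eq_integral => x _; rewrite /f /h /=.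
  under eq_integral do rewrite EFinM.
  rewrite ge0_integralZl_EFin//.
  - by move=> y _; rewrite lee_fin.
  - exact/measurable_EFinP.
  - by rewrite le_max lexx orbT.
rewrite ge0_integralZr//; last 3 first.
  - by apply/measurable_EFinP; exact: measurable_maxr.
  - by move=> x _; rewrite lee_fin le_max lexx orbT.
  - by apply: integral_ge0 => y _; rewrite lee_fin.
congr (_ * _)%E; rewrite ge0_integral_pushforward//=.
- by apply: eq_integral => w _ /=; rewrite max_l.
- by apply/measurable_EFinP; exact: measurable_maxr.
- by move=> x _; rewrite lee_fin le_max lexx orbT.
- exact/measurable_EFinP.
- by move=> y _; rewrite lee_fin.
Qed.

End product_rule.

(** * Gaussian moments and symmetry *)

Section gauss.
Context {R : realType}.
Local Notation mu := (@lebesgue_measure R).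

Lemma integral_normal_probE (s : R) (f : R -> R) : measurable_fun setT f ->
  (forall x, 0 <= f x) ->
  (\int[normal_prob 0 s]_x (f x)%:E = \int[mu]_x (f x * normal_pdf 0 s x)%:E)%E.
Proof.
move=> mf f0.
have dom := normal_prob_dominates 0 s.
have mfE : measurable_fun setT (EFin \o f) by exact/measurable_EFinP.
rewrite -(Radon_Nikodym_SigmaFinite.change_of_variables dom)//.
apply: ae_eq_integral => //.
- apply: emeasurable_funM => //.
  exact: measurable_int (Radon_Nikodym_SigmaFinite.f_integrable dom).
- apply/measurable_EFinP/measurable_funM => //.
  exact: measurable_normal_pdf.
under [X in ae_eq _ _ _ X]eq_fun do rewrite EFinM.
apply: ae_eqe_mul2l.
apply: integral_ae_eq => //.
- exact: Radon_Nikodym_SigmaFinite.f_integrable.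
- by apply/measurable_EFinP; exact: measurable_normal_pdf.
- by move=> E ET mE; exact/esym/(Radon_Nikodym_SigmaFinite.f_integral dom).
Qed.

(** With [t = |x| / s], [(1 + t)^j <= exp (j t)], and [j t - t^2 / 2 <= j^2 - t^2 / 4] says that
    [(j - t / 2)^2 >= 0]. Domination by a Gaussian of twice the variance bounds all moments
    independently of [s] without computing any; [sqrt 2] is the ratio of the two peaks. *)
Lemma normal_pdf_moment_le (s x : R) (j : nat) : 0 < s ->
  (1 + `|x| / s) ^+ j * normal_pdf 0 s x <=
  expR (j%:R ^+ 2) * Num.sqrt 2 * normal_pdf 0 (Num.sqrt 2 * s) x.
Proof.
move=> s0.
have s20 : 0 < Num.sqrt 2 * s :> R by rewrite mulr_gt0// sqrtr_gt0.
rewrite !normal_pdfE ?gt_eqF// /normal_peak /normal_fun subr0.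
have s2E : (Num.sqrt 2 * s) ^+ 2 = s ^+ 2 *+ 2 :> R.
  by rewrite exprMn sqr_sqrtr// mulrC mulr_natr.
rewrite s2E.
have q0 : 0 < Num.sqrt (s ^+ 2 * pi *+ 2).
  by rewrite sqrtr_gt0 pmulrn_lgt0// mulr_gt0 ?pi_gt0 ?exprn_gt0.
have -> : Num.sqrt (s ^+ 2 *+ 2 * pi *+ 2) =
    Num.sqrt 2 * Num.sqrt (s ^+ 2 * pi *+ 2) :> R.
  by rewrite -sqrtrM// mulrnAl -mulr_natl.
set c := Num.sqrt (s ^+ 2 * pi *+ 2) in q0 *.
have -> : expR (j%:R ^+ 2) * Num.sqrt 2 * ((Num.sqrt 2 * c)^-1 *
    expR (- x ^+ 2 / (s ^+ 2 *+ 2 *+ 2))) =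
    c^-1 * (expR (j%:R ^+ 2) * expR (- x ^+ 2 / (s ^+ 2 *+ 2 *+ 2))) :> R.
  field; rewrite gt_eqF//= gt_eqF// sqrtr_gt0//.
rewrite mulrCA ler_pM2l ?invr_gt0//.
set t := `|x| / s.
have t0 : 0 <= t by rewrite divr_ge0// ltW.
have -> : - x ^+ 2 / (s ^+ 2 *+ 2) = - (t ^+ 2 / 2).
  rewrite /t expr_div_n real_normK ?num_real//; field; exact: lt0r_neq0.
have -> : - x ^+ 2 / (s ^+ 2 *+ 2 *+ 2) = - (t ^+ 2 / 4).
  rewrite /t expr_div_n real_normK ?num_real//; field; exact: lt0r_neq0.
rewrite -expRD.
apply: (@le_trans _ _ (expR (t *+ j) * expR (- (t ^+ 2 / 2)))).
  rewrite ler_wpM2r ?expR_ge0// -mulr_natl expRM_natl; apply: lerXn2r.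
  - by rewrite nnegrE addr_ge0.
  - by rewrite nnegrE expR_ge0.
  - exact: expR_ge1Dx.
rewrite -expRD ler_expR -mulr_natr.
have : 0 <= (j%:R - t / 2) ^+ 2 by exact: sqr_ge0.
nra.
Qed.

Lemma normal_prob_moment (s : R) (j : nat) : 0 < s ->
  (\int[normal_prob 0 s]_x ((1 + `|x| / s) ^+ j)%:E <=
   (expR (j%:R ^+ 2) * Num.sqrt 2)%:E)%E.
Proof.
move=> s0.
have mf : measurable_fun setT (fun x : R => (1 + `|x| / s) ^+ j).
  apply: measurable_funX; apply: measurable_funD => //.
  by apply: measurable_funM => //; exact: measurableT_comp.
have f0 x : 0 <= (1 + `|x| / s) ^+ j.
  by rewrite exprn_ge0// addr_ge0// divr_ge0// ltW.
rewrite integral_normal_probE//.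
apply: (@le_trans _ _ (\int[mu]_x ((expR (j%:R ^+ 2) * Num.sqrt 2)%:E *
    (normal_pdf 0 (Num.sqrt 2 * s) x)%:E))%E).
  apply: ge0_le_integral => //.
  - by move=> x _; rewrite lee_fin mulr_ge0// normal_pdf_ge0.
  - by apply/measurable_EFinP/measurable_funM => //; exact: measurable_normal_pdf.
  - apply/measurable_EFinP/measurable_funM => //; exact: measurable_normal_pdf.
  - by move=> x _; rewrite -EFinM lee_fin normal_pdf_moment_le.
rewrite ge0_integralZl_EFin ?integral_normal_pdf ?mule1//.
- by move=> x _; rewrite lee_fin normal_pdf_ge0.
- by apply/measurable_EFinP; exact: measurable_normal_pdf.
Qed.

(** [|x|] times the density is even, so its integral is twice the part over [x >= 0], and it is also
    the sum of the two sides. Finiteness of one side permits the cancellation. *)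
Lemma normal_prob_symmetric (s : R) : 0 < s ->
  (\int[normal_prob 0 s]_x (Num.max x 0)%:E =
   \int[normal_prob 0 s]_x (Num.max (- x) 0)%:E)%E.
Proof.
move=> s0.
have mp : measurable_fun setT (fun x : R => Num.max x 0).
  exact: measurable_maxr.
have mn : measurable_fun setT (fun x : R => Num.max (- x) 0).
  by apply: measurable_maxr => //; exact: measurableT_comp.
have p0 (x : R) : 0 <= Num.max x 0 by rewrite le_max lexx orbT.
have fin : (\int[normal_prob 0 s]_x (Num.max x 0)%:E < +oo)%E.
  apply: (@le_lt_trans _ _ (\int[normal_prob 0 s]_x
      (s%:E * ((1 + `|x| / s) ^+ 1)%:E))%E).
    apply: ge0_le_integral => //.
    - by move=> x _; rewrite lee_fin.
    - exact/measurable_EFinP.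
    - apply/measurable_EFinP/measurable_funM => //.
      apply: measurable_funX; apply: measurable_funD => //.
      by apply: measurable_funM => //; exact: measurableT_comp.
    - move=> x _; rewrite -EFinM lee_fin expr1 mulrDr mulr1 mulrCA.
      rewrite mulfV ?gt_eqF// mulr1 ge_max; apply/andP; split.
        by rewrite (le_trans (ler_norm x))// lerDr ltW.
      by rewrite addr_ge0// ltW.
  rewrite ge0_integralZl_EFin//; last 3 first.
  - by move=> x _; rewrite lee_fin exprn_ge0// addr_ge0// divr_ge0// ltW.
  - apply/measurable_EFinP; apply: measurable_funX; apply: measurable_funD => //.
    by apply: measurable_funM => //; exact: measurableT_comp.
  - exact: ltW.
  have := @normal_prob_moment s 1 s0.
  move=> /(lee_wpmul2l (ltW s0 : (0 <= s%:E)%E)) /le_lt_trans; apply.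
  by rewrite -EFinM ltry.
move: fin; rewrite !integral_normal_probE//.
set a := (\int[mu]_x (Num.max x 0 * _)%:E)%E; set b := (\int[mu]_x _)%E => fin.
have mpdf := measurable_normal_pdf 0 s.
have h0 x : 0 <= `|x| * normal_pdf 0 s x by rewrite mulr_ge0// normal_pdf_ge0.
have E1 : (\int[mu]_x (`|x| * normal_pdf 0 s x)%:E = a + b)%E.
  rewrite -ge0_integralD//=; last 4 first.
  - by move=> x _; rewrite lee_fin mulr_ge0// normal_pdf_ge0.
  - exact/measurable_EFinP/measurable_funM.
  - by move=> x _; rewrite lee_fin mulr_ge0// normal_pdf_ge0.
  - exact/measurable_EFinP/measurable_funM.
  apply: eq_integral => x _; rewrite -EFinD -mulrDl; congr (_ * _)%:E.
  have [x0|x0] := leP 0 x.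
    by rewrite ger0_norm// max_r ?oppr_le0// addr0.
  by rewrite ltr0_norm// max_l ?add0r// oppr_ge0 ltW.
have E2 : (\int[mu]_x (`|x| * normal_pdf 0 s x)%:E = 2%:E * a)%E.
  rewrite ge0_symfun_integralT//.
  - congr (_ * _)%E; rewrite integral_mkcond; apply: eq_integral => x _.
    rewrite patchE; case: ifPn; rewrite ?notin_setE ?inE/= => x0.
      by rewrite ger0_norm// max_l.
    move: x0 => /negP; rewrite -ltNge => x0.
    by rewrite max_r ?mul0r// ltW.
  - move=> x; apply: cvgM; first exact: norm_continuous.
    by apply: continuous_normal_pdf; rewrite gt_eqF.
  - move=> x /=; rewrite normrN; congr (_ * _).
    by rewrite normal_pdfE ?gt_eqF// /normal_fun !subr0 sqrrN.
have a0 : (0 <= a)%E.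
  by apply: integral_ge0 => x _; rewrite lee_fin mulr_ge0// normal_pdf_ge0.
have afin : a \is a fin_num by rewrite ge0_fin_numE.
have aba : (a + b = a + a)%E.
  by rewrite -E1 E2 -(@fineK _ a)// -EFinM mulr_natl -EFinD.
by rewrite -[RHS](addeK b afin) (addeC b a) aba addeK.
Qed.

End gauss.

(** * One step of the scalar recursion *)

Section real_inequalities.
Context {R : realFieldType}.

(** A Bernoulli inequality from above, by induction on [M]. The linear term must keep its exact
    coefficient because it becomes a martingale increment; only the remainder may be estimated
    crudely. *)
Lemma expr1D_le_quadratic (M : nat) (x : R) : -1 <= x ->
  (1 + x) ^+ M <= 1 + M%:R * x + M%:R ^+ 2 * x ^+ 2 * (1 + `|x|) ^+ M.
Proof.
move=> x1; elim: M => [|M IH]; first by rewrite expr0 expr0n !mul0r !addr0.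
have x0 : 0 <= 1 + x by lra.
have y1 : 1 <= 1 + `|x| by rewrite lerDl.
have y0 : 0 <= 1 + `|x| by apply: le_trans y1.
have xy : 1 + x <= 1 + `|x| by rewrite lerD2l ler_norm.
have P1 : 1 <= (1 + `|x|) ^+ M.+1 by apply: exprn_ege1.
rewrite exprSr; apply: (le_trans (ler_wpM2r x0 IH)).
have H : M%:R ^+ 2 * x ^+ 2 * (1 + `|x|) ^+ M * (1 + x) <=
    M%:R ^+ 2 * x ^+ 2 * (1 + `|x|) ^+ M.+1.
  rewrite (exprSr (1 + `|x|) M) [X in _ <= X]mulrA.
  by apply: ler_wpM2l => //; rewrite mulr_ge0 ?exprn_ge0// mulr_ge0 ?sqr_ge0.
have m0 : 0 <= M%:R :> R by [].
set y := (1 + `|x|) ^+ M.+1 in P1 H *.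
set z := _ * _ * (1 + `|x|) ^+ M in H *.
rewrite -natr1.
have : M%:R * x ^+ 2 * 1 <= M%:R * x ^+ 2 * y.
  by rewrite ler_wpM2l// mulr_ge0// sqr_ge0.
have : 0 <= (M%:R + 1) * x ^+ 2 * y.
  by rewrite mulr_ge0 ?(le_trans ler01 P1)// mulr_ge0 ?sqr_ge0// addr_ge0.
nra.
Qed.

End real_inequalities.

Section growth.
Context {R : realType}.

(** The relative increment [eta] is of size [1 / sqrt N]. In [s ^+ M.+1 * (1 + eta) ^+ M.+1] the
    noise survives at first order as an exact linear term in [z], and all the rest is of order
    [1 / N]: the drift directly, the remainder through [eta ^+ 2]. The exponent of [1 + |z|] adds
    the powers from the drift, from [eta ^+ 2] and from [(1 + |eta|) ^+ M.+1]. *)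
Lemma step_growth (M m : nat) (A N s a z : R) :
  0 <= A -> 1 <= N -> 1 <= s -> `|a| <= A * s / Num.sqrt N ->
  let s' := s + a * z + A / N * (1 + `|z|) ^+ m in
  0 <= s' ->
  s' <= s * ((1 + 2 * A) * (1 + `|z|) ^+ m.+1) /\
  s' ^+ M.+1 <= s ^+ M.+1 + M.+1%:R * s ^+ M * a * z +
    (M.+1%:R * A + M.+1%:R ^+ 2 * (2 * A) ^+ 2 * (1 + 2 * A) ^+ M.+1) / N *
    (s ^+ M.+1 * (1 + `|z|) ^+ (m + m.+1 * 2 + m.+1 * M.+1)).
Proof.
move=> A0 N1 s1 ha s' s'0.
have s0 : 0 < s by apply: lt_le_trans s1.
have N0 : 0 < N by apply: lt_le_trans N1.
set r := Num.sqrt N.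
have r0 : 0 < r by rewrite sqrtr_gt0.
have rr : r ^+ 2 = N by rewrite sqr_sqrtr// ltW.
have r1 : 1 <= r by rewrite -(sqrtr1 R) ler_wsqrtr.
set u := 1 + `|z|.
have u1 : 1 <= u by rewrite lerDl.
have u0 : 0 <= u by apply: le_trans u1.
have um j : 1 <= u ^+ j by apply: exprn_ege1.
have um0 j : 0 <= u ^+ j by apply: exprn_ge0.
pose eta := (a * z + A / N * u ^+ m) / s.
have s'E : s' = s * (1 + eta).
  by rewrite /s' /eta mulrDr mulr1 mulrCA mulfV ?gt_eqF// mulr1 addrA.
have eta_bnd : `|eta| <= 2 * A * u ^+ m.+1 / r.
  rewrite /eta normrM [`|s^-1|]ger0_norm ?invr_ge0 ?(ltW s0)//.
  rewrite ler_pdivrMr//; apply: (le_trans (ler_normD _ _)).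
  rewrite [`|A / N * _|]ger0_norm; last first.
    by rewrite mulr_ge0// divr_ge0// ltW.
  have H1 : `|a * z| <= A * u ^+ m.+1 / r * s.
    rewrite normrM exprSr.
    apply: (@le_trans _ _ (A * s / r * u)).
      rewrite ler_pM//; apply: (le_trans _ (_ : `|z| <= _)) => //.
      by rewrite lerDr.
    have -> : A * s / r * u = A * 1 * u / r * s by field; exact: lt0r_neq0.
    rewrite !ler_wpM2r ?invr_ge0 ?(ltW s0) ?(ltW r0)// -mulrA ler_wpM2l//.
    by rewrite ler_wpM2r.
  have H2 : A / N * u ^+ m <= A * u ^+ m.+1 / r * s.
    have -> : A / N * u ^+ m = A * u ^+ m / N by rewrite mulrAC.
    have Nr : N^-1 <= r^-1 by rewrite lef_pV2 ?posrE// -rr expr2 ler_peMl// ltW.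
    rewrite -[leLHS]mulr1 ler_pM// ?divr_ge0 ?mulr_ge0 ?(ltW N0)//.
    rewrite ler_pM// ?mulr_ge0 ?invr_ge0 ?(ltW N0)//.
    by rewrite ler_wpM2l// exprS ler_peMl.
  by have -> : 2 * A * u ^+ m.+1 / r * s =
    A * u ^+ m.+1 / r * s + A * u ^+ m.+1 / r * s; [ring | rewrite lerD].
have eta_bnd1 : `|eta| <= 2 * A * u ^+ m.+1.
  apply: (le_trans eta_bnd); rewrite ler_pdivrMr// ler_peMr// !mulr_ge0//.
have eta1 : 1 + `|eta| <= (1 + 2 * A) * u ^+ m.+1.
  by rewrite mulrDl mul1r lerD.
have eta_ge : -1 <= eta.
  have : 0 <= 1 + eta by rewrite -(pmulr_rge0 _ s0) -s'E.
  lra.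
split.
  rewrite s'E ler_wpM2l ?(ltW s0)//; apply: le_trans eta1.
  by rewrite lerD2l ler_norm.
rewrite s'E exprMn.
have sM0 : 0 <= s ^+ M.+1 by rewrite exprn_ge0// ltW.
apply: (@le_trans _ _ (s ^+ M.+1 * (1 + M.+1%:R * eta +
    M.+1%:R ^+ 2 * eta ^+ 2 * (1 + `|eta|) ^+ M.+1))).
  by apply: ler_wpM2l => //; exact: expr1D_le_quadratic.
rewrite mulrDr mulrDr mulr1 -!addrA lerD2l.
have -> : s ^+ M.+1 * (M.+1%:R * eta) = M.+1%:R * s ^+ M * a * z +
   M.+1%:R * A / N * (s ^+ M * u ^+ m).
  rewrite /eta exprS; field; rewrite !gt_eqF//.
rewrite -addrA lerD2l.
rewrite [X in _ <= X]mulrA mulrDl mulrDl mulrDl; apply: lerD.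
  rewrite -!mulrA; do 2 rewrite ler_wpM2l//; rewrite ler_wpM2l ?invr_ge0 ?(ltW N0)//.
  apply: ler_pM; rewrite ?exprn_ge0 ?(ltW s0)//.
    by rewrite exprS ler_peMl// exprn_ge0// ltW.
  by rewrite exprD exprD -mulrA ler_peMr// mulr_ege1.
have e2 : eta ^+ 2 <= (2 * A) ^+ 2 * u ^+ (m.+1 * 2) / N.
  rewrite -(real_normK (num_real eta)) exprM -exprMn -rr -expr_div_n.
  by apply: lerXn2r; rewrite ?nnegrE// divr_ge0 ?(ltW r0)// !mulr_ge0.
have e3 : (1 + `|eta|) ^+ M.+1 <= (1 + 2 * A) ^+ M.+1 * u ^+ (m.+1 * M.+1).
  rewrite exprM -exprMn; apply: lerXn2r; rewrite ?nnegrE//.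
  by rewrite mulr_ge0// addr_ge0// mulr_ge0.
apply: (@le_trans _ _ (s ^+ M.+1 * (M.+1%:R ^+ 2 *
   ((2 * A) ^+ 2 * u ^+ (m.+1 * 2) / N) *
   ((1 + 2 * A) ^+ M.+1 * u ^+ (m.+1 * M.+1))))).
  rewrite ler_wpM2l//; apply: ler_pM => //.
  - by rewrite mulr_ge0// sqr_ge0.
  - by rewrite ler_wpM2l// sqr_ge0.
rewrite [u ^+ (m + _ + _)]exprD [u ^+ (m + _)]exprD.
have := um m; have := um0 (m.+1 * 2)%N; have := um0 (m.+1 * M.+1)%N.
have : 0 <= (1 + 2 * A) ^+ M.+1 by rewrite exprn_ge0// addr_ge0// mulr_ge0.
move: sM0 (u ^+ m) (u ^+ (m.+1 * 2)) (u ^+ (m.+1 * M.+1)).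
move: (s ^+ M.+1) ((1 + 2 * A) ^+ M.+1) => S B S0 x y w B0 w0 y0 x1.
have -> : S * (M.+1%:R ^+ 2 * ((2 * A) ^+ 2 * y / N) * (B * w)) =
  M.+1%:R ^+ 2 * (2 * A) ^+ 2 * B / N * S * (1 * y * w) by ring.
apply: ler_wpM2l.
  by rewrite mulr_ge0// divr_ge0 ?(ltW N0)// !mulr_ge0 ?sqr_ge0.
by do 2 apply: ler_wpM2r => //.
Qed.

End growth.

(** * Adapted functions and martingale increments *)

Section adapted.
Context {R : realType} {d} {T : measurableType d}.

(** Going through the generated sigma-algebra gives a measurable type for any family [G], so the
    usual closure rules for [measurable_fun] apply; [meas_wrtP] returns to preimages when [G] is
    already a sigma-algebra. *)
Definition meas_wrt (G : set (set T)) (f : T -> R) : Prop :=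
  measurable_fun (setT : set (g_sigma_algebraType G)) f.

Lemma meas_wrt_sub (G H : set (set T)) (f : T -> R) :
  G `<=` H -> meas_wrt G f -> meas_wrt H f.
Proof.
move=> GH mf _ B mB; rewrite setTI.
have := mf measurableT B mB; rewrite setTI.
exact: sub_sigma_algebra2.
Qed.

Lemma meas_wrt_measurable (G : set (set T)) (f : T -> R) :
  G `<=` measurable -> meas_wrt G f -> measurable_fun setT f.
Proof.
move=> GT mf _ B mB; rewrite setTI.
have := mf measurableT B mB; rewrite setTI.
exact: (smallest_sub (@sigma_algebra_measurable _ T) GT).
Qed.

Lemma meas_wrtP (G : set (set T)) (f : T -> R) : sigma_algebra setT G ->
  meas_wrt G f <-> forall B, measurable B -> G (f @^-1` B).
Proof.
move=> sG; split => mf B mB.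
  have := mf measurableT B mB; rewrite setTI.
  by rewrite [X in X _ -> _](_ : _ = G)//; exact: sigma_algebra_id.
by move=> mB'; rewrite setTI; apply: sub_sigma_algebra; exact: mf.
Qed.

End adapted.

Section martingale.
Context {R : realType} {d} {T : measurableType d} (P : probability T R).
Variables (G : nat -> set (set T)) (z : nat -> T -> R) (kappa : nat -> R).
Hypothesis GT : forall n, G n `<=` measurable.
Hypothesis GS : forall n, G n `<=` G n.+1.
Hypothesis mz : forall n, meas_wrt (G n.+1) (z n).
Hypothesis zmoment : forall n j (f : T -> R), meas_wrt (G n) f ->
  (forall w, 0 <= f w) ->
  (\int[P]_w (f w * (1 + `|z n w|) ^+ j)%:E <=
   (kappa j)%:E * \int[P]_w (f w)%:E)%E.
Hypothesis zsym : forall n (f : T -> R), meas_wrt (G n) f ->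
  (forall w, 0 <= f w) ->
  (\int[P]_w (f w * Num.max (z n w) 0)%:E =
   \int[P]_w (f w * Num.max (- z n w) 0)%:E)%E.

Let mT n (f : T -> R) : meas_wrt (G n) f -> measurable_fun setT f.
Proof. exact: meas_wrt_measurable. Qed.

(** The vanishing mean of the martingale sum, without signed integrals. [X n] and [Y n] are the
    positive and negative parts of [b n * z n]; [zsym] equates their integrals and [zmoment] makes
    them finite. Adding the sum of the [Y n] to both sides leaves an inequality between nonnegative
    functions, and equal finite amounts cancel after integration. *)
Lemma expectation_drop_martingale (N : nat) (f h : T -> R) (b : nat -> T -> R) :
  measurable_fun setT f -> measurable_fun setT h ->
  (forall w, 0 <= f w) -> (forall w, 0 <= h w) ->
  (forall n, (n < N)%N -> meas_wrt (G n) (b n)) ->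
  (forall n, (n < N)%N -> (\int[P]_w `|b n w|%:E < +oo)%E) ->
  (forall w, f w <= h w + \sum_(n < N) b n w * z n w) ->
  (\int[P]_w (f w)%:E <= \int[P]_w (h w)%:E)%E.
Proof.
move=> mf mh f0 h0 mb bfin fh.
pose pos (x : R) : R := Num.max x 0.
have pos0 x : 0 <= pos x by rewrite le_max lexx orbT.
have mpos d' (T' : measurableType d') (g : T' -> R) :
    measurable_fun setT g -> measurable_fun setT (pos \o g).
  by move=> mg; apply: measurable_maxr.
have posE x : x = pos x - pos (- x).
  rewrite /pos; have [x0|x0] := leP 0 x.
    by rewrite max_r ?subr0// oppr_le0.
  by rewrite max_l ?opprK ?add0r// oppr_ge0 ltW.
pose bp n w : R := pos (b n w); pose bn n w : R := pos (- b n w).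
pose zp n w : R := pos (z n w); pose zn n w : R := pos (- z n w).
have mbp n : (n < N)%N -> meas_wrt (G n) (bp n) by move=> nN; exact: (mpos _ _ _ (mb n nN)).
have mbn n : (n < N)%N -> meas_wrt (G n) (bn n).
  by move=> nN; apply: mpos; apply: measurableT_comp => //; exact: mb.
have mzp n : measurable_fun setT (zp n) by exact: (mpos _ _ _ (mT (@mz n))).
have mzn n : measurable_fun setT (zn n).
  by apply: mpos; apply: measurableT_comp => //; exact: (mT (@mz n)).
have bp0 n w : 0 <= bp n w by exact: pos0.
have bn0 n w : 0 <= bn n w by exact: pos0.
have zp0 n w : 0 <= zp n w by exact: pos0.
have zn0 n w : 0 <= zn n w by exact: pos0.
pose X n w : R := bp n w * zp n w + bn n w * zn n w.
pose Y n w : R := bp n w * zn n w + bn n w * zp n w.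
have X0 n w : 0 <= X n w by rewrite addr_ge0// mulr_ge0.
have Y0 n w : 0 <= Y n w by rewrite addr_ge0// mulr_ge0.
have mX n : (n < N)%N -> measurable_fun setT (X n).
  move=> nN; apply: measurable_funD; apply: measurable_funM => //.
    exact: (mT (mbp n nN)).
  exact: (mT (mbn n nN)).
have mY n : (n < N)%N -> measurable_fun setT (Y n).
  move=> nN; apply: measurable_funD; apply: measurable_funM => //.
    exact: (mT (mbp n nN)).
  exact: (mT (mbn n nN)).
have XYE n : (n < N)%N -> (\int[P]_w (X n w)%:E = \int[P]_w (Y n w)%:E)%E.
  move=> nN; have ? := mT (mbp n nN); have ? := mT (mbn n nN).
  under eq_integral do rewrite EFinD.
  under [RHS]eq_integral do rewrite EFinD.
  rewrite !ge0_integralD//; try (by apply/measurable_EFinP/measurable_funM);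
    try (by move=> w _; rewrite lee_fin mulr_ge0).
  rewrite (zsym (mbp n nN))// (zsym (mbn n nN))//.
have Xfin n : (n < N)%N -> (\int[P]_w (X n w)%:E < +oo)%E.
  move=> nN; have ? := mT (mbp n nN); have ? := mT (mbn n nN).
  have mbabs : meas_wrt (G n) (fun w => `|b n w|).
    by apply: measurableT_comp => //; exact: mb.
  apply: (@le_lt_trans _ _ (\int[P]_w (`|b n w| * (1 + `|z n w|) ^+ 1)%:E)%E).
    apply: ge0_le_integral => //.
    - by move=> w _; rewrite lee_fin.
    - by apply/measurable_EFinP; exact: mX.
    - apply/measurable_EFinP/measurable_funM; first exact: mT mbabs.
      apply: measurable_funX; apply: measurable_funD => //.
      by apply: measurableT_comp => //; exact: (mT (@mz n)).
    - move=> w _; rewrite lee_fin expr1 /X /bp /bn /zp /zn /pos.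
      move: (b n w) (z n w) => x y.
      have := ler_norm x; have := ler_normr (- x) x; have := normr_ge0 x.
      have := ler_norm (- x); have := ler_norm y; have := ler_norm (- y).
      rewrite !normrN.
      by case: (leP x 0); case: (leP y 0); case: (leP (- x) 0);
        case: (leP (- y) 0) => *; nra.
  apply: le_lt_trans (zmoment 1 mbabs _) _ => //.
  have : (\int[P]_w (`|b n w|)%:E)%E \is a fin_num.
    rewrite ge0_fin_numE; first exact: bfin.
    by apply: integral_ge0 => w _; rewrite lee_fin.
  by move=> /fineK <-; rewrite -EFinM ltry.
pose SX w := \sum_(n < N) X n w; pose SY w := \sum_(n < N) Y n w.
have SX0 w : 0 <= SX w by apply: sumr_ge0.
have SY0 w : 0 <= SY w by apply: sumr_ge0.
have mSX : measurable_fun setT SX.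
  by apply: measurable_sum => n; exact: mX.
have mSY : measurable_fun setT SY.
  by apply: measurable_sum => n; exact: mY.
have intSX : (\int[P]_w (SX w)%:E = \sum_(n < N) \int[P]_w (X n w)%:E)%E.
  rewrite -ge0_integral_sum//.
  - by apply: eq_integral => w _; rewrite /SX sumEFin.
  - by move=> n; apply/measurable_EFinP; exact: mX.
  - by move=> n w _; rewrite lee_fin.
have intSY : (\int[P]_w (SY w)%:E = \int[P]_w (SX w)%:E)%E.
  rewrite intSX; under [RHS]eq_bigr do rewrite XYE//.
  rewrite -ge0_integral_sum//.
  - by apply: eq_integral => w _; rewrite /SY sumEFin.
  - by move=> n; apply/measurable_EFinP; exact: mY.
  - by move=> n w _; rewrite lee_fin.
have finSX : (\int[P]_w (SX w)%:E)%E \is a fin_num.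
  rewrite intSX; apply/sum_fin_numP => n _ _.
  rewrite ge0_fin_numE; first exact: Xfin.
  by apply: integral_ge0 => w _; rewrite lee_fin.
rewrite -(@leeD2rE _ _ _ _ finSX) -{1}intSY -!ge0_integralD//;
  try (by apply/measurable_EFinP);
  try (by move=> w _; rewrite lee_fin).
apply: ge0_le_integral => //.
- by move=> w _; rewrite -EFinD lee_fin addr_ge0.
- by apply/measurable_EFinP/measurable_funD.
- by apply/measurable_EFinP/measurable_funD.
- move=> w _; rewrite -!EFinD lee_fin.
  have -> : h w + SX w = h w + \sum_(n < N) b n w * z n w + SY w.
    rewrite -addrA -big_split/=; congr (_ + _); apply: eq_bigr => n _.
    rewrite {1}(posE (b n w)) {1}(posE (z n w)) /X /Y /bp /bn /zp /zn; ring.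
  by rewrite lerD2r.
Qed.

End martingale.

(** * A pathwise maximal inequality *)

Section running_max.
Context {R : realType}.

Lemma exprn_convex (k : nat) (s t : R) : 0 <= s -> 0 <= t ->
  s ^+ k.+1 + k.+1%:R * s ^+ k * (t - s) <= t ^+ k.+1.
Proof.
move=> s0 t0; elim: k => [|k IH]; first by rewrite !expr1 expr0; lra.
rewrite [leRHS]exprS; apply: le_trans (ler_wpM2l t0 IH).
have sk0 : 0 <= s ^+ k by rewrite exprn_ge0.
rewrite !exprS -(natr1 k.+1) -(natr1 k).
have k0 : 0 <= k%:R :> R by [].
move: (s ^+ k) sk0 (k%:R) k0 => u u0 c c0.
have : 0 <= u * (c + 1) * (t - s) ^+ 2.
  apply: mulr_ge0; last exact: sqr_ge0.
  by apply: mulr_ge0 => //; rewrite addr_ge0.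
nra.
Qed.

(** Starting from [max 0 (s 0)] makes the value nonnegative for every sequence, as monotonicity of
    its powers demands. *)
Fixpoint running_max (s : nat -> R) (n : nat) : R :=
  if n is m.+1 then Num.max (running_max s m) (s n) else Num.max 0 (s 0).

Lemma running_maxS (s : nat -> R) n :
  running_max s n.+1 = Num.max (running_max s n) (s n.+1).
Proof. by []. Qed.

Lemma running_max0 (s : nat -> R) : 0 <= s 0 -> running_max s 0 = s 0.
Proof. by move=> s0; rewrite /= max_r. Qed.

Lemma running_max_ge (s : nat -> R) n i : (i <= n)%N -> s i <= running_max s n.
Proof.
elim: n => [|n IH].
  rewrite leqn0 => /eqP ->.
  by rewrite /= le_max lexx orbT.
rewrite running_maxS leq_eqVlt => /predU1P[->|]; rewrite le_max ?lexx ?orbT//.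
by rewrite ltnS => /IH ->.
Qed.

Lemma running_max_ge0 (s : nat -> R) n : 0 <= running_max s n.
Proof.
elim: n => [|n IH]; last by rewrite running_maxS le_max IH.
by rewrite /= le_max lexx.
Qed.

Lemma running_max_exists (s : nat -> R) n : (forall i, (i <= n)%N -> 0 <= s i) ->
  exists2 i, (i <= n)%N & running_max s n = s i.
Proof.
elim: n => [|n IH] s0; first by exists 0%N => //; rewrite running_max0// s0.
rewrite running_maxS; case: leP => _; first by exists n.+1.
have [i ni ->] := IH (fun i ni => s0 i (leqW ni)).
by exists i => //; exact: leqW.
Qed.

(* A pathwise form of Doob's L^2 maximal inequality for the powers s^(k+1). *)
Lemma doob_pathwise (k N : nat) (s x : nat -> R) :
  (forall n, (n <= N)%N -> 0 <= s n) ->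
  (forall n, (n < N)%N -> s n + x n <= s n.+1) ->
  running_max s N ^+ (k.+1 * 2) <= 4 * s N ^+ (k.+1 * 2) +
    \sum_(n < N) (- (4 * k.+1%:R * running_max s n ^+ k.+1 * s n ^+ k) * x n).
Proof.
move=> s0 sx.
(* Summation by parts for the squared maximum; convexity of the power turns increments of
   [s ^+ k.+1] into multiples of [x n]. *)
have A : (running_max s N ^+ k.+1) ^+ 2 <=
    2 * s N ^+ k.+1 * running_max s N ^+ k.+1 -
    2 * k.+1%:R * \sum_(n < N) running_max s n ^+ k.+1 * s n ^+ k * x n.
  elim: N s0 sx => [|N IH] s0 sx.
    rewrite big_ord0 mulr0 subr0 running_max0 ?s0//.
    have := sqr_ge0 (s 0 ^+ k.+1); nra.
  have {}IH := IH (fun n nN => s0 n (leqW nN)) (fun n nN => sx n (leqW nN)).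
  rewrite big_ord_recr/=.
  have cv := exprn_convex k (s0 N (leqnSn N)) (s0 N.+1 (leqnn _)).
  have sk0 : 0 <= s N ^+ k by rewrite exprn_ge0// s0.
  have sx' : k.+1%:R * s N ^+ k * x N <= k.+1%:R * s N ^+ k * (s N.+1 - s N).
    by apply: ler_wpM2l; rewrite ?mulr_ge0// lerBrDl sx.
  have p0 : 0 <= running_max s N ^+ k.+1 by rewrite exprn_ge0// running_max_ge0.
  have s'0 : 0 <= s N.+1 ^+ k.+1 by rewrite exprn_ge0// s0.
  have pp : running_max s N ^+ k.+1 <= running_max s N.+1 ^+ k.+1.
    apply: lerXn2r; rewrite ?nnegrE ?running_max_ge0//.
    by rewrite running_maxS le_max lexx.
  (* The maximum moves only when [s N.+1] becomes the new maximum, so the sum of the two powers is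
     then at most [2 * s N.+1 ^+ k.+1]. *)
  have key : (running_max s N.+1 ^+ k.+1 - running_max s N ^+ k.+1) *
      (running_max s N.+1 ^+ k.+1 + running_max s N ^+ k.+1) <=
      2 * s N.+1 ^+ k.+1 * (running_max s N.+1 ^+ k.+1 - running_max s N ^+ k.+1).
    move: pp; rewrite running_maxS; case: (leP (running_max s N) (s N.+1)) => _ pp; last first.
      by rewrite subrr mulr0 mul0r.
    rewrite [leRHS]mulrC; apply: ler_wpM2l; first by rewrite subr_ge0.
    by rewrite mulr_natl mulr2n lerD2l.
  move: IH key cv sx' p0 pp.
  set S := \sum_(n < N) _.
  move: (running_max s N.+1 ^+ k.+1) (running_max s N ^+ k.+1) => p' p.
  move: (s N.+1 ^+ k.+1) (s N ^+ k.+1) => y' y.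
  rewrite -!mulrA; set w := _ * x N; set v := _ * (s N.+1 - s N).
  move=> IH key cv sx' p0 pp.
  have : p * (k.+1%:R * w) <= p * (y' - y).
    by apply: ler_wpM2l => //; lra.
  rewrite mulrDr; nra.
rewrite (_ : \sum_(n < N) (- _ * _) = - (4 * k.+1%:R *
  \sum_(n < N) running_max s n ^+ k.+1 * s n ^+ k * x n)); last first.
  by rewrite mulr_sumr -sumrN; apply: eq_bigr => n _; ring.
move: A; rewrite !exprM; move: (\sum_(n < N) _) => S.
move: (running_max s N ^+ k.+1) (s N ^+ k.+1) => p y.
(* The square gives [2 y p <= p^2 / 2 + 2 y^2]; absorbing [p^2 / 2] on the left doubles the rest,
   whence the factor 4. *)
have := sqr_ge0 (p - 2 * y); nra.
Qed.

End running_max.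

(** Growth rate of the moment of order [M.+1]: the coefficient of [1 / N] in [step_growth] times the
    bound for the moment of [1 + |z|] that occurs there. *)
Definition growth_const {R : realType} (kappa : nat -> R) (m : nat) (A : R)
    (M : nat) : R :=
  (M.+1%:R * A + M.+1%:R ^+ 2 * (2 * A) ^+ 2 * (1 + 2 * A) ^+ M.+1) *
  kappa (m + m.+1 * 2 + m.+1 * M.+1)%N.

(** * Moments of the normalised recursion *)

Section moment_bound.
Context {R : realType} {d} {T : measurableType d} (P : probability T R).
Variables (G : nat -> set (set T)) (z : nat -> T -> R) (kappa : nat -> R).
Hypothesis GT : forall n, G n `<=` measurable.
Hypothesis GS : forall n, G n `<=` G n.+1.
Hypothesis mz : forall n, meas_wrt (G n.+1) (z n).
Hypothesis kappa0 : forall j, 0 <= kappa j.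
Hypothesis zmoment : forall n j (f : T -> R), meas_wrt (G n) f ->
  (forall w, 0 <= f w) ->
  (\int[P]_w (f w * (1 + `|z n w|) ^+ j)%:E <=
   (kappa j)%:E * \int[P]_w (f w)%:E)%E.
Hypothesis zsym : forall n (f : T -> R), meas_wrt (G n) f ->
  (forall w, 0 <= f w) ->
  (\int[P]_w (f w * Num.max (z n w) 0)%:E =
   \int[P]_w (f w * Num.max (- z n w) 0)%:E)%E.

Variables (N m : nat) (A lam : R) (a s : nat -> T -> R).
Hypothesis N0 : (0 < N)%N.
Hypothesis A0 : 0 <= A.
Hypothesis ma : forall n, meas_wrt (G n) (a n).
Hypothesis s0E : forall w, s 0 w = lam.
Hypothesis sSE : forall n w,
  s n.+1 w = s n w + a n w * z n w + A / N%:R * (1 + `|z n w|) ^+ m.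
Hypothesis s_ge1 : forall n w, (n <= N)%N -> 1 <= s n w.
Hypothesis a_le : forall n w, (n < N)%N -> `|a n w| <= A * s n w / Num.sqrt N%:R.

Local Notation gconst := (growth_const kappa m A).

Let mT n (f : T -> R) : meas_wrt (G n) f -> measurable_fun setT f.
Proof. exact: meas_wrt_measurable. Qed.

Let s_ge0 n w : (n <= N)%N -> 0 <= s n w.
Proof. by move=> nN; apply: le_trans (s_ge1 w nN). Qed.

Let growth_const0 M : 0 <= gconst M.
Proof.
rewrite mulr_ge0// addr_ge0 ?mulr_ge0 ?sqr_ge0//.
by rewrite exprn_ge0// addr_ge0// mulr_ge0.
Qed.

Let mu n : measurable_fun setT (fun w => 1 + `|z n w|).
Proof.
apply: measurable_funD => //; apply: measurableT_comp => //.
exact: (mT (@mz n)).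
Qed.

Lemma recursion_adapted n : meas_wrt (G n) (s n).
Proof.
elim: n => [|n IH].
  rewrite /meas_wrt (_ : s 0 = cst lam); first exact: measurable_cst.
  by apply/funext => w; rewrite s0E.
rewrite /meas_wrt (_ : s n.+1 = fun w =>
  s n w + a n w * z n w + A / N%:R * (1 + `|z n w|) ^+ m); last first.
  by apply/funext => w; rewrite sSE.
have mzn : meas_wrt (G n.+1) (z n) := @mz n.
apply: measurable_funD.
  apply: measurable_funD; first exact: (meas_wrt_sub (@GS n)).
  by apply: measurable_funM => //; exact: (meas_wrt_sub (@GS n) (@ma n)).
apply: measurable_funM => //; apply: measurable_funX.
by apply: measurable_funD => //; exact: measurableT_comp.
Qed.

Let ms n : meas_wrt (G n) (s n) := @recursion_adapted n.

Lemma running_max_adapted n : meas_wrt (G n) (fun w => running_max (s^~ w) n).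
Proof.
elim: n => [|n IH] /=; first by apply: measurable_maxr => //; exact: ms.
by apply: measurable_maxr; [exact: (meas_wrt_sub (@GS n) IH)|exact: ms].
Qed.

Let msX n M : meas_wrt (G n) (fun w => s n w ^+ M).
Proof. by apply: measurable_funX; exact: ms. Qed.

Let N1 : 1 <= N%:R :> R.
Proof. by rewrite ler1n. Qed.

Let sqN1 : 1 <= Num.sqrt N%:R :> R.
Proof. by rewrite -[leLHS](sqrtr1 R) ler_wsqrtr. Qed.

Let sX_ge0 n M w : (n <= N)%N -> 0 <= s n w ^+ M.
Proof. by move=> nN; rewrite exprn_ge0// s_ge0. Qed.

Let int_ge0 n M : (n <= N)%N -> (0 <= \int[P]_w (s n w ^+ M)%:E)%E.
Proof. by move=> nN; apply: integral_ge0 => w _; rewrite lee_fin sX_ge0. Qed.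

(** A crude bound, multiplied by a fixed constant at every step and hence useless for large [N]. It
    serves to know that the coefficients are integrable before martingale terms are dropped in the
    sharp estimate. *)
Let smoment_fin n M : (n <= N)%N -> (\int[P]_w (s n w ^+ M)%:E < +oo)%E.
Proof.
elim: n => [|n IH] nN.
  under eq_integral do rewrite s0E.
  by rewrite integral_cst//= probability_setT mule1 ltry.
pose c := (1 + 2 * A) ^+ M.
have c0 : 0 <= c by rewrite exprn_ge0// addr_ge0// mulr_ge0.
apply: (@le_lt_trans _ _ (\int[P]_w
    (c%:E * (s n w ^+ M * (1 + `|z n w|) ^+ (m.+1 * M))%:E))%E).
  apply: ge0_le_integral => //.
  - by move=> w _; rewrite lee_fin sX_ge0.
  - by apply/measurable_EFinP; exact: (mT (@msX _ _)).
  - apply/measurable_EFinP/measurable_funM => //; apply: measurable_funM.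
      exact: (mT (@msX _ _)).
    exact: measurable_funX.
  - move=> w _; rewrite -EFinM lee_fin /c exprM.
    have [+ _] := @step_growth _ 0 m A N%:R (s n w) (a n w) (z n w) A0 N1
      (s_ge1 w (ltnW nN)) (a_le w nN)
      (eq_ind _ (fun x => 0 <= x) (s_ge0 w nN) _ (sSE n w)).
    rewrite -sSE => h.
    rewrite mulrCA -!exprMn; apply: lerXn2r => //; rewrite nnegrE ?s_ge0//.
    by rewrite !mulr_ge0 ?s_ge0 ?addr_ge0 ?exprn_ge0 ?mulr_ge0// ltnW.
rewrite ge0_integralZl_EFin//; last 2 first.
- by move=> w _; rewrite lee_fin mulr_ge0 ?sX_ge0 ?exprn_ge0 ?addr_ge0// ltnW.
- apply/measurable_EFinP; apply: measurable_funM.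
    exact: (mT (@msX _ _)).
  exact: measurable_funX.
have zm := @zmoment n (m.+1 * M) _ (@msX n M) (fun w => sX_ge0 M w (ltnW nN)).
apply: (le_lt_trans (lee_wpmul2l _ zm)); first by rewrite lee_fin.
have fin : (\int[P]_w (s n w ^+ M)%:E)%E \is a fin_num.
  by rewrite ge0_fin_numE ?int_ge0 ?IH// ltnW.
by rewrite -(fineK fin) -!EFinM ltry.
Qed.

Let fin n M : (n <= N)%N -> (\int[P]_w (s n w ^+ M)%:E)%E \is a fin_num.
Proof. by move=> nN; rewrite ge0_fin_numE ?int_ge0 ?smoment_fin. Qed.

Let smoment_step n M : (n < N)%N ->
  (\int[P]_w (s n.+1 w ^+ M.+1)%:E <=
   (1 + gconst M / N%:R)%:E * \int[P]_w (s n w ^+ M.+1)%:E)%E.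
Proof.
move=> nN; have nN' := ltnW nN.
pose K : R := M.+1%:R * A + M.+1%:R ^+ 2 * (2 * A) ^+ 2 * (1 + 2 * A) ^+ M.+1.
pose J := (m + m.+1 * 2 + m.+1 * M.+1)%N.
have K0 : 0 <= K / N%:R.
  rewrite divr_ge0// addr_ge0 ?mulr_ge0 ?sqr_ge0//.
  by rewrite exprn_ge0// addr_ge0// mulr_ge0.
(* [expectation_drop_martingale] treats a sum over steps; here only the summand of step [n] is
   present. *)
pose b k w : R := if k == n then M.+1%:R * s n w ^+ M * a n w else 0.
pose h w : R := s n w ^+ M.+1 + K / N%:R * (s n w ^+ M.+1 * (1 + `|z n w|) ^+ J).
have mbn : meas_wrt (G n) (fun w => M.+1%:R * s n w ^+ M * a n w).
  apply: measurable_funM; last exact: ma.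
  by apply: measurable_funM => //; exact: msX.
have mu2 : measurable_fun setT (fun w => s n w ^+ M.+1 * (1 + `|z n w|) ^+ J).
  apply: measurable_funM; first exact: (mT (@msX _ _)).
  exact: measurable_funX.
have pos2 w : 0 <= s n w ^+ M.+1 * (1 + `|z n w|) ^+ J.
  by rewrite mulr_ge0 ?sX_ge0 ?exprn_ge0 ?addr_ge0.
apply: (@le_trans _ _ (\int[P]_w (h w)%:E)%E).
  apply: (@expectation_drop_martingale _ _ _ P G z kappa GT mz zmoment zsym
    n.+1 _ _ b).
  - exact: (mT (@msX _ _)).
  - apply: measurable_funD; first exact: (mT (@msX _ _)).
    exact: measurable_funM.
  - by move=> w; rewrite sX_ge0.
  - by move=> w; rewrite addr_ge0 ?sX_ge0// mulr_ge0.
  - move=> k _; rewrite /b; have [->|kn] := eqVneq k n; first exact: mbn.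
    exact: measurable_cst.
  - move=> k _; rewrite /b; have [_|_] := eqVneq k n; last first.
      by under eq_integral do rewrite normr0; rewrite integral0.
    apply: (@le_lt_trans _ _ (\int[P]_w ((M.+1%:R * A)%:E * (s n w ^+ M.+1)%:E))%E).
      apply: ge0_le_integral => //.
      + by apply/measurable_EFinP; apply: measurableT_comp => //; exact: (mT mbn).
      + apply/measurable_EFinP/measurable_funM => //; exact: (mT (@msX _ _)).
      + move=> w _; rewrite -EFinM lee_fin !normrM.
        rewrite ger0_norm// ger0_norm ?sX_ge0//.
        rewrite -!mulrA; apply: ler_wpM2l => //.
        rewrite exprSr mulrCA; apply: ler_wpM2l; first by rewrite sX_ge0.
        apply: (le_trans (a_le w nN)); rewrite ler_pdivrMr ?sqrtr_gt0 ?ltr0n//.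
        apply: ler_peMr; first by rewrite mulr_ge0// s_ge0.
        exact: sqN1.
    rewrite ge0_integralZl_EFin//; last 3 first.
    + by move=> w _; rewrite lee_fin sX_ge0.
    + by apply/measurable_EFinP; exact: (mT (@msX _ _)).
    + by rewrite mulr_ge0.
    by rewrite -(fineK (@fin n M.+1 nN')) -EFinM ltry.
  - move=> w; rewrite big_ord_recr/= big1 ?add0r; last first.
      by move=> i _; rewrite /b ltn_eqF ?mul0r.
    have [_] := @step_growth _ M m A N%:R (s n w) (a n w) (z n w) A0 N1
      (s_ge1 w (ltnW nN)) (a_le w nN)
      (eq_ind _ (fun x => 0 <= x) (s_ge0 w nN) _ (sSE n w)).
    by rewrite -sSE /h /b eqxx -/K -/J [leRHS]addrAC.
under eq_integral do rewrite EFinD.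
rewrite ge0_integralD//; last 4 first.
- by move=> w _; rewrite lee_fin sX_ge0.
- by apply/measurable_EFinP; exact: (mT (@msX _ _)).
- by move=> w _; rewrite lee_fin mulr_ge0.
- by apply/measurable_EFinP; apply: measurable_funM.
rewrite EFinD ge0_muleDl ?lee_fin ?divr_ge0// mul1e; apply: leeD2l.
under eq_integral do rewrite EFinM.
rewrite ge0_integralZl_EFin//; last 2 first.
- by move=> w _; rewrite lee_fin.
- exact/measurable_EFinP.
have zm := @zmoment n J _ (@msX n M.+1) (fun w => sX_ge0 M.+1 w (ltnW nN)).
apply: (le_trans (lee_wpmul2l _ zm)); first by rewrite lee_fin.
by rewrite muleA -EFinM /growth_const -/K -/J mulrAC.
Qed.

(** Discrete Gronwall: [N] factors [1 + gconst M / N] multiply to at most [expR (gconst M)], so the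
    number of steps disappears. *)
Let smoment M : (\int[P]_w (s N w ^+ M.+1)%:E <=
  (expR (gconst M) * lam ^+ M.+1)%:E)%E.
Proof.
pose q : R := 1 + gconst M / N%:R.
have q0 : 0 <= q by rewrite addr_ge0// divr_ge0.
have lam0 : 0 <= lam by rewrite -(s0E point) s_ge0.
have H n : (n <= N)%N -> (\int[P]_w (s n w ^+ M.+1)%:E <=
    (q ^+ n * lam ^+ M.+1)%:E)%E.
  elim: n => [|n IH] nN.
    under eq_integral do rewrite s0E.
    by rewrite integral_cst//= probability_setT mule1 expr0 mul1r.
  apply: (le_trans (smoment_step M nN)); rewrite -/q exprS -mulrA EFinM.
  by apply: lee_wpmul2l; rewrite ?lee_fin ?IH// ltnW.
apply: (le_trans (H N (leqnn _))); rewrite lee_fin.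
apply: ler_wpM2r; first by rewrite exprn_ge0.
have -> : expR (gconst M) = expR (gconst M / N%:R) ^+ N.
  by rewrite -expRM_natr divfK// pnatr_eq0 -lt0n.
by apply: lerXn2r; rewrite ?nnegrE ?expR_ge0// expR_ge1Dx.
Qed.

(** The drift is nonnegative, so [doob_pathwise] applies with [x n = a n * z n]. Its sum is again of
    martingale type and drops out, leaving the terminal moment of order [k.+1 * 2 = k.*2.+2]. *)
Lemma running_max_moment (k : nat) :
  (\int[P]_w (running_max (s^~ w) N ^+ (k.+1 * 2))%:E <=
   (4 * expR (gconst (k.*2.+1)) * lam ^+ (k.+1 * 2))%:E)%E.
Proof.
have k2 : (k.+1 * 2 = k.*2.+2)%N by rewrite muln2 doubleS.
(* The power of the maximum is one of the summands; this serves integrability only. *)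
have rm_le n w M : (n <= N)%N ->
    running_max (s^~ w) n ^+ M <= \sum_(i < n.+1) s i w ^+ M.
  move=> nN; have [i|i ni ->] := @running_max_exists _ (s^~ w) n.
    by move=> ni; rewrite s_ge0// (leq_trans ni).
  rewrite (bigD1 (inord i))//= inordK ?ltnS// lerDl sumr_ge0// => j _.
  by rewrite sX_ge0// -ltnS (leq_trans (ltn_ord j)).
have rm_fin n M : (n <= N)%N ->
    (\int[P]_w (running_max (s^~ w) n ^+ M)%:E < +oo)%E.
  move=> nN; apply: (@le_lt_trans _ _
      (\int[P]_w (\sum_(i < n.+1) (s i w ^+ M)%:E))%E).
    apply: ge0_le_integral => //.
    - by move=> w _; rewrite lee_fin exprn_ge0// running_max_ge0.
    - by apply/measurable_EFinP/measurable_funX; exact: (mT (@running_max_adapted n)).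
    - apply: emeasurable_sum => i; apply/measurable_EFinP.
      exact: (mT (@msX _ _)).
    - by move=> w _; rewrite sumEFin lee_fin rm_le.
  rewrite ge0_integral_sum//; last 2 first.
  - by move=> i; apply/measurable_EFinP; exact: (mT (@msX _ _)).
  - move=> i w _; rewrite lee_fin sX_ge0//.
    by rewrite -ltnS (leq_trans (ltn_ord i)).
  apply: lte_sum_pinfty => i _; apply: smoment_fin.
  by rewrite -ltnS (leq_trans (ltn_ord i)).
apply: (@le_trans _ _ (\int[P]_w (4 * s N w ^+ (k.+1 * 2))%:E)%E).
  apply: (@expectation_drop_martingale _ _ _ P G z kappa GT mz zmoment zsym
    N _ _ (fun n w => - (4 * k.+1%:R * running_max (s^~ w) n ^+ k.+1 * s n w ^+ k)
       * a n w)).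
  - by apply: measurable_funX; exact: (mT (@running_max_adapted N)).
  - by apply: measurable_funM => //; exact: (mT (@msX _ _)).
  - by move=> w; rewrite exprn_ge0// running_max_ge0.
  - by move=> w; rewrite mulr_ge0// sX_ge0.
  - move=> n nN; apply: measurable_funM; last exact: ma.
    apply: measurableT_comp => //; apply: measurable_funM; last exact: msX.
    by apply: measurable_funM => //; apply: measurable_funX; exact: running_max_adapted.
  - move=> n nN; have nN' := ltnW nN.
    apply: (@le_lt_trans _ _ (\int[P]_w ((4 * k.+1%:R * A)%:E *
      (running_max (s^~ w) n ^+ (k.+1 * 2))%:E))%E).
      apply: ge0_le_integral => //.
      + apply/measurable_EFinP; apply: measurableT_comp => //.
        apply: measurable_funM; last exact: (mT (@ma n)).
        apply: measurableT_comp => //; apply: measurable_funM.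
          apply: measurable_funM => //; apply: measurable_funX.
          exact: (mT (@running_max_adapted n)).
        exact: (mT (@msX _ _)).
      + apply/measurable_EFinP/measurable_funM => //.
        by apply: measurable_funX; exact: (mT (@running_max_adapted n)).
      + move=> w _; rewrite -EFinM lee_fin normrM normrN.
        set r := running_max _ _.
        have r0 : 0 <= r by exact: running_max_ge0.
        have sr : s n w <= r by exact: (@running_max_ge _ (s^~ w)).
        rewrite [X in X * _]ger0_norm; last by rewrite !mulr_ge0 ?exprn_ge0 ?s_ge0.
        have aA : `|a n w| <= A * r.
          apply: (le_trans (a_le w nN)); rewrite ler_pdivrMr ?sqrtr_gt0 ?ltr0n//.
          apply: (@le_trans _ _ (A * r)); first exact: ler_wpM2l.
          apply: ler_peMr; first by rewrite mulr_ge0.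
          exact: sqN1.
        have sk : s n w ^+ k <= r ^+ k.
          by apply: lerXn2r; rewrite ?nnegrE ?s_ge0.
        apply: (@le_trans _ _ (4 * k.+1%:R * r ^+ k.+1 * r ^+ k * (A * r))).
          apply: ler_pM => //; first by rewrite !mulr_ge0 ?exprn_ge0 ?s_ge0.
          by apply: ler_wpM2l => //; rewrite !mulr_ge0 ?exprn_ge0.
        rewrite exprM [r ^+ k.+1 ^+ 2]expr2 {2}(exprSr r k).
        by rewrite le_eqVlt; apply/orP; left; apply/eqP; ring.
    rewrite ge0_integralZl_EFin//; last 3 first.
    + by move=> w _; rewrite lee_fin exprn_ge0// running_max_ge0.
    + apply/measurable_EFinP; apply: measurable_funX; exact: (mT (@running_max_adapted n)).
    + by rewrite !mulr_ge0.
    have /fineK <- : (\int[P]_w (running_max (s^~ w) n ^+ (k.+1 * 2))%:E)%E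
        \is a fin_num.
      rewrite ge0_fin_numE ?rm_fin//.
      apply: integral_ge0 => w _.
      by rewrite lee_fin exprn_ge0// running_max_ge0.
    by rewrite -EFinM ltry.
  - move=> w.
    under eq_bigr do rewrite -[_ * z _ w]mulrA.
    apply: (@doob_pathwise _ k N (s^~ w) (fun n => a n w * z n w)) => n nN.
      by rewrite s_ge0.
    rewrite sSE lerDl mulr_ge0 ?divr_ge0// exprn_ge0// addr_ge0//.
under eq_integral do rewrite EFinM.
rewrite ge0_integralZl_EFin//; last 2 first.
- by move=> w _; rewrite lee_fin sX_ge0.
- by apply/measurable_EFinP; exact: (mT (@msX _ _)).
rewrite -mulrA EFinM k2; apply: lee_wpmul2l; first by rewrite lee_fin.
exact: smoment.
Qed.

End moment_bound.

(** * Comparison of integrals, and Wiener increments on the time grid *)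

Section nonmeasurable.
Context {R : realType} {d} {T : measurableType d} (mu : {measure set T -> \bar R}).

(* The integral of a nonnegative function is a supremum over simple functions
   below it, hence monotone even if the smaller function is not measurable. *)
Lemma le_integral_nonmeasurable (f g : T -> R) :
  (forall x, 0 <= f x) -> (forall x, 0 <= g x) -> measurable_fun setT g ->
  {ae mu, forall x, f x <= g x} ->
  (\int[mu]_x (f x)%:E <= \int[mu]_x (g x)%:E)%E.
Proof.
move=> f0 g0 mg [N [mN N0 Nsub]].
(* Adding infinity on the exceptional null set makes the comparison hold everywhere and leaves the
   integral of [g] unchanged. *)
pose h x : \bar R := ((g x)%:E + (cst +oo%E \_ N) x)%E.
have r0 x : (0 <= (cst (+oo%E : \bar R) \_ N) x)%E.
  by rewrite patchE; case: ifP => _ //=; exact: leey.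
have h0 x : (0 <= h x)%E by rewrite adde_ge0// lee_fin.
have mh : measurable_fun setT h.
  apply: emeasurable_funD; first exact/measurable_EFinP.
  exact/(measurable_restrictT _ mN).
apply: (@le_trans _ _ (\int[mu]_x h x)%E).
  rewrite !ge0_integralTE//; apply: ereal_sup_le => /= _ [k kf <-].
  exists k => // x; apply: (le_trans (kf x)); rewrite /h patchE.
  case: ifPn => [_|]; first by rewrite addey// leey.
  rewrite notin_setE => Nx; rewrite adde0 lee_fin.
  by apply: contrapT => fg; apply: Nx; apply: Nsub.
rewrite le_eqVlt; apply/orP; left; apply/eqP.
apply: ge0_ae_eq_integral => //; first exact/measurable_EFinP.
  by move=> x _; rewrite lee_fin.
exists N; split => // x /= hx; apply: contrapT => Nx; apply: hx => _.
by rewrite /h patchE memNset// adde0.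
Qed.
End nonmeasurable.

Section wiener_increments.
Context {R : realType} {dO : measure_display} {Om : measurableType dO}.
Variables (P : probability Om R) (F : R -> set (set Om)) (W : R -> Om -> R).
Hypothesis hF : usual_filtration P F.
Hypothesis hW : wiener P F W.
Variable tau : R.
Hypothesis tau0 : 0 < tau.

Definition grid_filtration (n : nat) : set (set Om) := F (n%:R * tau).

(** Division by [sqrt tau] gives unit variance, so that moment bounds do not see the time step. *)
Definition scaled_increment (n : nat) (w : Om) : R :=
  (W (n.+1%:R * tau) w - W (n%:R * tau) w) / Num.sqrt tau.

Lemma grid_ge0 (n : nat) : 0 <= n%:R * tau.
Proof. by rewrite mulr_ge0// ltW. Qed.

Lemma grid_filtration_sigma n : sigma_algebra setT (grid_filtration n).
Proof. by have [/(_ _ (grid_ge0 n))[]] := hF. Qed.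

Lemma grid_filtration_measurable n : grid_filtration n `<=` measurable.
Proof. by have [/(_ _ (grid_ge0 n))[]] := hF. Qed.

Lemma grid_filtration_le n m : (n <= m)%N ->
  grid_filtration n `<=` grid_filtration m.
Proof.
move=> nm; have [_ Fle _ _] := hF; apply: Fle; first exact: grid_ge0.
by apply: ler_wpM2r; rewrite ?ler_nat// ltW.
Qed.

Lemma wiener_meas (n : nat) : meas_wrt (grid_filtration n) (W (n%:R * tau)).
Proof.
have [_ WF _ _] := hW.
apply/(meas_wrtP _ (grid_filtration_sigma n)) => B mB.
by apply: WF => //; exact: grid_ge0.
Qed.

Lemma increment_meas n : meas_wrt (grid_filtration n.+1)
  (fun w => W (n.+1%:R * tau) w - W (n%:R * tau) w).
Proof.
apply: measurable_funB; first exact: wiener_meas.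
exact: (meas_wrt_sub (grid_filtration_le (leqnSn n)) (@wiener_meas n)).
Qed.

Lemma scaled_increment_meas n :
  meas_wrt (grid_filtration n.+1) (scaled_increment n).
Proof. by apply: measurable_funM => //; exact: increment_meas. Qed.

Let s0 : 0 < Num.sqrt tau. Proof. by rewrite sqrtr_gt0. Qed.

(** Independence from events at time [n * tau] passes to functions by [integral_prod_indep], and the
    law of the increment turns the second factor into a Gaussian integral. *)
Lemma increment_indep n (f : Om -> R) (g : R -> R) :
  meas_wrt (grid_filtration n) f -> (forall w, 0 <= f w) ->
  measurable_fun setT g -> (forall x, 0 <= g x) ->
  (\int[P]_w (f w * g (W (n.+1%:R * tau) w - W (n%:R * tau) w)%R)%:E =
   \int[P]_w (f w)%:E * \int[normal_prob 0 (Num.sqrt tau)]_x (g x)%:E)%E.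
Proof.
move=> mf f0 mg g0.
have [_ _ _ WI] := hW.
have lt_grid : n%:R * tau < n.+1%:R * tau by rewrite ltr_pM2r// ltr_nat.
have [law ind] := WI _ _ (grid_ge0 n) lt_grid.
have dt : n.+1%:R * tau - n%:R * tau = tau.
  by rewrite -mulrBl -natrB// subSnn mul1r.
have mD := meas_wrt_measurable (@grid_filtration_measurable n.+1)
  (@increment_meas n).
rewrite integral_prod_indep//.
- congr (_ * _)%E.
  pose D' : {mfun Om >-> measurableTypeR R} := HB.pack
    (fun w => W (n.+1%:R * tau) w - W (n%:R * tau) w : measurableTypeR R)
    (isMeasurableFun.Build _ _ Om (measurableTypeR R) _ mD).
  transitivity (\int[distribution P D']_x (g x)%:E)%E.
    rewrite ge0_integral_pushforward//=; first exact/measurable_EFinP.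
    by move=> x _; rewrite lee_fin.
  by apply: eq_measure_integral => A mA _; rewrite -dt; exact: law.
- exact: (meas_wrt_measurable (@grid_filtration_measurable n) mf).
- move=> A B mA mB; apply: ind => //.
  exact: ((meas_wrtP f (grid_filtration_sigma n)).1 mf A mA).
Qed.

Lemma scaled_increment_moment n j (f : Om -> R) :
  meas_wrt (grid_filtration n) f -> (forall w, 0 <= f w) ->
  (\int[P]_w (f w * (1 + `|scaled_increment n w|) ^+ j)%:E <=
   (expR (j%:R ^+ 2) * Num.sqrt 2)%:E * \int[P]_w (f w)%:E)%E.
Proof.
move=> mf f0.
pose g (x : R) := (1 + `|x| / Num.sqrt tau) ^+ j.
have g0 x : 0 <= g x by rewrite exprn_ge0// addr_ge0// divr_ge0// ltW.
have mg : measurable_fun setT g.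
  apply: measurable_funX; apply: measurable_funD => //.
  by apply: measurable_funM => //; exact: measurableT_comp.
have := increment_indep mf f0 mg g0.
under eq_integral do rewrite /g -[in X in _ + X](gtr0_norm s0) -normf_div.
move=> ->; rewrite muleC; apply: lee_wpmul2r.
  by apply: integral_ge0 => w _; rewrite lee_fin.
exact: normal_prob_moment.
Qed.

Lemma scaled_increment_sym n (f : Om -> R) :
  meas_wrt (grid_filtration n) f -> (forall w, 0 <= f w) ->
  (\int[P]_w (f w * Num.max (scaled_increment n w) 0)%:E =
   \int[P]_w (f w * Num.max (- scaled_increment n w) 0)%:E)%E.
Proof.
move=> mf f0.
have mh : meas_wrt (grid_filtration n) (fun w => f w / Num.sqrt tau).
  exact: measurable_funM.
have h0 w : 0 <= f w / Num.sqrt tau by rewrite divr_ge0// ltW.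
have E (x y : R) : x * Num.max (y / Num.sqrt tau) 0 =
    x / Num.sqrt tau * Num.max y 0.
  rewrite -mulrA; congr (_ * _); rewrite [RHS]mulrC maxr_pMl ?invr_ge0 ?(ltW s0)//.
  by rewrite mul0r.
rewrite /scaled_increment.
under eq_integral do rewrite E.
under [RHS]eq_integral do rewrite -mulNr E.
rewrite (@increment_indep n _ (fun x => Num.max x 0) mh h0); last 2 first.
- exact: measurable_maxr.
- by move=> x; rewrite le_max lexx orbT.
rewrite (@increment_indep n _ (fun x => Num.max (- x) 0) mh h0); last 2 first.
- by apply: measurable_maxr => //; exact: measurableT_comp.
- by move=> x; rewrite le_max lexx orbT.
by rewrite normal_prob_symmetric.
Qed.

End wiener_increments.

Definition gauss_moment (R : realType) (j : nat) : R :=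
  expR (j%:R ^+ 2) * Num.sqrt 2.

Lemma powR_le1DX (R : realType) (q t : R) (M : nat) :
  0 < q -> q <= M%:R -> 0 <= t -> t `^ q <= 1 + t ^+ M.
Proof.
move=> q0 qM t0; have [t1|t1] := leP t 1.
  apply: (@le_trans _ _ (1 `^ q)); last by rewrite powR1 lerDl exprn_ge0.
  by apply: ge0_ler_powR; rewrite ?nnegrE// ltW.
apply: (@le_trans _ _ (t ^+ M)); last by rewrite lerDr.
by rewrite -powR_mulrn// ler_powR// ltW.
Qed.

Lemma powRD_le (R : realType) (q x y : R) : 0 < q -> 0 <= x -> 0 <= y ->
  (x + y) `^ q <= 2 `^ q * (x `^ q + y `^ q).
Proof.
move=> q0 x0 y0; wlog xy : x y x0 y0 / x <= y.
  have [xy|/ltW yx] := leP x y; first by apply.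
  by move=> /(_ y x y0 x0 yx); rewrite addrC [y `^ q + _]addrC.
apply: (@le_trans _ _ ((2 * y) `^ q)).
  apply: ge0_ler_powR; rewrite ?nnegrE ?mulr_ge0 ?addr_ge0 ?(ltW q0)//.
  by rewrite mulr_natl mulr2n lerD2r.
by rewrite powRM// ler_wpM2l ?powR_ge0// lerDr powR_ge0.
Qed.

(** * From moments to the energy estimate *)

Section energy.
Context {R : realType}.
Variables (q A c : R) (m : nat).
Hypotheses (q0 : 0 < q) (A0 : 0 <= A) (c0 : 0 < c).

Let k := Num.trunc q.

(** [2 ^ q] splits the power of [x0 + tau * N], [1 + c^-1 ^ q] recombines maximum and dissipation,
    and the exponential bounds the moment of order [2 * (trunc q + 1)] of the running maximum. *)
Definition energy_const : R := 2 `^ q * (1 + c^-1 `^ q) *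
  (1 + 4 * expR (growth_const (gauss_moment R) m A (Num.trunc q).*2.+1)).

Lemma energy_const_gt0 : 0 < energy_const.
Proof.
rewrite !mulr_gt0 ?powR_gt0//.
by rewrite ltr_pwDl// powR_ge0.
Qed.

(** [X] and [D] enter through pathwise inequalities on [Good]. The recursion for [s] turns these
    into an equality with adapted coefficients, and on [Good] the quantity [Tm * s n] dominates the
    energy, the accumulated dissipation and [Tm] together. *)
Lemma energy_bound {dO : measure_display} {Om : measurableType dO}
    (P : probability Om R) (F : R -> set (set Om)) (W : R -> Om -> R)
    (tau x0 : R) (X D a : nat -> Om -> R) (Good : set Om) (N : nat) :
  usual_filtration P F -> wiener P F W -> 0 < tau -> 0 <= x0 ->
  P.-negligible (~` Good) ->
  (forall n, meas_wrt (F (n%:R * tau)) (a n)) ->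
  (forall n w, 0 <= X n w) -> (forall n w, 0 <= D n w) ->
  (forall w, Good w -> X 0 w = x0) ->
  (forall n w, Good w -> `|a n w| <= A * Num.sqrt (X n w)) ->
  (forall n w, Good w -> X n.+1 w + c * (tau * D n w) <=
     X n w + a n w * (W (n.+1%:R * tau) w - W (n%:R * tau) w) +
     A * tau * (1 + `|(W (n.+1%:R * tau) w - W (n%:R * tau) w) / Num.sqrt tau|)
       ^+ m) ->
  (0 < N)%N ->
  (\int[P]_w (\big[Num.max/0]_(n < N.+1) X n w `^ q +
      (\sum_(n < N) tau * D n w) `^ q)%:E <=
   (energy_const * (x0 `^ q + (tau * N%:R) `^ q))%:E)%E.
Proof.
move=> hF hW tau0 x00 Goodn ma X0 D0 X0E aX step N0.
pose G := grid_filtration F tau.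
pose z := scaled_increment W tau.
have sG n : sigma_algebra setT (G n) := grid_filtration_sigma hF tau0 n.
have GT n : G n `<=` measurable := @grid_filtration_measurable _ _ _ _ _ hF _ tau0 n.
have GS n : G n `<=` G n.+1 := grid_filtration_le hF tau0 (leqnSn n).
have mz n : meas_wrt (G n.+1) (z n) := scaled_increment_meas hF hW tau0 (n := n).
have rt0 : 0 < Num.sqrt tau by rewrite sqrtr_gt0.
have NR0 : 0 < N%:R :> R by rewrite ltr0n.
pose Tm : R := tau * N%:R.
have T0 : 0 < Tm by rewrite mulr_gt0.
have mGood n : G n Good.
  have [_ _ _ FN] := hF.
  have GC : F 0 (~` Good) by exact: FN.
  have [+ _] := sG n; move=> _.
  have : G n (~` Good).
    apply: (grid_filtration_le hF tau0 (leq0n n)).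
    by rewrite /grid_filtration mul0r.
  have [_ + _] := sG n => /[apply]; rewrite setTD setCK//.
(* Cut off outside [Good], where the bound on [a] may fail; there [s] can only increase. The factor
   [sqrt tau / Tm] accounts for scaling the increment and dividing the energy by [Tm]. *)
pose al n w : R := a n w * \1_Good w * (Num.sqrt tau / Tm).
have mal n : meas_wrt (G n) (al n).
  apply: measurable_funM => //; apply: measurable_funM; first exact: ma.
  apply: (@measurable_indic _ (g_sigma_algebraType (G n))).
  exact: sub_sigma_algebra.
(* That is [(x0 + Tm) / Tm]; the shift by 1 secures [s >= 1], on which the relative growth estimate
   rests. *)
pose lam : R := 1 + x0 / Tm.
have lam1 : 1 <= lam by rewrite lerDl divr_ge0// ltW.
have lam0 : 0 < lam by apply: lt_le_trans lam1.
pose s := fix s n w : R := if n is n'.+1 then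
  s n' w + al n' w * z n' w + A / N%:R * (1 + `|z n' w|) ^+ m else lam.
have sS n w : s n.+1 w =
  s n w + al n w * z n w + A / N%:R * (1 + `|z n w|) ^+ m by [].
have good n w : Good w ->
    X n w + c * (\sum_(i < n) tau * D i w) + Tm <= Tm * s n w.
  move=> gw; elim: n => [|n IH].
    rewrite big_ord0 mulr0 addr0 X0E// /= /lam mulrDr mulr1 mulrCA mulfV ?gt_eqF//.
    by rewrite mulr1 addrC.
  rewrite big_ord_recr/= mulrDr -/(z n w) -/(s n w).
  have := step n w gw; rewrite -/(scaled_increment W tau n w) -/(z n w).
  have -> : W (n.+1%:R * tau) w - W (n%:R * tau) w = Num.sqrt tau * z n w.
    by rewrite /z /scaled_increment [RHS]mulrC divfK// gt_eqF.
  have -> : Tm * (s n w + al n w * z n w + A / N%:R * (1 + `|z n w|) ^+ m) =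
     Tm * s n w + a n w * (Num.sqrt tau * z n w) +
     A * tau * (1 + `|z n w|) ^+ m.
    rewrite /al indicE mem_set// mulr1; move: (_ ^+ m) => u; rewrite /Tm; field; rewrite !gt_eqF//.
  lra.
have bad n w : ~ Good w -> 1 <= s n w.
  move=> bw; elim: n => [//|n IH]; rewrite sS /al indicE memNset//.
  rewrite mulr0 mul0r mul0r addr0 (le_trans IH)// lerDl mulr_ge0//.
  by rewrite divr_ge0.
have sumD n w : 0 <= \sum_(i < n) tau * D i w.
  by apply: sumr_ge0 => i _; rewrite mulr_ge0// ltW.
have s1 n w : 1 <= s n w.
  have [gw|bw] := pselect (Good w); last exact: bad.
  rewrite -(ler_pM2l T0) mulr1 (le_trans _ (good n w gw))// lerDr addr_ge0//.
  by rewrite mulr_ge0// ltW.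
have al_le n w : `|al n w| <= A * s n w / Num.sqrt N%:R.
  have s0 : 0 <= s n w by apply: le_trans (s1 n w).
  have [gw|bw] := pselect (Good w); last first.
    rewrite /al indicE memNset// mulr0 mul0r normr0.
    by rewrite divr_ge0 ?sqrtr_ge0// mulr_ge0.
  rewrite /al indicE mem_set// mulr1 normrM.
  have h0 : 0 <= Num.sqrt tau / Tm by rewrite divr_ge0// ltW.
  rewrite [`|Num.sqrt tau / Tm|]ger0_norm//.
  have XT : X n w <= Tm * s n w.
    apply: le_trans (good n w gw); rewrite -addrA lerDl addr_ge0 ?(ltW T0)//.
    by rewrite mulr_ge0// ltW.
  have aX' : `|a n w| <= A * (Num.sqrt Tm * s n w).
    apply: (le_trans (aX n w gw)); apply: ler_wpM2l => //.
    apply: (@le_trans _ _ (Num.sqrt (Tm * s n w))); first exact: ler_wsqrtr.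
    rewrite sqrtrM ?(ltW T0)//; apply: ler_wpM2l; first exact: sqrtr_ge0.
    rewrite -[leRHS](sqr_sqrtr s0) expr2 ler_peMr ?sqrtr_ge0//.
    by rewrite -[leLHS](sqrtr1 R) ler_wsqrtr.
  apply: (le_trans (ler_wpM2r h0 aX')).
  rewrite le_eqVlt; apply/orP; left; apply/eqP.
  rewrite /Tm sqrtrM ?(ltW tau0)//.
  set u := Num.sqrt tau in rt0 *; set v := Num.sqrt N%:R.
  have v0 : 0 < v by rewrite sqrtr_gt0.
  have -> : tau = u ^+ 2 by rewrite sqr_sqrtr// ltW.
  have -> : N%:R = v ^+ 2 by rewrite sqr_sqrtr// ltW.
  by field; rewrite !gt_eqF.
(* An even order not below [q], the form in which the maximal inequality is available. *)
pose M := (k.+1 * 2)%N.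
have qM : q <= M%:R.
  rewrite (@le_trans _ _ k.+1%:R)//; first by rewrite ltW// truncnS_gt.
  by rewrite ler_nat /M muln2 -addnn leq_addr.
pose r w := running_max (s^~ w) N.
have mom : (\int[P]_w (r w ^+ M)%:E <= (4 *
  expR (growth_const (gauss_moment R) m A k.*2.+1) * lam ^+ M)%:E)%E.
  apply: (@running_max_moment _ _ _ P G z (gauss_moment R) GT GS mz _ _ _ N m A
    lam al s) => //.
  - by move=> j; rewrite mulr_ge0 ?expR_ge0.
  - by move=> n j f; exact: scaled_increment_moment.
  - by move=> n f; exact: scaled_increment_sym.
have mr : measurable_fun setT r.
  apply: (meas_wrt_measurable (GT N)).
  by apply: (@running_max_adapted _ _ _ G z GS mz N m A lam al s).
have r0 w : 0 <= r w by exact: running_max_ge0.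
pose B : R := Tm `^ q * (1 + c^-1 `^ q).
have B0 : 0 <= B by rewrite mulr_ge0 ?powR_ge0 ?addr_ge0 ?powR_ge0.
(* From [(r / lam) ^ q <= 1 + (r / lam) ^+ M]. The moment of order [M] costs [lam ^+ M], which
   cancels, so only the factor [lam ^ q] of the right homogeneity remains. *)
pose g w : R := B * lam `^ q * (1 + lam ^- M * r w ^+ M).
have lM0 : 0 <= lam ^- M by rewrite invr_ge0 exprn_ge0// ltW.
have g0 w : 0 <= g w.
  apply: mulr_ge0; first by rewrite mulr_ge0// powR_ge0.
  by rewrite addr_ge0// mulr_ge0// exprn_ge0.
apply: (@le_trans _ _ (\int[P]_w (g w)%:E)%E).
  apply: le_integral_nonmeasurable => //.
  - move=> w; rewrite addr_ge0 ?powR_ge0//.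
    elim/big_ind : _ => [//|x y hx _|n _]; last exact: powR_ge0.
    by rewrite le_max hx.
  - apply: measurable_funM => //; apply: measurable_funD => //.
    by apply: measurable_funM => //; exact: measurable_funX.
  have [Z [mZ Z0 GZ]] := Goodn; exists Z; split => //.
  apply: subset_trans GZ => w /= nle gw; apply: nle.
  have rN n : (n <= N)%N -> Tm * s n w <= Tm * r w.
    by move=> nN; rewrite ler_pM2l// (@running_max_ge _ (s^~ w)).
  have H1 : \big[Num.max/0]_(n < N.+1) X n w `^ q <= (Tm * r w) `^ q.
    apply: bigmax_le => [|i _]; first exact: powR_ge0.
    apply: ge0_ler_powR; rewrite ?nnegrE; [exact: ltW|exact: X0|by rewrite mulr_ge0// ltW|].
    apply: (@le_trans _ _ (Tm * s i w)); last by apply: rN; rewrite -ltnS.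
    apply: le_trans (good i w gw); rewrite -addrA lerDl addr_ge0 ?(ltW T0)//.
    by rewrite mulr_ge0// ltW.
  have H2 : (\sum_(n < N) tau * D n w) `^ q <= (c^-1 * (Tm * r w)) `^ q.
    have Tr0 : 0 <= Tm * r w by rewrite mulr_ge0// ltW.
    apply: ge0_ler_powR; rewrite ?nnegrE;
      [exact: ltW|exact: sumD|by rewrite mulr_ge0// invr_ge0 ltW|].
    rewrite ler_pdivlMl//; apply: le_trans (rN N (leqnn _)).
    by apply: le_trans (good N w gw); rewrite -addrA addrCA lerDl addr_ge0// ltW.
  apply: (le_trans (lerD H1 H2)).
  have ci0 : 0 <= c^-1 by rewrite invr_ge0 ltW.
  have Tr0 : 0 <= Tm * r w by rewrite mulr_ge0// ltW.
  have Trq : (Tm * r w) `^ q = Tm `^ q * r w `^ q by rewrite powRM// ltW.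
  rewrite (powRM q ci0 Tr0) Trq.
  have -> : Tm `^ q * r w `^ q + c^-1 `^ q * (Tm `^ q * r w `^ q) =
    B * r w `^ q by rewrite /B; ring.
  rewrite /g -mulrA; apply: ler_wpM2l => //.
  have rE : r w = lam * (r w / lam) by rewrite mulrCA mulfV ?mulr1// gt_eqF.
  rewrite {1}rE powRM ?divr_ge0 ?(ltW lam0)//; apply: ler_wpM2l.
    exact: powR_ge0.
  have -> : lam ^- M * r w ^+ M = (r w / lam) ^+ M by rewrite expr_div_n mulrC.
  apply: powR_le1DX => //.
  by rewrite divr_ge0// ltW.
have bl0 : 0 <= B * lam `^ q by rewrite mulr_ge0// powR_ge0.
have rM0 w : 0 <= lam ^- M * r w ^+ M by rewrite mulr_ge0// exprn_ge0.
have mrM : measurable_fun setT (fun w => r w ^+ M) by exact: measurable_funX.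
rewrite /g; under eq_integral do rewrite EFinM.
rewrite ge0_integralZl_EFin//; last 2 first.
- by move=> w _; rewrite lee_fin addr_ge0.
- apply/measurable_EFinP; apply: measurable_funD => //.
  exact: measurable_funM.
under eq_integral do rewrite EFinD.
rewrite ge0_integralD//; last 2 first.
- by move=> w _; rewrite lee_fin.
- by apply/measurable_EFinP; exact: measurable_funM.
rewrite integral_cst//= probability_setT mule1.
under eq_integral do rewrite EFinM.
rewrite ge0_integralZl_EFin//; last 2 first.
- by move=> w _; rewrite lee_fin exprn_ge0.
- exact/measurable_EFinP.
set E := 4 * _ in mom.
have E0 : 0 <= E by rewrite mulr_ge0// expR_ge0.
apply: (@le_trans _ _ ((B * lam `^ q)%:E * (1%:E + (lam ^- M)%:E * (E * lam ^+ M)%:E))%E).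
  by apply: lee_wpmul2l; rewrite ?lee_fin//; apply: leeD2l; exact: lee_wpmul2l.
have -> : ((lam ^- M)%:E * (E * lam ^+ M)%:E = E%:E)%E.
  by rewrite -EFinM mulrCA mulVf ?mulr1// expf_neq0// gt_eqF.
rewrite -EFinD -EFinM lee_fin.
have TlE : Tm `^ q * lam `^ q = (x0 + Tm) `^ q.
  rewrite -powRM ?(ltW T0) ?(ltW lam0)//; congr (_ `^ _).
  by rewrite /lam mulrDr mulr1 mulrCA mulfV ?gt_eqF// mulr1 addrC.
have -> : B * lam `^ q * (1 + E) = (1 + c^-1 `^ q) * (1 + E) * (x0 + Tm) `^ q.
  by rewrite -TlE /B; ring.
have -> : energy_const * (x0 `^ q + (tau * N%:R) `^ q) =
  (1 + c^-1 `^ q) * (1 + E) * (2 `^ q * (x0 `^ q + Tm `^ q)).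
  by rewrite /energy_const -/k -/E -/Tm; ring.
apply: ler_wpM2l; last by rewrite powRD_le// ltW.
by rewrite mulr_ge0 ?addr_ge0 ?powR_ge0.
Qed.

End energy.

(** * Integration almost everywhere, matrix norms and Lp pairings *)

Section ae_integral.
Context {R : realType} {d} {T : measurableType d} (mu : {measure set T -> \bar R}).
Variable D : set T.
Hypothesis mD : measurable D.
Implicit Types f g h : T -> R.

Local Notation ok := (fun f => mu.-integrable D (EFin \o f)).
Local Notation aeD := (fun P : T -> Prop => {ae mu, forall x, D x -> P x}).

Lemma ae_on_mp (Q S : T -> Prop) :
  (forall x, D x -> Q x -> S x) -> aeD Q -> aeD S.
Proof.
move=> QS; apply: (@filterS _ (almost_everywhere mu)) => x QD Dx.
exact/QS/QD.
Qed.

Lemma ae_on_mp2 (Q1 Q2 S : T -> Prop) :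
  (forall x, D x -> Q1 x -> Q2 x -> S x) -> aeD Q1 -> aeD Q2 -> aeD S.
Proof.
move=> QS; apply: (@filterS2 _ (almost_everywhere mu)) => x Q1D Q2D Dx.
by apply: QS => //; [exact: Q1D|exact: Q2D].
Qed.

Lemma ae_onT (Q : T -> Prop) : (forall x, D x -> Q x) -> aeD Q.
Proof. by move=> Qx; apply: aeW. Qed.

Lemma ok_measurable f : ok f -> measurable_fun D f.
Proof. by move=> /measurable_int /measurable_EFinP. Qed.

Lemma ok_dom f g : measurable_fun D f -> ok g ->
  aeD (fun x => `|f x| <= g x) -> ok f.
Proof.
move=> mf og fg; apply/integrableP; split; first exact/measurable_EFinP.
move/integrableP : (og) => [mg]; apply: le_lt_trans.
apply: ae_ge0_le_integral => //.
- apply/measurable_EFinP; apply: measurableT_comp => //.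
- by apply: measurableT_comp.
- apply: ae_on_mp fg => x Dx fg /=.
  by rewrite lee_fin (le_trans fg)// ler_norm.
Qed.

Lemma okD f g : ok f -> ok g -> ok (fun x => f x + g x).
Proof. by move=> hf hg; exact: (integrableD mD hf hg). Qed.

Lemma okZ (r : R) f : ok f -> ok (fun x => r * f x).
Proof. by move=> hf; exact: (integrableZl mD r hf). Qed.

Lemma okB f g : ok f -> ok g -> ok (fun x => f x - g x).
Proof. by move=> hf hg; exact: (integrableB mD hf hg). Qed.

Lemma ok_abs f : ok f -> ok (fun x => `|f x|).
Proof. by move=> hf; exact: (integrable_abse hf). Qed.

Lemma ok_sum (I : Type) (s : seq I) (F : I -> T -> R) :
  (forall i, ok (F i)) -> ok (fun x => \sum_(i <- s) F i x).
Proof.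
move=> oF; elim: s => [|i s IH].
  rewrite (_ : (fun x => _) = cst 0); first exact: integrable0.
  by apply/funext => x; rewrite big_nil.
rewrite (_ : (fun x => _) = fun x => F i x + \sum_(j <- s) F j x).
  exact: okD.
by apply/funext => x; rewrite big_cons.
Qed.

Lemma Rintegral_sum (I : Type) (s : seq I) (F : I -> T -> R) :
  (forall i, ok (F i)) ->
  \int[mu]_(x in D) (\sum_(i <- s) F i x) = \sum_(i <- s) \int[mu]_(x in D) F i x.
Proof.
move=> oF; elim: s => [|i s IH].
  rewrite big_nil; under eq_Rintegral do rewrite big_nil.
  by rewrite Rintegral_cst// mul0r.
rewrite big_cons; under eq_Rintegral do rewrite big_cons.
by rewrite RintegralD// ?IH//; exact: ok_sum.
Qed.

Lemma ae_eq_Rintegral f g : measurable_fun D f -> measurable_fun D g ->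
  aeD (fun x => f x = g x) -> \int[mu]_(x in D) f x = \int[mu]_(x in D) g x.
Proof.
move=> mf mg fg; congr fine; apply: ae_eq_integral => //.
- exact/measurable_EFinP.
- exact/measurable_EFinP.
- by apply: ae_on_mp fg => x _ /= ->.
Qed.

(** Replacing [f] by [min f g], equal to it almost everywhere, reduces the claim to an inequality
    valid at every point. *)
Lemma ae_le_Rintegral f g : ok f -> ok g ->
  aeD (fun x => f x <= g x) -> \int[mu]_(x in D) f x <= \int[mu]_(x in D) g x.
Proof.
move=> hf hg fg.
have mf := ok_measurable hf; have mg := ok_measurable hg.
have mm : measurable_fun D (fun x => Num.min (f x) (g x)).
  exact: measurable_minr.
have om : ok (fun x => Num.min (f x) (g x)).
  apply: (ok_dom mm (g := fun x => `|f x| + `|g x|)).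
    by apply: okD; exact: ok_abs.
  apply: ae_onT => x _; rewrite minEle; case: ifP => _.
    by rewrite lerDl.
  by rewrite lerDr.
rewrite (@ae_eq_Rintegral f (fun x => Num.min (f x) (g x)))//.
  apply: le_Rintegral => // x _.
  by rewrite ge_min lexx orbT.
by apply: ae_on_mp fg => x _ fg; rewrite min_l.
Qed.

Lemma Rintegral_ge0_eq0 f : ok f -> (forall x, D x -> 0 <= f x) ->
  \int[mu]_(x in D) f x = 0 -> aeD (fun x => f x = 0).
Proof.
move=> hf f0 If0.
have mf := ok_measurable hf.
have : (\int[mu]_(x in D) `|(f x)%:E| = 0)%E.
  transitivity (\int[mu]_(x in D) (f x)%:E)%E.
    by apply: eq_integral => x /set_mem Dx; rewrite gee0_abs// lee_fin f0.
  rewrite -[LHS]fineK; first by rewrite [fine _]If0.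
  exact: integrable_fin_num.
have mfE : measurable_fun D (EFin \o f) by exact/measurable_EFinP.
move/(ae_eq_integral_abs mu mD mfE); apply: ae_on_mp => x _ /=.
by case.
Qed.

End ae_integral.

Section matrix_norm.
Context {R : realType}.
Implicit Types m n : nat.

Lemma mdotC m n (A B : 'M[R]_(m, n)) : mdot A B = mdot B A.
Proof. by apply: eq_bigr => i _; apply: eq_bigr => j _; rewrite mulrC. Qed.

Lemma mdotDl m n (A B C : 'M[R]_(m, n)) : mdot (A + B) C = mdot A C + mdot B C.
Proof.
rewrite /mdot -big_split/=; apply: eq_bigr => i _; rewrite -big_split/=.
by apply: eq_bigr => j _; rewrite mxE mulrDl.
Qed.

Lemma mdotZl m n (a : R) (A C : 'M[R]_(m, n)) : mdot (a *: A) C = a * mdot A C.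
Proof.
rewrite /mdot mulr_sumr; apply: eq_bigr => i _; rewrite mulr_sumr.
by apply: eq_bigr => j _; rewrite mxE mulrA.
Qed.

Lemma mdotDr m n (A B C : 'M[R]_(m, n)) : mdot C (A + B) = mdot C A + mdot C B.
Proof. by rewrite mdotC mdotDl !(mdotC _ C). Qed.

Lemma mdotZr m n (a : R) (A C : 'M[R]_(m, n)) : mdot C (a *: A) = a * mdot C A.
Proof. by rewrite mdotC mdotZl mdotC. Qed.

Lemma mdotNl m n (A C : 'M[R]_(m, n)) : mdot (- A) C = - mdot A C.
Proof. by rewrite -scaleN1r mdotZl mulN1r. Qed.

Lemma mdotNr m n (A C : 'M[R]_(m, n)) : mdot C (- A) = - mdot C A.
Proof. by rewrite mdotC mdotNl mdotC. Qed.

Lemma mdotBl m n (A B C : 'M[R]_(m, n)) : mdot (A - B) C = mdot A C - mdot B C.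
Proof. by rewrite mdotDl mdotNl. Qed.

Lemma mdotBr m n (A B C : 'M[R]_(m, n)) : mdot C (A - B) = mdot C A - mdot C B.
Proof. by rewrite mdotDr mdotNr. Qed.

Lemma mdot_ge0 m n (A : 'M[R]_(m, n)) : 0 <= mdot A A.
Proof. by apply: sumr_ge0 => i _; apply: sumr_ge0 => j _; rewrite -expr2 sqr_ge0. Qed.

Lemma mdot_ge_entry m n (A : 'M[R]_(m, n)) i j : (A i j) ^+ 2 <= mdot A A.
Proof.
rewrite /mdot (bigD1 i)//= (bigD1 j)//= -expr2 -addrA lerDl addr_ge0//.
  by apply: sumr_ge0 => k _; rewrite -expr2 sqr_ge0.
by apply: sumr_ge0 => k _; apply: sumr_ge0 => l _; rewrite -expr2 sqr_ge0.
Qed.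

Lemma mabs_ge0 m n (A : 'M[R]_(m, n)) : 0 <= mabs A.
Proof. exact: sqrtr_ge0. Qed.

Lemma sqr_mabs m n (A : 'M[R]_(m, n)) : mabs A ^+ 2 = mdot A A.
Proof. by rewrite sqr_sqrtr// mdot_ge0. Qed.

Lemma mabs_entry m n (A : 'M[R]_(m, n)) i j : `|A i j| <= mabs A.
Proof. by rewrite -sqrtr_sqr ler_wsqrtr// mdot_ge_entry. Qed.

Lemma mabs_eq0 m n (A : 'M[R]_(m, n)) : mabs A = 0 -> A = 0.
Proof.
move=> A0; apply/matrixP => i j; rewrite mxE; apply/eqP.
by rewrite -normr_le0 -A0 mabs_entry.
Qed.

Lemma mabs0 m n : mabs (0 : 'M[R]_(m, n)) = 0.
Proof.
rewrite /mabs /mdot big1 ?sqrtr0// => i _; rewrite big1// => j _.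
by rewrite mxE mul0r.
Qed.

Lemma mdot_le m n (A B : 'M[R]_(m, n)) : `|mdot A B| <= mabs A * mabs B.
Proof.
have [B0|B0] := eqVneq (mabs B) 0.
  rewrite B0 mulr0 (mabs_eq0 B0) (_ : mdot A 0 = 0) ?normr0//.
  by rewrite -(scale0r 0) mdotZr mul0r.
have {}B0 : 0 < mabs B by rewrite lt0r B0 mabs_ge0.
have b0 : 0 < mdot B B by rewrite -sqr_mabs exprn_gt0.
have := mdot_ge0 (mdot B B *: A - mdot A B *: B).
rewrite !(mdotBl, mdotBr, mdotZl, mdotZr) (mdotC B A) => h.
have {}h : mdot A B ^+ 2 <= mdot A A * mdot B B.
  by rewrite -(ler_pM2l b0); nra.
rewrite -(@ler_pXn2r _ 2)// ?nnegrE ?mulr_ge0 ?mabs_ge0//.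
by rewrite real_normK ?num_real// exprMn !sqr_mabs.
Qed.

Lemma mdot_le_mabs m n (A B : 'M[R]_(m, n)) : mdot A B <= mabs A * mabs B.
Proof. exact: le_trans (ler_norm _) (mdot_le A B). Qed.

Lemma mabsZ m n (a : R) (A : 'M[R]_(m, n)) : mabs (a *: A) = `|a| * mabs A.
Proof.
by rewrite /mabs mdotZl mdotZr mulrA -expr2 sqrtrM ?sqr_ge0// sqrtr_sqr.
Qed.

Lemma mabsN m n (A : 'M[R]_(m, n)) : mabs (- A) = mabs A.
Proof. by rewrite -scaleN1r mabsZ normrN1 mul1r. Qed.

Lemma mabsD m n (A B : 'M[R]_(m, n)) : mabs (A + B) <= mabs A + mabs B.
Proof.
rewrite -(@ler_pXn2r _ 2)// ?nnegrE ?addr_ge0 ?mabs_ge0//.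
rewrite sqrrD !sqr_mabs !(mdotDl, mdotDr) (mdotC B A).
have := mdot_le_mabs A B; rewrite -mulr_natl; lra.
Qed.

Lemma mabs_le_sum m n (A : 'M[R]_(m, n)) : mabs A <= \sum_i \sum_j `|A i j|.
Proof.
have S0 : 0 <= \sum_i \sum_j `|A i j|.
  by apply: sumr_ge0 => i _; apply: sumr_ge0.
rewrite -(@ler_pXn2r _ 2)// ?nnegrE ?mabs_ge0//.
rewrite sqr_mabs expr2 mulr_suml; apply: ler_sum => i _.
rewrite mulr_suml; apply: ler_sum => j _.
apply: (le_trans (ler_norm _)); rewrite normrM; apply: ler_wpM2l => //.
rewrite (bigD1 i)//= (bigD1 j)//= -addrA lerDl addr_ge0//.
  exact: sumr_ge0.
by apply: sumr_ge0 => k _; apply: sumr_ge0.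
Qed.

Lemma mabs_tr m n (A : 'M[R]_(m, n)) : mabs A^T = mabs A.
Proof.
rewrite /mabs /mdot exchange_big/=; congr Num.sqrt.
by apply: eq_bigr => i _; apply: eq_bigr => j _; rewrite mxE.
Qed.

Lemma mabs_mulmx n (s : 'rV[R]_n) (A : 'M[R]_n) :
  mabs (s *m A) <= mabs s * mabs A.
Proof.
rewrite -(@ler_pXn2r _ 2)// ?nnegrE ?mulr_ge0 ?mabs_ge0//.
rewrite exprMn !sqr_mabs [mdot (s *m A) _]/mdot big_ord1.
rewrite [mdot A A]/mdot exchange_big/= mulr_sumr; apply: ler_sum => j _.
have -> : (s *m A) ord0 j = mdot s (\row_k A k j).
  by rewrite mxE /mdot big_ord1; apply: eq_bigr => k _; rewrite mxE.
have -> : \sum_i A i j * A i j = mdot (\row_k A k j) (\row_k A k j).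
  by rewrite /mdot big_ord1; apply: eq_bigr => k _; rewrite !mxE.
rewrite -!sqr_mabs -expr2 -exprMn -(real_normK (num_real (mdot _ _))).
by apply: lerXn2r; rewrite ?nnegrE ?mulr_ge0 ?mabs_ge0// mdot_le.
Qed.

End matrix_norm.

Lemma measurable_fun_powR (R : realType) d (T : measurableType d) (E : set T)
    (g : T -> R) (r : R) :
  measurable_fun E g -> measurable_fun E (fun x => g x `^ r).
Proof. exact: (measurableT_comp (measurable_powR r)). Qed.

Section Lp.
Context {R : realType} (d : nat) (O : set 'rV[R]_d).
Local Notation point := 'rV[R]_d.
Local Notation mu := (leb R d).
Hypothesis mO : measurable O.
Local Notation ok := (fun f : point -> R => mu.-integrable O (EFin \o f)).
Local Notation aeO := (fun P : point -> Prop => {ae mu, forall x, O x -> P x}).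

Lemma snorm_ge0 r (f : point -> R) : 0 <= snorm O r f.
Proof. by rewrite fine_ge0// Lnorm_ge0. Qed.

Lemma mnorm_ge0 m n r (f : point -> 'M[R]_(m, n)) : 0 <= mnorm O r f.
Proof. exact: snorm_ge0. Qed.

Lemma poweR_Lnorm_restrict (r : R) (f : point -> R) : 0 < r ->
  (('N[mu]_r%:E[EFin \o (f \_ O)]) `^ r =
   \int[mu]_(x in O) (`|f x| `^ r)%:E)%E.
Proof.
move=> r0; rewrite poweR_Lnorm ?gt_eqF// [RHS]integral_mkcond.
apply: eq_integral => x _ /=; rewrite !patchE; case: ifPn => // _.
by rewrite normr0 powR0 ?gt_eqF.
Qed.

Lemma sLpP (r : R) (f : point -> R) : 0 < r ->
  sLp O r%:E f <-> measurable_fun O f /\ ok (fun x => `|f x| `^ r).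
Proof.
move=> r0.
have mfE : measurable_fun setT (f \_ O) <-> measurable_fun O f.
  by split => /(measurable_restrictT _ mO).
have mpow : measurable_fun O f -> measurable_fun O (fun x => `|f x| `^ r).
  move=> mf; apply: measurable_fun_powR.
  exact: measurableT_comp.
have normE : finite_norm mu r%:E (f \_ O) <->
    (\int[mu]_(x in O) (`|f x| `^ r)%:E < +oo)%E.
  rewrite -poweR_Lnorm_restrict// /finite_norm.
  have := Lnorm_ge0 mu r%:E (EFin \o (f \_ O)).
  case: ('N[mu]_r%:E[EFin \o (f \_ O)])%E => [x|//|//] /= _.
    by rewrite !ltry.
  by rewrite (gt_eqF r0).
split.
  rewrite /sLp inE => /andP[]; rewrite !inE => /mfE mf /normE fin.
  split => //; apply/integrableP; split.
    by apply/measurable_EFinP; exact: mpow.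
  under eq_integral do rewrite /= ger0_norm ?powR_ge0//.
  exact: fin.
move=> [mf /integrableP[_ fin]]; rewrite /sLp inE; apply/andP; split; rewrite !inE.
  exact/mfE.
apply/normE; under eq_integral do rewrite -(ger0_norm (powR_ge0 _ _)).
exact: fin.
Qed.

Lemma snorm_powR (r : R) (f : point -> R) : 0 < r -> sLp O r%:E f ->
  snorm O r%:E f `^ r = \int[mu]_(x in O) (`|f x| `^ r).
Proof.
move=> r0 fr; rewrite /Rintegral -poweR_Lnorm_restrict// /snorm.
have : finite_norm mu r%:E (f \_ O).
  by move: fr; rewrite /sLp inE => /andP[_]; rewrite !inE.
rewrite /finite_norm; have := Lnorm_ge0 mu r%:E (EFin \o (f \_ O)).
by case: ('N[mu]_r%:E[EFin \o (f \_ O)])%E.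
Qed.

Lemma sLp_holder (r s : R) (f g : point -> R) : 0 < r -> 0 < s ->
  r^-1 + s^-1 = 1 -> sLp O r%:E f -> sLp O s%:E g ->
  ok (fun x => f x * g x) /\
  \int[mu]_(x in O) `|f x * g x| <= snorm O r%:E f * snorm O s%:E g.
Proof.
move=> r0 s0 rs fr gs.
have [mf _] := (sLpP f r0).1 fr; have [mg _] := (sLpP g s0).1 gs.
have mf' : measurable_fun setT (f \_ O) by exact/(measurable_restrictT _ mO).
have mg' : measurable_fun setT (g \_ O) by exact/(measurable_restrictT _ mO).
have := hoelder mu mf' mg' r0 s0 rs.
have ff : ('N[mu]_r%:E[EFin \o (f \_ O)])%E \is a fin_num.
  rewrite ge0_fin_numE ?Lnorm_ge0//.
  by move: fr; rewrite /sLp inE => /andP[_]; rewrite !inE.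
have gf : ('N[mu]_s%:E[EFin \o (g \_ O)])%E \is a fin_num.
  rewrite ge0_fin_numE ?Lnorm_ge0//.
  by move: gs; rewrite /sLp inE => /andP[_]; rewrite !inE.
rewrite -(fineK ff) -(fineK gf) -EFinM Lnorm1.
have -> : (\int[mu]_x `|(EFin \o ((f \_ O) \* (g \_ O))%R) x| =
    \int[mu]_(x in O) `|(f x * g x)%:E|)%E.
  rewrite [RHS]integral_mkcond; apply: eq_integral => x _ /=.
  rewrite !patchE; case: ifPn => //= _.
  by rewrite mulr0 normr0.
move=> H.
have fin : (\int[mu]_(x in O) `|(f x * g x)%:E| < +oo)%E.
  by apply: le_lt_trans H _; rewrite ltry.
split.
  apply/integrableP; split => //.
  exact/measurable_EFinP/measurable_funM.
rewrite -lee_fin; apply: le_trans H; rewrite /Rintegral fineK//.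
by rewrite ge0_fin_numE ?integral_ge0.
Qed.

Definition mmeas m n (F : point -> 'M[R]_(m, n)) :=
  forall i j, measurable_fun O (fun x => F x i j).

Lemma mmeas_mdot m n (F G : point -> 'M[R]_(m, n)) : mmeas F -> mmeas G ->
  measurable_fun O (fun x => mdot (F x) (G x)).
Proof.
move=> mF mG; apply: measurable_sum => i; apply: measurable_sum => j.
exact: measurable_funM.
Qed.

Lemma mmeas_mabs m n (F : point -> 'M[R]_(m, n)) : mmeas F ->
  measurable_fun O (fun x => mabs (F x)).
Proof.
move=> mF; have := measurable_fun_powR 2^-1 (mmeas_mdot mF mF).
by under eq_fun do rewrite powR12_sqrt ?mdot_ge0//.
Qed.

Lemma mmeasD m n (F G : point -> 'M[R]_(m, n)) : mmeas F -> mmeas G ->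
  mmeas (fun x => F x + G x).
Proof.
move=> mF mG i j; under eq_fun do rewrite mxE.
exact: measurable_funD.
Qed.

Lemma mmeasZ m n (a : R) (F : point -> 'M[R]_(m, n)) : mmeas F ->
  mmeas (fun x => a *: F x).
Proof.
move=> mF i j; under eq_fun do rewrite mxE.
exact: measurable_funM.
Qed.

Lemma mmeas_mulmx m n k (F : point -> 'M[R]_(m, n)) (G : point -> 'M[R]_(n, k)) :
  mmeas F -> mmeas G -> mmeas (fun x => F x *m G x).
Proof.
move=> mF mG i j; under eq_fun do rewrite mxE.
by apply: measurable_sum => l; exact: measurable_funM.
Qed.

Lemma mLp_mmeas m n (r : R) (F : point -> 'M[R]_(m, n)) : 0 < r ->
  mLp O r%:E F -> mmeas F.
Proof. by move=> r0 Fr i j; have [] := (sLpP _ r0).1 (Fr i j). Qed.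

(** Every term is at most the largest one; the argument uses monotonicity of the power and so covers
    all [r > 0]. *)
Lemma powR_sum_le (I : finType) (F : I -> R) (r : R) : 0 < r ->
  (forall i, 0 <= F i) ->
  (\sum_i F i) `^ r <= (#|I|%:R) `^ r * \sum_i F i `^ r.
Proof.
move=> r0 F0.
have [i0 _ | I0] := pickP I; last first.
  by rewrite !big_pred0// powR0 ?gt_eqF// mulr0.
pose M := \big[Num.max/0]_i F i.
have FM i : F i <= M by exact: le_bigmax.
have [i MF] : exists i, M <= F i.
  have [|] := @eq_bigmax _ _ _ 0 i0 predT F isT; first by move=> j _; exact: F0.
  by move=> i _ E; exists i; rewrite /M E.
apply: (@le_trans _ _ ((#|I|%:R * F i) `^ r)).
  apply: ge0_ler_powR; rewrite ?nnegrE ?(ltW r0) ?sumr_ge0 ?mulr_ge0//.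
  rewrite mulr_natl -sumr_const; apply: ler_sum => j _.
  exact: le_trans (FM j) MF.
rewrite powRM//; apply: ler_wpM2l; first exact: powR_ge0.
by rewrite (bigD1 i)//= lerDl sumr_ge0// => j _; exact: powR_ge0.
Qed.

Lemma mLp_mabs m n (r : R) (F : point -> 'M[R]_(m, n)) : 0 < r ->
  mLp O r%:E F -> sLp O r%:E (fun x => mabs (F x)).
Proof.
move=> r0 Fr; have mF := mLp_mmeas r0 Fr.
apply/(sLpP _ r0); split; first exact: mmeas_mabs.
pose S x := \sum_(ij : 'I_m * 'I_n) `|F x ij.1 ij.2| `^ r.
apply: (@ok_dom _ _ _ mu _ mO _ (fun x => #|{: 'I_m * 'I_n}|%:R `^ r * S x)).
- apply: measurable_fun_powR.
  by apply: measurableT_comp => //; exact: mmeas_mabs.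
- apply: okZ => //; apply: ok_sum => // -[i j] /=.
  by have [] := (sLpP _ r0).1 (Fr i j).
- apply: ae_onT => x _; rewrite !ger0_norm ?powR_ge0 ?mabs_ge0//.
  apply: (@le_trans _ _ ((\sum_ij `|F x ij.1 ij.2|) `^ r)).
    apply: ge0_ler_powR; rewrite ?nnegrE ?(ltW r0) ?mabs_ge0 ?sumr_ge0//.
    by rewrite -(pair_big xpredT xpredT (fun i j => `|F x i j|))/= mabs_le_sum.
  exact: powR_sum_le.
Qed.

Lemma mpair_holder m n m' n' (r s : R) (F : point -> 'M[R]_(m, n))
    (G : point -> 'M[R]_(m', n')) : 0 < r -> 0 < s ->
  r^-1 + s^-1 = 1 -> mLp O r%:E F -> mLp O s%:E G ->
  ok (fun x => mabs (F x) * mabs (G x)) /\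
  \int[mu]_(x in O) (mabs (F x) * mabs (G x)) <= mnorm O r%:E F * mnorm O s%:E G.
Proof.
move=> r0 s0 rs Fr Gs.
have [h1 h2] := sLp_holder r0 s0 rs (mLp_mabs r0 Fr) (mLp_mabs s0 Gs).
split => //; apply: le_trans h2; rewrite le_eqVlt; apply/orP; left; apply/eqP.
by apply: eq_Rintegral => x _; rewrite ger0_norm// mulr_ge0// mabs_ge0.
Qed.

Lemma ok_mdot m n (F G : point -> 'M[R]_(m, n)) (h : point -> R) :
  mmeas F -> mmeas G -> ok h -> aeO (fun x => mabs (F x) * mabs (G x) <= h x) ->
  ok (fun x => mdot (F x) (G x)).
Proof.
move=> mF mG oh FGh; apply: (@ok_dom _ _ _ mu _ mO _ h) => //.
  exact: mmeas_mdot.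
by apply: ae_on_mp FGh => x _; apply: le_trans; exact: mdot_le.
Qed.

Lemma mnorm_powR m n (r : R) (F : point -> 'M[R]_(m, n)) : 0 < r ->
  mLp O r%:E F -> mnorm O r%:E F `^ r = \int[mu]_(x in O) (mabs (F x) `^ r).
Proof.
move=> r0 Fr; rewrite /mnorm snorm_powR//; last exact: mLp_mabs.
by apply: eq_Rintegral => x _; rewrite ger0_norm// mabs_ge0.
Qed.

Lemma ok_mabs_powR m n (r : R) (F : point -> 'M[R]_(m, n)) : 0 < r ->
  mLp O r%:E F -> ok (fun x => mabs (F x) `^ r).
Proof.
move=> r0 /(mLp_mabs r0) /(sLpP _ r0)[_].
by under eq_fun do rewrite ger0_norm ?mabs_ge0//.
Qed.

Lemma mnorm2_sqr m n (F : point -> 'M[R]_(m, n)) : mLp O 2%:E F ->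
  mnorm O 2%:E F ^+ 2 = mpair O F F.
Proof.
move=> F2; rewrite -powR_mulrn ?mnorm_ge0// mnorm_powR//.
by apply: eq_Rintegral => x _; rewrite powR_mulrn ?mabs_ge0// sqr_mabs.
Qed.

Lemma ok_mdot2 m n (F G : point -> 'M[R]_(m, n)) : mLp O 2%:E F -> mLp O 2%:E G ->
  ok (fun x => mdot (F x) (G x)).
Proof.
move=> F2 G2.
have h2 : (2^-1 + 2^-1 = 1 :> R) by field.
have p2 : 0 < 2 :> R by [].
have [h _] := mpair_holder p2 p2 h2 F2 G2.
by apply: (ok_mdot _ _ h); [exact: mLp_mmeas F2|exact: mLp_mmeas G2|exact: ae_onT].
Qed.

End Lp.

(** * Orthonormal bases of a linear subset *)

Section orthonormal_basis.
Context {R : realType} (X : vectType R) (b : X -> X -> R) (E : set X).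
Hypothesis b_lin : forall a u v w, b (a *: u + v) w = a * b u w + b v w.
Hypothesis b_sym : forall u v, b u v = b v u.
Hypothesis b_ge0 : forall v, 0 <= b v v.
Hypothesis b_def : forall v, E v -> b v v = 0 -> v = 0.
Hypothesis E0 : E 0.
Hypothesis E_lin : forall a v w, E v -> E w -> E (a *: v + w).

Lemma form0l w : b 0 w = 0.
Proof.
have := b_lin 1 0 0 w; rewrite scaler0 addr0 mul1r; lra.
Qed.

Lemma formZl a u w : b (a *: u) w = a * b u w.
Proof. by rewrite -[a *: u]addr0 b_lin form0l addr0. Qed.

Lemma formDl u v w : b (u + v) w = b u w + b v w.
Proof. by rewrite -[u]scale1r b_lin mul1r scale1r. Qed.

Lemma formBl u v w : b (u - v) w = b u w - b v w.
Proof. by rewrite formDl -scaleN1r formZl mulN1r. Qed.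

Lemma form_suml (I : finType) (F : I -> X) w : b (\sum_i F i) w = \sum_i b (F i) w.
Proof.
apply: (big_morph (b ^~ w)); [exact: (fun u v => formDl u v w)|exact: form0l].
Qed.

Let orthonormal n (e : 'I_n -> X) :=
  (forall i, E (e i)) /\ (forall i j, b (e i) (e j) = (i == j)%:R).

Let orthonormal_le n (e : 'I_n -> X) : orthonormal e -> (n <= \dim {:X})%N.
Proof.
move=> [_ eb]; pose s := [tuple e i | i < n].
have sE (i : 'I_n) : s`_i = e i by rewrite -tnth_nth tnth_mktuple.
suff /eqP fs : free s.
  by rewrite -[leqLHS](size_tuple s) -fs dimvS// subvf.
apply/freeP => k; under eq_bigr do rewrite sE.
move=> sk i; have := congr1 (b ^~ (e i)) sk.
rewrite form0l form_suml (bigD1 i)//= formZl eb eqxx mulr1 big1 ?addr0//.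
by move=> j ji; rewrite formZl eb (negbTE ji) mulr0.
Qed.

(** Orthonormal vectors are free, so their number is bounded by the dimension and a family in [E] of
    maximal size exists. If [v] differed from its expansion [u], the normalised [v - u] would extend
    the family; it has positive length because it lies in [E], where [b] is definite. *)
Lemma exists_orthonormal_basis : exists n (e : 'I_n -> X),
  [/\ forall i, E (e i), forall i j, b (e i) (e j) = (i == j)%:R &
      forall v, E v -> v = \sum_i b v (e i) *: e i].
Proof.
pose Q n := `[< exists e : 'I_n -> X, orthonormal e >].
have Q0 : exists n, Q n.
  by exists 0%N; apply/asboolP; exists (fun=> 0); split => -[].
have Qle n : Q n -> (n <= \dim {:X})%N.
  by move=> /asboolP[e]; exact: orthonormal_le.
case: (ex_maxnP Q0 Qle) => n /asboolP[e [Ee eb]] nmax.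
exists n, e; split => // v Ev.
pose u := \sum_i b v (e i) *: e i.
have Eu : E u.
  rewrite /u; elim/big_ind : _ => [//|x y Ex Ey|i _].
    by rewrite -[x]scale1r; exact: E_lin.
  by rewrite -[_ *: _]addr0; exact: E_lin.
have Evu : E (v - u) by rewrite addrC -scaleN1r; exact: E_lin.
have orth i : b (v - u) (e i) = 0.
  rewrite formBl form_suml (bigD1 i)//= formZl eb eqxx mulr1 big1.
    by rewrite addr0 subrr.
  by move=> j ji; rewrite formZl eb (negbTE ji) mulr0.
apply/eqP; rewrite -subr_eq0; apply/negPn/negP => vu0.
have c0 : 0 < b (v - u) (v - u).
  rewrite lt_neqAle b_ge0 andbT eq_sym; apply/eqP => /(b_def Evu) /eqP.
  by rewrite (negbTE vu0).
have s0 : 0 < Num.sqrt (b (v - u) (v - u)) by rewrite sqrtr_gt0.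
pose f (i : 'I_n.+1) : X := if unlift ord_max i is Some j then e j
  else (Num.sqrt (b (v - u) (v - u)))^-1 *: (v - u).
suff : (n.+1 <= n)%N by rewrite ltnn.
apply: nmax; apply/asboolP; exists f; split => [i|i j]; rewrite /f.
  case: unliftP => [k _|_]; first exact: Ee.
  by rewrite -[_ *: _]addr0; exact: E_lin.
case: (unliftP ord_max i) => [i' ->|->]; case: (unliftP ord_max j) => [j' ->|->].
- by rewrite eb (inj_eq lift_inj).
- by rewrite b_sym formZl orth mulr0 eq_sym (negbTE (neq_lift _ _)).
- by rewrite formZl orth mulr0 (negbTE (neq_lift _ _)).
- rewrite formZl b_sym formZl eqxx mulrA -expr2 exprVn sqr_sqrtr ?b_ge0//.
  by rewrite mulVf// gt_eqF.
Qed.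

End orthonormal_basis.

(** * Measurability through open conditions *)

Section open_in_data.
Context {R : realType} {d} {T : measurableType d} (m : nat).
Variable data : 'I_m -> T -> R.
Hypothesis mdata : forall i, measurable_fun setT (data i).

(* A set that is open with respect to finitely many real measurable data is a
   countable union of preimages of boxes with rational centre and radius. *)
Lemma measurable_open_in_data (A U : set T) : measurable A ->
  (forall t, A t -> U t -> exists2 e : R, 0 < e & forall t', A t' ->
     (forall i, `|data i t' - data i t| < e) -> U t') ->
  measurable (A `&` U).
Proof.
move=> mA openU.
pose box (ck : {ffun 'I_m -> rat} * nat) : set T :=
  \bigcap_(i in [set: 'I_m])
    [set t | `|data i t - ratr (ck.1 i)| < ck.2.+1%:R^-1].
have mbox ck : measurable (box ck).
  apply: fin_bigcap_measurable => // i _.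
  have mf : measurable_fun setT (fun t => `|data i t - ratr (ck.1 i)|).
    by apply: measurableT_comp => //; exact: measurable_funB.
  have := mf measurableT `]-oo, (ck.2.+1%:R^-1 : R)[%classic (measurable_itv _).
  rewrite setTI; congr measurable; apply/seteqP; split => t /=;
    by rewrite in_itv.
pose F ck : set T := if `[< A `&` box ck `<=` U >] then A `&` box ck else set0.
have mF ck : measurable (F ck).
  by rewrite /F; case: ifP => // _; exact: measurableI.
rewrite (_ : A `&` U = \bigcup_ck F ck).
  by apply: countable_bigcupT_measurable.
apply/seteqP; split => [t [At Ut]|t [ck _]]; last first.
  by rewrite /F; case: asboolP => // sub AB; split; [case: AB|exact: sub].
have [e e0 He] := openU t At Ut.
(* A radius below [e / 2]: a box of this radius whose rational centre is that close to the data at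
   [t] stays within distance [e] of them. *)
pose k := Num.trunc (2 / e).
have ke : k.+1%:R^-1 < e / 2.
  rewrite -[ltRHS]invrK ltf_pV2 ?posrE ?invr_gt0 ?divr_gt0//.
  by rewrite invf_div; exact: truncnS_gt.
have k0 : 0 < k.+1%:R^-1 :> R by rewrite invr_gt0.
have qP i : exists q : rat, `|data i t - ratr q| < k.+1%:R^-1.
  have [|q] := @rat_in_itvoo R (data i t - k.+1%:R^-1) (data i t + k.+1%:R^-1).
    by rewrite ltrD2l; apply: lt_trans k0; rewrite oppr_lt0.
  rewrite in_itv/= => /andP[q1 q2]; exists q.
  by rewrite distrC ltr_distl q1 q2.
pose c := [ffun i => projT1 (cid (qP i))].
have cP i : `|data i t - ratr (c i)| < k.+1%:R^-1.
  by rewrite ffunE; exact: projT2 (cid (qP i)).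
exists (c, k) => //; rewrite /F.
have -> : `[< A `&` box (c, k) `<=` U >].
  apply/asboolP => t' [At' bt']; apply: He => // i.
  have := bt' i I; rewrite /= => h; have := cP i => h'.
  rewrite -(subrKA (ratr (c i))) (le_lt_trans (ler_normD _ _))//.
  rewrite [`|ratr _ - _|]distrC.
  by rewrite (lt_le_trans (ltrD h h'))// [leRHS]splitr lerD// ltW.
by split => // i _; exact: cP.
Qed.

End open_in_data.

Lemma measurable_fun_of_open {R : realType} {d} {T : measurableType d}
    (A : set T) (f : T -> R) : measurable A ->
  (forall V : set R, open V -> measurable (A `&` f @^-1` V)) ->
  measurable_fun A f.
Proof.
move=> mA fV; apply: (measurability _ (RGenOpens.measurableE R)).
by move=> _ [_ [a [b ->] <-]]; apply: fV; exact: interval_open.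
Qed.

Section borel_rV.
Context {R : realType} (d : nat).
Local Notation point := 'rV[R]_d.

Lemma rV_nbhs (x : point) (U : set point) : nbhs x U ->
  exists2 e : R, 0 < e & forall y : point,
    (forall i, `|y ord0 i - x ord0 i| < e) -> U y.
Proof.
move=> /nbhs_ballP[e /= e0 sub]; exists e => // y xy; apply: sub; split => // i j.
rewrite (ord1 i); rewrite /ball/= distrC.
exact: xy.
Qed.

(** The sigma-algebra is generated by the coordinates, and neighbourhoods contain sup-norm balls, so
    the coordinates themselves are the finitely many data. *)
Lemma open_measurable_rV (U : set point) : open U -> measurable U.
Proof.
move=> oU; rewrite -(setTI U).
apply: (measurable_open_in_data (@measurable_rV_coord R d) measurableT).
move=> x _ Ux; have /rV_nbhs[e e0 H] : nbhs x U by exact: open_nbhs_nbhs.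
by exists e => // y _; exact: H.
Qed.

Lemma continuous_measurable_rV (f : point -> R) :
  continuous f -> measurable_fun setT f.
Proof.
move=> cf; apply: measurable_fun_of_open => // V oV; rewrite setTI.
apply: open_measurable_rV; exact: open_comp.
Qed.

End borel_rV.

(** * Smooth functions, test functions and the weak product rule *)

Section smooth.
Context {R : realType} (d : nat).
Local Notation point := 'rV[R]_d.
Local Notation dir := (fun i : 'I_d => delta_mx ord0 i : point).
Implicit Types (A : set point) (f g : point -> R).

(** A finite-order version of [smooth]: the induction for products consumes one derivative at a time
    and needs an order to count down. *)
Definition Cn (n : nat) A f := forall (s : seq 'I_d) x, (size s <= n)%N -> A x ->
  {for x, continuous (pder s f)} /\
  forall i : 'I_d, derivable (pder s f) x (dir i).

Lemma smoothP A f : smooth A f <-> forall n, Cn n A f.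
Proof.
split => [sf n s x _ Ax|Cf s x Ax]; first exact: sf.
exact: (Cf (size s)).
Qed.

Lemma CnS n m A f : (m <= n)%N -> Cn n A f -> Cn m A f.
Proof. by move=> mn Cf s x sm; apply: Cf; exact: leq_trans mn. Qed.

(** The head of the list is the outermost derivative. Peeling off the innermost one, at the other
    end, lets the product rule act on the functions themselves. *)
Lemma pder_rcons s i f : pder (rcons s i) f = pder s (fun x => 'D_(dir i) f x).
Proof. by rewrite /pder foldr_rcons. Qed.

Lemma Cn_der n A f i : Cn n.+1 A f -> Cn n A (fun x => 'D_(dir i) f x).
Proof.
by move=> Cf s x sn; rewrite -pder_rcons; apply: Cf; rewrite size_rcons.
Qed.

Lemma open_near A x : open A -> A x -> \forall y \near x, A y.
Proof. by move=> oA Ax; exact: open_nbhs_nbhs. Qed.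

Lemma pder_local A f g s : open A -> (forall x, A x -> f x = g x) ->
  forall x, A x -> pder s f x = pder s g x.
Proof.
move=> oA fg; elim: s => [|i s IH] x Ax /=; first exact: fg.
apply: near_eq_derive; apply: filterS (open_near oA Ax) => y Ay.
exact: IH.
Qed.

Lemma Cn_local n A f g : open A -> (forall x, A x -> f x = g x) ->
  Cn n A f -> Cn n A g.
Proof.
move=> oA fg Cf s x sn Ax; have [cf df] := Cf s x sn Ax.
have nfg : \forall y \near x, pder s f y = pder s g y.
  by apply: filterS (open_near oA Ax) => y Ay; exact: (pder_local s oA fg Ay).
split => [|i].
  rewrite /prop_for /continuous_at -(pder_local s oA fg Ax).
  by apply: cvg_trans cf; exact: (near_eq_cvg nfg).
exact: (near_eq_derivable nfg).
Qed.

Lemma pder_add n A f g s : open A -> Cn n A f -> Cn n A g -> (size s <= n.+1)%N ->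
  forall x, A x -> pder s (fun y => f y + g y) x = pder s f x + pder s g x.
Proof.
move=> oA Cf Cg; elim: s => [//|i s IH] sn x Ax /=.
transitivity ('D_(dir i) (pder s f + pder s g) x).
  apply: near_eq_derive; apply: filterS (open_near oA Ax) => y Ay.
  by apply: IH => //; exact: ltnW.
by apply: deriveD; [have [_] := Cf s x sn Ax|have [_] := Cg s x sn Ax].
Qed.

Lemma Cn_add n A f g : open A -> Cn n A f -> Cn n A g ->
  Cn n A (fun y => f y + g y).
Proof.
move=> oA Cf Cg s x sn Ax.
have [cf df] := Cf s x sn Ax; have [cg dg] := Cg s x sn Ax.
have E := pder_add oA Cf Cg (leqW sn).
have nE : \forall y \near x,
    (pder s f + pder s g) y = pder s (fun y => f y + g y) y.
  by apply: filterS (open_near oA Ax) => y Ay; rewrite E.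
split => [|i].
  rewrite /prop_for /continuous_at E//.
  by apply: cvg_trans (cvgD cf cg); exact: (near_eq_cvg nE).
apply: (near_eq_derivable nE); exact: derivableD.
Qed.

Lemma der_mul n A f g i x : Cn n A f -> Cn n A g -> A x ->
  'D_(dir i) (fun y => f y * g y) x =
  'D_(dir i) f x * g x + f x * 'D_(dir i) g x.
Proof.
move=> Cf Cg Ax.
have [_ df] := Cf [::] x (leq0n _) Ax; have [_ dg] := Cg [::] x (leq0n _) Ax.
rewrite (deriveM (df i) (dg i)) addrC; congr (_ + _).
by rewrite mulrC.
Qed.

Lemma Cn_mul n A f g : open A -> Cn n A f -> Cn n A g ->
  Cn n A (fun y => f y * g y).
Proof.
move=> oA; elim: n f g => [|n IH] f g Cf Cg s x sn Ax.
  move: sn; rewrite leqn0 => /nilP ->.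
  have [cf df] := Cf [::] x (leq0n _) Ax; have [cg dg] := Cg [::] x (leq0n _) Ax.
  by split => [|i]; [exact: (cvgM cf cg)|exact: (derivableM (df i) (dg i))].
case/lastP: s sn => [_|s i sn].
  have [cf df] := Cf [::] x (leq0n _) Ax; have [cg dg] := Cg [::] x (leq0n _) Ax.
  by split => [|i]; [exact: (cvgM cf cg)|exact: (derivableM (df i) (dg i))].
rewrite pder_rcons; move: s x sn Ax => s x; rewrite size_rcons => sn Ax.
suff : Cn n A (fun x => 'D_(dir i) (fun y => f y * g y) x) by apply.
apply: (@Cn_local n A (fun x => 'D_(dir i) f x * g x + f x * 'D_(dir i) g x)) => //.
  by move=> y Ay; rewrite (der_mul i Cf Cg Ay).
apply: Cn_add => //; apply: IH => //.
- exact: Cn_der.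
- exact: CnS Cg.
- exact: CnS Cf.
- exact: Cn_der.
Qed.

Lemma pder_cst0 s : pder s (fun _ : point => 0 : R) = (fun _ => 0).
Proof.
by elim: s => //= i s ->; apply/funext => x; exact: derive_cst.
Qed.

Lemma Cn_cst0 n A : Cn n A (fun _ => 0).
Proof.
move=> s x _ _; rewrite pder_cst0; split => [|i]; first by rewrite /prop_for; exact: cst_continuous.
exact: derivable_cst.
Qed.

Lemma pder_test_support (phi : point -> R) (K : set point) s : compact K ->
  (forall x, ~ K x -> phi x = 0) -> forall x, ~ K x -> pder s phi x = 0.
Proof.
move=> cK phi0 x Kx.
have cl : closed K by apply: compact_closed cK; exact: norm_hausdorff.
rewrite (@pder_local (~` K) phi (fun=> 0) s)// ?pder_cst0//.
exact: closed_openC.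
Qed.

Variable O : set point.
Hypothesis oO : open O.

Lemma test_fun_der phi i : test_fun O phi -> test_fun O (fun x => 'D_(dir i) phi x).
Proof.
move=> [sphi [K [cK KO phi0]]]; split.
  apply/smoothP => n; apply: Cn_der; move/smoothP : sphi; exact.
exists K; split => //; exact: (@pder_test_support phi K [:: i] cK phi0).
Qed.

(** [psi] is arbitrary outside [O]. At points of [K] the product rule applies inside the open set
    [O]; off the closed set [K] the product vanishes in a neighbourhood. *)
Lemma test_fun_mul psi phi : smooth O psi -> test_fun O phi ->
  test_fun O (fun x => psi x * phi x).
Proof.
move=> spsi [sphi [K [cK KO phi0]]]; split; last first.
  by exists K; split => // x Kx; rewrite phi0// mulr0.
have cl : closed K by apply: compact_closed cK; exact: norm_hausdorff.
move=> s x _; have [Kx|Kx] := pselect (K x).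
  have : Cn (size s) O (fun x => psi x * phi x).
    apply: Cn_mul => //; first exact: ((smoothP _ _).1 spsi).
    by move=> s' y ss' _; exact: ((smoothP _ _).1 sphi).
  by apply => //; exact: KO.
have : Cn (size s) (~` K) (fun x => psi x * phi x).
  apply: (@Cn_local _ _ (fun=> 0)); first exact: closed_openC.
    by move=> y Ky; rewrite phi0// mulr0.
  exact: Cn_cst0.
by apply.
Qed.

Lemma test_fun_continuous phi : test_fun O phi -> continuous phi.
Proof. by move=> [sphi _] x; have [] := sphi [::] x I. Qed.

Lemma test_fun_bounded phi : test_fun O phi -> exists M, forall x, `|phi x| <= M.
Proof.
move=> tphi; have cphi := test_fun_continuous tphi.
have [_ [K [cK _ phi0]]] := tphi.
have cfK : {within K, continuous phi} by apply: continuous_subspaceT.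
have cim : compact (phi @` K) := continuous_compact cfK cK.
have [M [_ HM]] := compact_bounded cim.
exists (Num.max 0 (M + 1)) => x; have [Kx|Kx] := pselect (K x).
  by rewrite le_max (HM (M + 1)) ?orbT ?ltrDl//; exists x.
by rewrite phi0// normr0 le_max lexx.
Qed.

Lemma test_fun_measurable phi : test_fun O phi -> measurable_fun setT phi.
Proof. by move=> tphi; apply: continuous_measurable_rV; exact: test_fun_continuous. Qed.

End smooth.

Section weak_product.
Context {R : realType} (d : nat) (O : set 'rV[R]_d) (vol : R).
Local Notation point := 'rV[R]_d.
Local Notation mu := (leb R d).
Hypothesis oO : open O.
Hypothesis volO : mu O = vol%:E.
Local Notation ok := (fun f : point -> R => mu.-integrable O (EFin \o f)).
Local Notation aeO := (fun P : point -> Prop => {ae mu, forall x, O x -> P x}).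
Implicit Types f g h : point -> R.

Let mO : measurable O. Proof. exact: open_measurable_rV. Qed.

Definition ess_bdd f := measurable_fun O f /\ exists M, aeO (fun x => `|f x| <= M).

Lemma ess_bddD f g : ess_bdd f -> ess_bdd g -> ess_bdd (fun x => f x + g x).
Proof.
move=> [mf [M hM]] [mg [N hN]]; split; first exact: measurable_funD.
exists (M + N); apply: ae_on_mp2 hM hN => x _ a b.
by apply: (le_trans (ler_normD _ _)); exact: lerD.
Qed.

Lemma ess_bddB f g : ess_bdd f -> ess_bdd g -> ess_bdd (fun x => f x - g x).
Proof.
move=> [mf [M hM]] [mg [N hN]]; split; first exact: measurable_funB.
exists (M + N); apply: ae_on_mp2 hM hN => x _ a b.
by apply: (le_trans (ler_normB _ _)); exact: lerD.
Qed.

Lemma ess_bddM f g : ess_bdd f -> ess_bdd g -> ess_bdd (fun x => f x * g x).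
Proof.
move=> [mf [M hM]] [mg [N hN]]; split; first exact: measurable_funM.
exists (M * N); apply: ae_on_mp2 hM hN => x _ a b.
by rewrite normrM ler_pM.
Qed.

Lemma ess_bdd_sum n (F : 'I_n -> point -> R) :
  (forall i, ess_bdd (F i)) -> ess_bdd (fun x => \sum_i F i x).
Proof.
move=> bF; suff H (s : seq 'I_n) : ess_bdd (fun x => \sum_(i <- s) F i x) by exact: H.
elim: s => [|i s IH].
  under eq_fun do rewrite big_nil; split; first exact: measurable_cst.
  by exists 0; apply: ae_onT => x _; rewrite normr0.
by under eq_fun do rewrite big_cons; exact: ess_bddD.
Qed.

Lemma ok_cst (M : R) : ok (cst M).
Proof.
apply/integrableP; split; first by apply/measurable_EFinP; exact: measurable_cst.
have -> : (\int[mu]_(x in O) `|(EFin \o cst M) x| =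
    \int[mu]_(x in O) (cst `|M|%:E x))%E by apply: eq_integral.
by rewrite integral_cst// [X in (_ * X)%E]volO -EFinM ltry.
Qed.

Lemma ess_bdd_ok f : ess_bdd f -> ok f.
Proof.
move=> [mf [M hM]]; exact: (ok_dom mO mf (ok_cst M) hM).
Qed.

Lemma Lnorm_pinfty_ae f : ('N[mu]_+oo[EFin \o f] < +oo)%E ->
  {ae mu, forall x, `|f x| <= fine ('N[mu]_+oo[EFin \o f])%E}.
Proof.
(* When the whole space has measure zero the norm is 0 by convention, and any property holds almost
   everywhere. *)
rewrite unlock /Lnorm/=; case: ifPn => [_ fin|m0 _]; last first.
  exists setT; split => //; apply/eqP; rewrite eq_le measure_ge0 andbT.
  by rewrite leNgt.
have := @ess_sup_ge _ _ _ mu (abse \o (EFin \o f)).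
apply: (@filterS _ (almost_everywhere mu)) => x /= h.
rewrite -lee_fin fineK//.
by rewrite fin_numE -ltNye -ltey fin andbT; apply: lt_le_trans h; rewrite ltNyr.
Qed.

Lemma sLpy_bound f : sLp O +oo%E f ->
  measurable_fun O f /\ aeO (fun x => `|f x| <= snorm O +oo%E f).
Proof.
rewrite /sLp inE => /andP[]; rewrite !inE => mf fin; split.
  exact/(measurable_restrictT _ mO).
have := Lnorm_pinfty_ae fin.
apply: (@filterS _ (almost_everywhere mu)) => x /= h Ox.
by move: h; rewrite patchE mem_set.
Qed.

Lemma sLpy_ess_bdd f : sLp O +oo%E f -> ess_bdd f.
Proof. by move=> /sLpy_bound[mf h]; split => //; exists (snorm O +oo%E f). Qed.

Lemma ess_bdd_snorm f : ess_bdd f -> aeO (fun x => `|f x| <= snorm O +oo%E f).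
Proof.
move=> [mf [M hM]]; suff : sLp O +oo%E f by case/sLpy_bound.
rewrite /sLp inE; apply/andP; split; rewrite !inE.
  exact/(measurable_restrictT _ mO).
rewrite /finite_norm unlock /Lnorm/=; case: ifPn => // _.
apply: (@le_lt_trans _ _ (Num.max M 0)%:E); last by rewrite ltry.
apply/ess_supP; apply: (@filterS _ (almost_everywhere mu)) hM => x h /=.
rewrite patchE lee_fin le_max; case: ifPn => [/set_mem /h ->//|_].
by rewrite normr0 lexx orbT.
Qed.

Lemma ess_bdd_sLp f (r : R) : 0 < r -> ess_bdd f -> sLp O r%:E f.
Proof.
move=> r0 [mf [M hM]]; apply/(sLpP mO _ r0); split => //.
apply: (@ok_dom _ _ _ mu _ mO _ (cst (M `^ r))); last 2 first.
- exact: ok_cst.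
- apply: ae_on_mp hM => x _ h; rewrite ger0_norm ?powR_ge0//.
  by apply: ge0_ler_powR; rewrite ?nnegrE ?(ltW r0) ?(le_trans _ h).
- by apply: measurable_fun_powR; exact: measurableT_comp.
Qed.

Lemma test_fun_ess_bdd phi : test_fun O phi -> ess_bdd phi.
Proof.
move=> tphi; split.
  by apply: measurable_funTS; exact: (test_fun_measurable tphi).
have [M hM] := test_fun_bounded tphi.
by exists M; apply: ae_onT => x _.
Qed.

(** Simultaneous uniform approximation of [S] and of its derivative: what the [W^{1,oo}] closure of
    smooth fields provides for each component. *)
Definition smooth_approx i (S S1 : point -> R) := forall e : R, 0 < e ->
  exists psi : point -> R, [/\ smooth O psi, ess_bdd psi,
    ess_bdd (pder [:: i] psi),
    aeO (fun x => `|S x - psi x| <= e) &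
    aeO (fun x => `|S1 x - pder [:: i] psi x| <= e)].

(** For smooth [psi] in place of [S], the product [psi * phi] is a test function and the identity
    follows from the weak derivative of [G]. The defect for [S] is at most [e] times a fixed
    integral, for every [e > 0]. *)
Lemma weak_der_mul i (S S1 G G1 : point -> R) :
  ess_bdd S -> ess_bdd S1 -> ess_bdd G -> ess_bdd G1 ->
  smooth_approx i S S1 -> weak_der O [:: i] G G1 ->
  weak_der O [:: i] (fun x => S x * G x) (fun x => S1 x * G x + S x * G1 x).
Proof.
move=> bS bS1 bG bG1 approx wG phi tphi; rewrite /= expr1 mulN1r.
set phi1 := pder [:: i] phi.
have tphi1 : test_fun O phi1 by exact: test_fun_der.
have bphi := test_fun_ess_bdd tphi; have bphi1 := test_fun_ess_bdd tphi1.
apply/eqP; rewrite -subr_eq0 opprK -normr_le0.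
(* The error density does not involve the approximant, so [e] can tend to zero. *)
pose K x := `|G x * phi1 x| + `|G x * phi x| + `|G1 x * phi x|.
have oK : ok K.
  by apply: okD => //; [apply: okD => //|]; apply: ok_abs => //;
    apply: ess_bdd_ok; exact: ess_bddM.
have K0 : 0 <= \int[mu]_(x in O) K x.
  by apply: Rintegral_ge0 => x _; rewrite !addr_ge0.
have main e : 0 < e -> `|spair O (fun x => S x * G x) phi1 +
    spair O (fun x => S1 x * G x + S x * G1 x) phi| <=
    e * \int[mu]_(x in O) K x.
  move=> e0; have [psi [spsi bpsi bpsi1 h h1]] := approx e e0.
  set psi1 := pder [:: i] psi in bpsi1 h1.
  have := wG _ (test_fun_mul oO spsi tphi); rewrite /= expr1 mulN1r => wpsi.
  have E0 : \int[mu]_(x in O) (G x * (psi1 x * phi x + psi x * phi1 x)) +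
      \int[mu]_(x in O) (G1 x * (psi x * phi x)) = 0.
    have -> : \int[mu]_(x in O) (G x * (psi1 x * phi x + psi x * phi1 x)) =
        spair O G (fun x => 'D_(delta_mx ord0 i) (fun x => psi x * phi x) x).
      apply: eq_Rintegral => x /set_mem Ox; congr (_ * _).
      rewrite (@der_mul _ _ 0 O) //; first exact: ((smoothP _ _).1 spsi).
      by case: tphi => sphi _ s y sn _; exact: ((smoothP _ _).1 sphi).
    by rewrite wpsi addNr.
  have oA1 : ok (fun x => G x * (psi1 x * phi x + psi x * phi1 x)).
    by apply: ess_bdd_ok; apply: ess_bddM => //; apply: ess_bddD; exact: ess_bddM.
  have oB1 : ok (fun x => G1 x * (psi x * phi x)).
    by apply: ess_bdd_ok; apply: ess_bddM => //; exact: ess_bddM.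
  have oC1 : ok (fun x => S x * G x * phi1 x).
    by apply: ess_bdd_ok; apply: ess_bddM => //; exact: ess_bddM.
  have oD1 : ok (fun x => (S1 x * G x + S x * G1 x) * phi x).
    by apply: ess_bdd_ok; apply: ess_bddM => //; apply: ess_bddD; exact: ess_bddM.
  rewrite -[X in `|X|]subr0 -E0 /spair -!RintegralD//.
  rewrite -RintegralB//; [|exact: (okD mO oC1 oD1)|exact: (okD mO oA1 oB1)].
  have okAll : ok (fun x => S x * G x * phi1 x +
      (S1 x * G x + S x * G1 x) * phi x -
      (G x * (psi1 x * phi x + psi x * phi1 x) + G1 x * (psi x * phi x))).
    by apply: (okB mO); [exact: (okD mO oC1 oD1)|exact: (okD mO oA1 oB1)].
  apply: (le_trans (le_normr_Rintegral _ okAll)) => //.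
  rewrite -RintegralZl//.
  apply: (ae_le_Rintegral mO); [exact: ok_abs|exact: okZ|].
  apply: ae_on_mp2 h h1 => x _ h h1; rewrite /K !normrM.
  have -> : S x * G x * phi1 x + (S1 x * G x + S x * G1 x) * phi x -
      (G x * (psi1 x * phi x + psi x * phi1 x) + G1 x * (psi x * phi x)) =
      (S x - psi x) * (G x * phi1 x) + (S1 x - psi1 x) * (G x * phi x) +
      (S x - psi x) * (G1 x * phi x) by ring.
  rewrite !mulrDr; apply: (le_trans (ler_normD _ _)); apply: lerD.
    apply: (le_trans (ler_normD _ _)); apply: lerD.
      by rewrite !normrM; apply: ler_pM => //; rewrite mulr_ge0.
    by rewrite !normrM; apply: ler_pM => //; rewrite mulr_ge0.
  by rewrite !normrM; apply: ler_pM => //; rewrite mulr_ge0.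
apply/ler_addgt0Pr => e e0; rewrite add0r.
set I := \int[mu]_(x in O) K x in K0 main.
apply: (le_trans (main (e / (I + 1)) _)).
  by rewrite divr_gt0// ltr_wpDl.
rewrite mulrAC ler_pdivrMr ?ltr_wpDl//; apply: ler_wpM2l; first exact: ltW.
by rewrite lerDl.
Qed.

End weak_product.

(** * The field (sigma . grad) g and its bounds *)

Section noise_jet.
Context {R : realType} (d : nat).
Local Notation point := 'rV[R]_d.
Local Notation mu := (leb R d).

(** This is the derivative of [grad g] in direction [i], since [g [:: k; i]] is the weak derivative
    of [g [:: k]] in that direction. *)
Definition hess_row (g : jet R d) (i : 'I_d) (x : point) : 'M[R]_d :=
  \matrix_(k, j) g [:: k; i] x ord0 j.

(* The vector field (sigma . grad) g with its first weak derivatives. *)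
Definition noise_jet (sigma g : jet R d) : jet R d := fun s x =>
  match s with
  | [::] => sigma [::] x *m grad g x
  | [:: i] => sigma [:: i] x *m grad g x + sigma [::] x *m hess_row g i x
  | _ => 0
  end.

(** The norm is over the whole space, so that constants built from it mention no domain; for fields
    extended by zero it equals the norm over [O]. *)
Definition jet_bound (U : jet R d) (s : seq 'I_d) : R :=
  \sum_(j < d) snorm setT +oo%E (fun x => U s x ord0 j).

Definition grad_bound (U : jet R d) : R := \sum_(k < d) jet_bound U [:: k].

Definition noise_bound (sigma g : jet R d) : R :=
  jet_bound sigma [::] * grad_bound g.

Definition noise_grad_bound (sigma g : jet R d) : R :=
  \sum_(i < d) \sum_(j < d) (jet_bound sigma [:: i] * grad_bound g +
    jet_bound sigma [::] * \sum_(k < d) jet_bound g [:: k; i]).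

Lemma jet_bound_ge0 U s : 0 <= jet_bound U s.
Proof. by apply: sumr_ge0 => j _; exact: snorm_ge0. Qed.

Lemma grad_bound_ge0 U : 0 <= grad_bound U.
Proof. by apply: sumr_ge0 => j _; exact: jet_bound_ge0. Qed.

Lemma noise_bound_ge0 sigma g : 0 <= noise_bound sigma g.
Proof. by rewrite mulr_ge0 ?jet_bound_ge0 ?grad_bound_ge0. Qed.

Variables (O : set point) (vol : R).
Hypothesis oO : open O.
Hypothesis volO : mu O = vol%:E.
Local Notation ok := (fun f : point -> R => mu.-integrable O (EFin \o f)).
Local Notation aeO := (fun P : point -> Prop => {ae mu, forall x, O x -> P x}).

Let mO : measurable O. Proof. exact: open_measurable_rV. Qed.

Lemma ae_on_forall (I : finType) (Q : I -> point -> Prop) :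
  (forall i, aeO (Q i)) -> aeO (fun x => forall i, Q i x).
Proof.
move=> h; have : {ae mu, forall x, forall i, O x -> Q i x}.
  exact: filter_forall.
by apply: (@filterS _ (almost_everywhere mu)) => x q Ox i; exact: q.
Qed.

Lemma sobolev_ess_bdd k (U : jet R d) s j : sobolev O k +oo%E U ->
  (size s <= k)%N -> ess_bdd O (fun x => U s x ord0 j).
Proof.
by move=> sU sk; have [h _] := sU s sk; exact: (sLpy_ess_bdd oO (h ord0 j)).
Qed.

Lemma jet_bound_ae k (U : jet R d) s : sobolev O k +oo%E U -> zero_outside O k U ->
  (size s <= k)%N ->
  aeO (fun x => \sum_(j < d) `|U s x ord0 j| <= jet_bound U s).
Proof.
move=> sU zU sk.
have h j : aeO (fun x => `|U s x ord0 j| <=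
    snorm setT +oo%E (fun x => U s x ord0 j)).
  have b := sobolev_ess_bdd j sU sk.
  have -> : snorm setT +oo%E (fun x => U s x ord0 j) =
      snorm O +oo%E (fun x => U s x ord0 j).
    congr (fine (Lnorm _ _ _)); apply/funext => x /=; rewrite !patchE.
    rewrite mem_set//; case: ifPn => // /negP nOx; rewrite zU ?mxE// => Ox.
    by apply: nOx; exact: mem_set.
  exact: (ess_bdd_snorm oO b).
by apply: ae_on_mp (ae_on_forall h) => x _ hx; exact: ler_sum.
Qed.

Lemma mabs_jet_bound k (U : jet R d) s : sobolev O k +oo%E U ->
  zero_outside O k U -> (size s <= k)%N ->
  aeO (fun x => mabs (U s x) <= jet_bound U s).
Proof.
move=> sU zU sk; apply: ae_on_mp (jet_bound_ae sU zU sk) => x _.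
by apply: le_trans; apply: (le_trans (mabs_le_sum _)); rewrite big_ord1.
Qed.

Lemma mabs_grad_bound k (U : jet R d) : sobolev O k.+1 +oo%E U ->
  zero_outside O k.+1 U -> aeO (fun x => mabs (grad U x) <= grad_bound U).
Proof.
move=> sU zU.
have h (i : 'I_d) : aeO (fun x => \sum_(j < d) `|U [:: i] x ord0 j| <=
    jet_bound U [:: i]) by exact: jet_bound_ae sU zU _.
apply: ae_on_mp (ae_on_forall h) => x _ hx.
apply: (le_trans (mabs_le_sum _)); apply: ler_sum => i _.
by under eq_bigr do rewrite mxE.
Qed.

Lemma mabs_symgrad_bound k (U : jet R d) : sobolev O k.+1 +oo%E U ->
  zero_outside O k.+1 U -> aeO (fun x => mabs (symgrad U x) <= grad_bound U).
Proof.
move=> sU zU; apply: ae_on_mp (mabs_grad_bound sU zU) => x _ h.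
rewrite /symgrad mabsZ ger0_norm// ler_pdivrMl//.
apply: (le_trans (mabsD _ _)); rewrite mabs_tr mulr_natl mulr2n.
exact: lerD.
Qed.

Lemma mabs_hess_bound (g : jet R d) i : sobolev O 2 +oo%E g ->
  zero_outside O 2 g ->
  aeO (fun x => mabs (hess_row g i x) <= \sum_(k < d) jet_bound g [:: k; i]).
Proof.
move=> sg zg.
have h (k : 'I_d) : aeO (fun x => \sum_(j < d) `|g [:: k; i] x ord0 j| <=
    jet_bound g [:: k; i]) by exact: jet_bound_ae sg zg _.
apply: ae_on_mp (ae_on_forall h) => x _ hx.
apply: (le_trans (mabs_le_sum _)); apply: ler_sum => k _.
by under eq_bigr do rewrite mxE.
Qed.

Lemma mmeas_jet k (U : jet R d) s : sobolev O k +oo%E U -> (size s <= k)%N ->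
  mmeas O (U s).
Proof.
by move=> sU sk i j; rewrite (ord1 i); have [] := sobolev_ess_bdd j sU sk.
Qed.

Lemma mmeas_grad k (U : jet R d) : sobolev O k.+1 +oo%E U -> mmeas O (grad U).
Proof.
move=> sU i j; under eq_fun do rewrite mxE.
by have [] := sobolev_ess_bdd j sU (isT : (size [:: i] <= k.+1)%N).
Qed.

Lemma mmeas_symgrad k (U : jet R d) : sobolev O k.+1 +oo%E U -> mmeas O (symgrad U).
Proof.
move=> sU; apply: mmeasZ; apply: mmeasD; first exact: mmeas_grad sU.
by move=> i j; under eq_fun do rewrite mxE; exact: (mmeas_grad sU).
Qed.

Section with_data.
Variables sigma g : jet R d.
Hypotheses (Wg : Wdiv O 2 g) (zg : zero_outside O 2 g).
Hypotheses (Ws : Wdiv O 1 sigma) (zs : zero_outside O 1 sigma).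

Let sg : sobolev O 2 +oo%E g. Proof. by case: Wg. Qed.
Let ss : sobolev O 1 +oo%E sigma. Proof. by case: Ws. Qed.

Lemma mabs_noise_bound :
  aeO (fun x => mabs (noise_jet sigma g [::] x) <= noise_bound sigma g).
Proof.
have h1 := mabs_jet_bound ss zs (isT : (size ([::] : seq 'I_d) <= 1)%N).
apply: ae_on_mp2 h1 (mabs_grad_bound sg zg) => x _ a b.
by apply: (le_trans (mabs_mulmx _ _)); apply: ler_pM; rewrite ?mabs_ge0.
Qed.

Lemma mabs_noise_grad_bound :
  aeO (fun x => mabs (grad (noise_jet sigma g) x) <= noise_grad_bound sigma g).
Proof.
have h1 := mabs_jet_bound ss zs (isT : (size ([::] : seq 'I_d) <= 1)%N).
have h2 (i : 'I_d) := mabs_jet_bound ss zs (isT : (size [:: i] <= 1)%N).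
have h3 (i : 'I_d) := mabs_hess_bound i sg zg.
have h12 := ae_on_mp2 (fun x _ a b => conj a b) h1 (mabs_grad_bound sg zg).
have h23 := ae_on_mp2 (fun x _ a b => conj a b)
  (ae_on_forall h2) (ae_on_forall h3).
apply: ae_on_mp2 h12 h23 => x _ [s0 gb] [s1 hb].
apply: (le_trans (mabs_le_sum _)); apply: ler_sum => i _; apply: ler_sum => j _.
rewrite mxE; apply: (le_trans (mabs_entry _ _ _)).
apply: (le_trans (mabsD _ _)); apply: lerD.
  by apply: (le_trans (mabs_mulmx _ _)); apply: ler_pM; rewrite ?mabs_ge0.
by apply: (le_trans (mabs_mulmx _ _)); apply: ler_pM; rewrite ?mabs_ge0.
Qed.

Lemma ess_bdd_noise s j : (size s <= 1)%N ->
  ess_bdd O (fun x => noise_jet sigma g s x ord0 j).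
Proof.
have bg s' j' : (size s' <= 2)%N -> ess_bdd O (fun x => g s' x ord0 j').
  exact: sobolev_ess_bdd sg.
have bs s' j' : (size s' <= 1)%N -> ess_bdd O (fun x => sigma s' x ord0 j').
  exact: sobolev_ess_bdd ss.
have bmul s' : (size s' <= 1)%N ->
    ess_bdd O (fun x => (sigma s' x *m grad g x) ord0 j).
  move=> s1; under eq_fun do rewrite mxE.
  apply: ess_bdd_sum => k; apply: ess_bddM; first exact: bs.
  by under eq_fun do rewrite mxE; exact: bg.
case: s => [|i [|//]] _ /=; first exact: bmul.
under eq_fun do rewrite mxE; apply: ess_bddD; first exact: bmul.
under eq_fun do rewrite mxE.
apply: ess_bdd_sum => k; apply: ess_bddM; first exact: bs.
by under eq_fun do rewrite mxE; exact: bg.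
Qed.

Lemma mLp_noise s r : 0 < r -> (size s <= 1)%N ->
  mLp O r%:E (noise_jet sigma g s).
Proof.
move=> r0 s1 i j; rewrite (ord1 i).
exact: (ess_bdd_sLp oO volO r0 (ess_bdd_noise j s1)).
Qed.

(** [pder [:: k; i] phi] is the [k]-derivative of the test function [D_i phi]. Comparing the
    identity for [[:: k]] at [D_i phi] with the one for [[:: k; i]] at [phi] gives the claim without
    exchanging derivatives. *)
Lemma weak_der_grad k i j : weak_der O [:: i]
  (fun x => g [:: k] x ord0 j) (fun x => g [:: k; i] x ord0 j).
Proof.
move=> phi tphi.
have [_ /(_ j _ (test_fun_der i tphi)) h1] := sg (isT : (size [:: k] <= 2)%N).
have [_ /(_ j _ tphi) h2] := sg (isT : (size [:: k; i] <= 2)%N).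
move: h1 h2; rewrite /= expr1 mulN1r sqrrN expr1n mul1r => h1 h2.
by rewrite mulN1r -h2 h1 opprK.
Qed.

Lemma sigma_approx i k : smooth_approx O i
  (fun x => sigma [::] x ord0 k) (fun x => sigma [:: i] x ord0 k).
Proof.
move=> e e0; have [_ /(_ e e0)[phi [sphi _ hphi]]] := Ws.
have bD s : (size s <= 1)%N -> forall j, ess_bdd O (pder s (phi j)).
  move=> s1 j; have [h _] := hphi s s1.
  have := sLpy_ess_bdd oO (h ord0 j).
  by under eq_fun do rewrite mxE.
have bM s : (size s <= 1)%N ->
    aeO (fun x => `|sigma s x ord0 k - pder s (phi k) x| <= e).
  move=> s1; have [_ h] := hphi s s1.
  pose F x := sigma s x - \row_j pder s (phi j) x.
  (* Norms pass through [fine], which sends infinity to 0; the bound by [e] has content only once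
     essential boundedness is known. *)
  have bF : ess_bdd O (fun x => mabs (F x)).
    have bFj j : ess_bdd O (fun x => F x ord0 j).
      rewrite /F; under eq_fun do rewrite !mxE.
      by apply: ess_bddB; [exact: sobolev_ess_bdd ss _|exact: bD].
    split.
      by apply: mmeas_mabs => i' j'; rewrite (ord1 i'); have [] := bFj j'.
    pose M j := projT1 (cid (bFj j).2).
    have hM j : aeO (fun x => `|F x ord0 j| <= M j) by exact: projT2 (cid (bFj j).2).
    exists (\sum_j M j); apply: ae_on_mp (ae_on_forall hM) => x _ hx.
    rewrite ger0_norm ?mabs_ge0//; apply: (le_trans (mabs_le_sum _)).
    by rewrite big_ord1; exact: ler_sum.
  apply: ae_on_mp (ess_bdd_snorm oO bF) => x _.
  rewrite ger0_norm ?mabs_ge0// => hx.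
  apply: le_trans h; apply: le_trans hx.
  have := mabs_entry (F x) ord0 k; by rewrite /F !mxE.
exists (phi k); split.
- exact: sphi.
- exact: (bD [::]).
- exact: (bD [:: i]).
- exact: (bM [::]).
- exact: (bM [:: i]).
Qed.

Lemma weak_der_sum n i (A B : 'I_n -> point -> R) :
  (forall k, ess_bdd O (A k)) -> (forall k, ess_bdd O (B k)) ->
  (forall k, weak_der O [:: i] (A k) (B k)) ->
  weak_der O [:: i] (fun x => \sum_k A k x) (fun x => \sum_k B k x).
Proof.
move=> bA bB wAB phi tphi.
have b1 := test_fun_ess_bdd tphi.
have b2 := test_fun_ess_bdd (test_fun_der i tphi).
rewrite /spair; under eq_Rintegral do rewrite mulr_suml.
under [X in _ = _ * X]eq_Rintegral do rewrite mulr_suml.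
rewrite !(Rintegral_sum mO).
- by rewrite mulr_sumr; apply: eq_bigr => k _; exact: wAB.
- by move=> k; apply: (ess_bdd_ok oO volO); exact: ess_bddM.
- by move=> k; apply: (ess_bdd_ok oO volO); exact: ess_bddM.
Qed.

(** Makes the Sobolev stability of [gdK] applicable to the noise field. Any [r > 0] will do, because
    all functions involved are essentially bounded on a set of finite measure. *)
Lemma noise_sobolev r : 0 < r -> sobolev O 1 r%:E (noise_jet sigma g).
Proof.
move=> r0 s s1; split; first exact: mLp_noise.
case: s s1 => [|i [|//]] _ j.
  by move=> phi _; rewrite /= expr0 mul1r.
have -> : (fun x => noise_jet sigma g [::] x ord0 j) =
    (fun x => \sum_k sigma [::] x ord0 k * g [:: k] x ord0 j).
  by apply/funext => x; rewrite mxE; apply: eq_bigr => k _; rewrite mxE.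
have -> : (fun x => noise_jet sigma g [:: i] x ord0 j) =
    (fun x => \sum_k (sigma [:: i] x ord0 k * g [:: k] x ord0 j +
       sigma [::] x ord0 k * g [:: k; i] x ord0 j)).
  apply/funext => x; rewrite !mxE -big_split/=.
  by apply: eq_bigr => k _; rewrite !mxE.
have bg s' j' : (size s' <= 2)%N -> ess_bdd O (fun x => g s' x ord0 j').
  exact: sobolev_ess_bdd sg.
have bs s' j' : (size s' <= 1)%N -> ess_bdd O (fun x => sigma s' x ord0 j').
  exact: sobolev_ess_bdd ss.
apply: weak_der_sum => k.
- by apply: ess_bddM; [exact: bs|exact: bg].
- apply: ess_bddD; apply: ess_bddM; by [exact: bs|exact: bg].
- apply: (weak_der_mul oO volO); [exact: bs|exact: bs|exact: bg|exact: bg| |].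
    exact: sigma_approx.
  exact: weak_der_grad.
Qed.

End with_data.

Lemma mnorm_le_bound m n (F : point -> 'M[R]_(m, n)) (r M : R) : 0 < r -> 0 <= M ->
  mLp O r%:E F -> aeO (fun x => mabs (F x) <= M) ->
  mnorm O r%:E F <= (M `^ r * vol) `^ r^-1.
Proof.
move=> r0 M0 Fr hM.
have H : mnorm O r%:E F `^ r <= M `^ r * vol.
  rewrite (mnorm_powR mO r0 Fr).
  apply: (@le_trans _ _ (\int[mu]_(x in O) (cst (M `^ r) x))).
    apply: (ae_le_Rintegral mO); [exact: ok_mabs_powR|exact: (ok_cst oO volO)|].
    apply: ae_on_mp hM => x _ h.
    by apply: ge0_ler_powR; rewrite ?nnegrE ?mabs_ge0 ?(ltW r0).
  by rewrite Rintegral_cst//= volO.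
have n0 := mnorm_ge0 O r%:E F.
rewrite -[leLHS](powRr1 n0) -(mulfV (lt0r_neq0 r0)) powRrM.
by apply: ge0_ler_powR; rewrite ?nnegrE ?powR_ge0 ?invr_ge0 ?(ltW r0)// (le_trans _ H)// powR_ge0.
Qed.

End noise_jet.

Lemma powR_mono {R : realType} (r x y : R) :
  0 <= r -> 0 <= x -> x <= y -> x `^ r <= y `^ r.
Proof.
move=> r0 x0 xy; apply: ge0_ler_powR => //; rewrite nnegrE//.
exact: le_trans xy.
Qed.

(** * Young's inequality and the stress *)

Section young.
Context {R : realType}.
Variable p : R.
Hypothesis p1 : 1 < p.

Let p0 : 0 < p. Proof. exact: lt_trans p1. Qed.
Let q0 : 0 < p - 1. Proof. by rewrite subr_gt0. Qed.

Lemma powR_succ (a : R) : 0 <= a -> a `^ (p - 1) * a = a `^ p.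
Proof.
rewrite le_eqVlt => /predU1P[<-|a0]; first by rewrite mulr0 powR0 ?gt_eqF.
rewrite -{2}(powRr1 (ltW a0)) -powRD; first by rewrite subrK.
by rewrite (gt_eqF a0) implybT.
Qed.

(** Whether [b] exceeds [delta * a] decides which of the two terms alone dominates; the constants
    are explicit rather than sharp. *)
Lemma young_pm1 (delta a b : R) : 0 < delta -> 0 <= a -> 0 <= b ->
  a `^ (p - 1) * b <= delta * a `^ p + delta^-1 `^ (p - 1) * b `^ p.
Proof.
move=> e0 a0 b0; have [ba|ba] := leP b (delta * a).
  apply: (@le_trans _ _ (delta * a `^ p)).
    rewrite -powR_succ// mulrCA; apply: ler_wpM2l => //; exact: powR_ge0.
  by rewrite lerDl mulr_ge0// powR_ge0.
apply: (@le_trans _ _ (delta^-1 `^ (p - 1) * b `^ p)).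
  rewrite -(powR_succ b0) mulrA; apply: ler_wpM2r => //.
  rewrite -powRM ?invr_ge0 ?(ltW e0)//.
  apply: ge0_ler_powR; rewrite ?nnegrE ?mulr_ge0 ?invr_ge0 ?(ltW e0) ?(ltW q0)//.
  by rewrite ler_pdivlMl// ltW.
by rewrite lerDr mulr_ge0 ?powR_ge0// ltW.
Qed.

Lemma conj_exp_gt1 : 1 < conj_exp p.
Proof. by rewrite /conj_exp ltr_pdivlMr// mul1r gtrBl. Qed.

Lemma conj_expE : p^-1 + (conj_exp p)^-1 = 1.
Proof. by rewrite /conj_exp; field; rewrite !gt_eqF. Qed.

Lemma young_conj (delta a b : R) : 0 < delta -> 0 <= a -> 0 <= b ->
  a * b <= delta * a `^ p + (delta^-1) `^ (p - 1)^-1 * b `^ conj_exp p.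
Proof.
move=> e0 a0 b0; have qi0 : 0 < (p - 1)^-1 by rewrite invr_gt0.
have [ba|ba] := leP b (delta * a `^ (p - 1)).
  apply: (@le_trans _ _ (delta * a `^ p)).
    rewrite -powR_succ// mulrA mulrC; exact: ler_wpM2r.
  by rewrite lerDl mulr_ge0// powR_ge0.
have b1 : 0 < b by apply: le_lt_trans ba; rewrite mulr_ge0 ?powR_ge0// ltW.
apply: (@le_trans _ _ ((delta^-1) `^ (p - 1)^-1 * b `^ conj_exp p)); last first.
  by rewrite lerDr mulr_ge0 ?powR_ge0// ltW.
have -> : conj_exp p = (p - 1)^-1 + 1.
  by rewrite /conj_exp; field; rewrite gt_eqF.
rewrite powRD ?(gt_eqF b1) ?implybT// powRr1// mulrA; apply: ler_wpM2r => //.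
rewrite -powRM ?invr_ge0 ?(ltW e0)//.
have -> : a = (a `^ (p - 1)) `^ (p - 1)^-1.
  by rewrite -powRrM mulfV ?powRr1// gt_eqF.
apply: ge0_ler_powR; rewrite ?nnegrE ?powR_ge0 ?(ltW qi0)//.
  by rewrite mulr_ge0// invr_ge0 ltW.
by rewrite ler_pdivlMl// ltW.
Qed.

End young.

Section stress.
Context {R : realType} (d : nat) (p kappa : R).
Hypothesis p1 : 1 < p.
Hypothesis k0 : 0 <= kappa.
Implicit Types A B : 'M[R]_d.

Let p0 : 0 < p. Proof. exact: lt_trans p1. Qed.

(** The stress has modulus [shear A ^ (p - 2) * |A|]. Powers of this quantity treat [p < 2] and
    [p >= 2] alike, and it differs from [|A|] by at most [sqrt kappa]. *)
Definition shear A : R := Num.sqrt (kappa + mdot A A).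

Lemma shear_ge0 A : 0 <= shear A. Proof. exact: sqrtr_ge0. Qed.

Lemma sqr_shear A : shear A ^+ 2 = kappa + mabs A ^+ 2.
Proof. by rewrite sqr_sqrtr ?sqr_mabs// addr_ge0// mdot_ge0. Qed.

Lemma mabs_le_shear A : mabs A <= shear A.
Proof.
rewrite -(@ler_pXn2r _ 2)// ?nnegrE ?mabs_ge0 ?shear_ge0// sqr_shear.
by rewrite lerDr.
Qed.

Lemma shear_le A : shear A <= Num.sqrt kappa + mabs A.
Proof.
rewrite -(@ler_pXn2r _ 2)// ?nnegrE ?addr_ge0 ?sqrtr_ge0 ?shear_ge0//.
have r0 := sqrtr_ge0 kappa; have := mulr_ge0 r0 (mabs_ge0 A).
rewrite sqr_shear; have := sqr_sqrtr k0.
move: (Num.sqrt kappa) (mabs A) => r a kE ra; rewrite -[X in X + _]kE.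
rewrite sqrrD -addrA [_ *+ 2 + _]addrC addrA lerDl mulrn_wge0//.
Qed.

Lemma stressE A : stress p kappa A = shear A `^ (p - 2) *: A.
Proof.
rewrite /stress; congr (_ *: _).
have -> : kappa + mdot A A = shear A `^ 2.
  by rewrite powR_mulrn ?shear_ge0// sqr_shear sqr_mabs.
by rewrite -powRrM mulrCA mulfV ?mulr1.
Qed.

Lemma shear_powR_pred A : shear A `^ (p - 2) * shear A <= shear A `^ (p - 1).
Proof.
have := shear_ge0 A; rewrite le_eqVlt => /predU1P[<-|y0].
  by rewrite mulr0 powR_ge0.
rewrite -{2}(powRr1 (ltW y0)) -powRD ?(gt_eqF y0) ?implybT//.
by rewrite le_eqVlt; apply/orP; left; apply/eqP; congr (_ `^ _); lra.
Qed.

Lemma stress_le A : mabs (stress p kappa A) <= shear A `^ (p - 1).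
Proof.
rewrite stressE mabsZ ger0_norm ?powR_ge0//; apply: le_trans (shear_powR_pred A).
by apply: ler_wpM2l; rewrite ?powR_ge0// mabs_le_shear.
Qed.

(** If [shear A ^+ 2 >= 2 * kappa], at least half of it comes from [|A|^2]; otherwise [shear A ^ p]
    is below the constant and nonnegativity of the pairing suffices. *)
Lemma stress_coercive A :
  2^-1 * shear A `^ p - 2^-1 * (2 * kappa) `^ (p / 2) <=
  mdot (stress p kappa A) A.
Proof.
have c0 : 0 <= (2 * kappa) `^ (p / 2) by exact: powR_ge0.
rewrite stressE mdotZl -sqr_mabs.
have m0 : 0 <= shear A `^ (p - 2) * mabs A ^+ 2.
  by rewrite mulr_ge0 ?powR_ge0 ?sqr_ge0.
have := shear_ge0 A; rewrite le_eqVlt => /predU1P[y0|y0].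
  by move: m0; rewrite -y0 [0 `^ p]powR0 ?gt_eqF//; lra.
have [big|small] := leP (2 * kappa) (shear A ^+ 2).
  have yp : shear A `^ p = shear A `^ (p - 2) * shear A ^+ 2.
    rewrite -powR_mulrn ?(ltW y0)// -powRD ?(gt_eqF y0) ?implybT//.
    by congr (_ `^ _); lra.
  have : shear A `^ (p - 2) * (2^-1 * shear A ^+ 2) <=
      shear A `^ (p - 2) * mabs A ^+ 2.
    apply: ler_wpM2l; first exact: powR_ge0.
    by have := sqr_shear A; lra.
  rewrite yp; lra.
have : shear A `^ p <= (2 * kappa) `^ (p / 2).
  have -> : shear A `^ p = (shear A ^+ 2) `^ (p / 2).
    rewrite -powR_mulrn ?(ltW y0)// -powRrM; congr (_ `^ _); lra.
  apply: ge0_ler_powR; rewrite ?nnegrE ?sqr_ge0 ?mulr_ge0 ?divr_ge0 ?(ltW p0)//.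
  exact: ltW.
lra.
Qed.

Let phi (t : R) := (kappa + t ^+ 2) `^ ((p - 2) / 2).

(** For [p < 2] the factor [phi] falls, but only by [rho ^ - th] with [th = (2 - p) / 2 < 1 / 2],
    and [sqrt rho <= t / s] compensates. *)
Let phi_mono (s t : R) : 0 <= s -> s <= t -> phi s * s <= phi t * t.
Proof.
rewrite le_eqVlt => /predU1P[<- t0|s0 st].
  by rewrite mulr0 mulr_ge0// powR_ge0.
have t0 : 0 < t by apply: lt_le_trans st.
have st2 : s ^+ 2 <= t ^+ 2 by rewrite ler_pXn2r// nnegrE ltW.
have a0 : 0 < kappa + s ^+ 2 by rewrite ltr_wpDl// exprn_gt0.
have b0 : 0 < kappa + t ^+ 2 by rewrite ltr_wpDl// exprn_gt0.
have [p2|p2] := leP 2 p.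
  apply: ler_pM; rewrite ?powR_ge0 ?(ltW s0)//.
  apply: ge0_ler_powR; rewrite ?nnegrE ?(ltW a0) ?(ltW b0) ?lerD2l//.
  by rewrite divr_ge0// subr_ge0.
pose rho := (kappa + t ^+ 2) / (kappa + s ^+ 2).
have rho1 : 1 <= rho by rewrite ler_pdivlMr// mul1r lerD2l.
have rho0 : 0 < rho by apply: lt_le_trans rho1.
pose th := (2 - p) / 2.
have thE : (p - 2) / 2 = - th by rewrite /th; lra.
have rth : rho `^ th <= t / s.
  apply: (@le_trans _ _ (rho `^ 2^-1)); first by apply: ler_powR => //; rewrite /= /th; have := p1; lra.
  have ts0 : 0 <= t / s by rewrite divr_ge0// ltW.
  rewrite powR12_sqrt ?(ltW rho0)//.
  rewrite -(@ler_pXn2r _ 2)// ?nnegrE ?sqrtr_ge0// sqr_sqrtr ?(ltW rho0)//.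
  rewrite ler_pdivrMr// expr_div_n mulrAC ler_pdivlMr ?exprn_gt0//.
  by rewrite mulrDl mulrDr [t ^+ 2 * kappa]mulrC lerD2r; apply: ler_wpM2l.
have -> : phi t = rho `^ (- th) * phi s.
  rewrite /phi thE -powRM ?(ltW rho0) ?(ltW a0)//; congr (_ `^ _).
  by rewrite /rho divfK// gt_eqF.
rewrite [X in _ <= X * t]mulrC -mulrA; apply: ler_wpM2l; first exact: powR_ge0.
rewrite powRN ler_pdivlMl ?powR_gt0//.
by move: rth; rewrite ler_pdivlMr.
Qed.

(** Cauchy-Schwarz on the mixed terms leaves [(phi a * a - phi b * b) * (a - b)], nonnegative by the
    scalar monotonicity. *)
Lemma stress_monotone A B :
  0 <= mdot (stress p kappa A - stress p kappa B) (A - B).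
Proof.
have SE C : stress p kappa C = phi (mabs C) *: C.
  by rewrite /stress /phi sqr_mabs.
rewrite !SE !(mdotBl, mdotBr, mdotZl) (mdotC B A) -!sqr_mabs.
set a := mabs A; set b := mabs B; set m := mdot A B.
have a0 : 0 <= a by exact: mabs_ge0.
have b0 : 0 <= b by exact: mabs_ge0.
have mab : m <= a * b by exact: mdot_le_mabs.
have pa : 0 <= phi a by exact: powR_ge0.
have pb : 0 <= phi b by exact: powR_ge0.
have h : (phi a + phi b) * m <= (phi a + phi b) * (a * b).
  by apply: ler_wpM2l; rewrite ?addr_ge0.
have h2 : 0 <= (phi a * a - phi b * b) * (a - b).
  have [ab|/ltW ba] := leP a b.
    by rewrite mulr_le0// subr_le0// phi_mono.
  by rewrite mulr_ge0// subr_ge0// phi_mono.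
nra.
Qed.

End stress.

Lemma powR_le_expn {R : realType} (r u : R) (m : nat) :
  r <= m%:R -> 1 <= u -> u `^ r <= u ^+ m.
Proof.
move=> rm u1; rewrite -powR_mulrn ?(le_trans ler01 u1)//.
exact: ler_powR.
Qed.

(* For tau <= 1 the martingale increment is kept; for tau > 1 the dissipation
   absorbs the whole noise term, which keeps the constant independent of tau. *)
Lemma step_algebra {R : realType} (p C1 Mp E c5 H2 c6 : R) :
  1 < p -> 0 <= C1 -> 0 <= Mp -> 0 <= E -> 0 <= c5 -> 0 <= H2 -> 0 <= c6 ->
  exists A c (m : nat), [/\ 0 <= A, 0 < c &
  forall tau s X X' Q Q2 Y N kv kv' nf kk : R,
  0 < tau -> 0 <= X -> 0 <= Y -> 0 <= N ->
  2^-1 * (X' - X) + tau * Q = s * (2^-1 * (kv' + kv)) ->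
  kv' - kv + tau * Q2 = (nf + kk) * s ->
  4^-1 * Y - C1 <= Q -> N `^ p <= 2 `^ p * (Y + Mp) ->
  (forall t, 0 <= t -> t * `|Q2| <= 8^-1 * Y + 8 `^ (p - 1) * (t `^ p * E)) ->
  `|nf| <= c5 * N -> 0 <= kk <= H2 -> `|2^-1 * (kv' + kv)| <= c6 * N ->
  `|kv| <= Num.sqrt H2 * Num.sqrt X ->
  let a := if tau <= 1 then 2 * kv else 0 in
  `|a| <= A * Num.sqrt X /\
  X' + c * (tau * N `^ p) <=
    X + a * s + A * tau * (1 + `|s / Num.sqrt tau|) ^+ m].
Proof.
move=> p1 C10 Mp0 E0 c50 H20 c60.
have p0 : 0 < p by apply: lt_trans p1.
set q := conj_exp p.
have q1 : 1 < q := conj_exp_gt1 p1.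
have q0 : 0 < q by apply: lt_trans q1.
(* The energy identity, doubled, provides [Y / 2] of dissipation. Since [N ^ p <= 2 ^ p * (Y + Mp)],
   a Young term with weight [d2] costs [Y / 8], and the constant [c] keeps [Y / 4] for the left
   side; both cases below spend exactly this budget. *)
pose d2 : R := (8 * 2 `^ p)^-1.
have d20 : 0 < d2 by rewrite invr_gt0 mulr_gt0// powR_gt0.
pose c : R := 4^-1 * (2 `^ p)^-1.
have c0 : 0 < c by rewrite mulr_gt0// invr_gt0 powR_gt0.
(* The powers of [|z|] to be dominated are [p], [q], [2] and [2 * q]. *)
pose m := (Num.trunc (p + 2 * q + 2)).+1.
have mge : p + 2 * q + 2 <= m%:R by rewrite ltW// truncnS_gt.
pose K1 : R := C1 + Mp + 8 `^ (p - 1) * E + d2^-1 `^ (p - 1)^-1 * c5 `^ q + H2.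
pose K2 : R := C1 + Mp + d2^-1 `^ (p - 1)^-1 * c6 `^ q.
have K10 : 0 <= K1 by rewrite !addr_ge0// mulr_ge0// powR_ge0.
have K20 : 0 <= K2 by rewrite !addr_ge0// mulr_ge0// powR_ge0.
exists (2 * Num.sqrt H2 + 2 * (K1 + K2)), c, m.
have A0 : 0 <= 2 * Num.sqrt H2 + 2 * (K1 + K2).
  by rewrite addr_ge0// mulr_ge0 ?sqrtr_ge0// addr_ge0.
split => // tau s X X' Q Q2 Y N kv kv' nf kk tau0 X0 Y0 N0 e1 e2 b1 b2 b3 b4
  /andP[kk0 b5] b6 b7.
set r := Num.sqrt tau; have r0 : 0 < r by rewrite sqrtr_gt0.
have rr : r ^+ 2 = tau by rewrite sqr_sqrtr// ltW.
have : s = r * (s / r) by rewrite mulrC divfK// gt_eqF.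
move: (s / r) => z sE; set a := (if _ then _ else _).
set u := 1 + `|z|; have u1 : 1 <= u by rewrite lerDl.
have um : 1 <= u ^+ m by apply: exprn_ege1.
have zu : `|z| <= u by rewrite lerDr.
have powz e : 0 <= e -> e <= m%:R -> `|z| `^ e <= u ^+ m.
  move=> e0 em; apply: le_trans (powR_le_expn em u1).
  exact: powR_mono.
have zp : `|z| `^ p <= u ^+ m by apply: powz; [exact: ltW|lra].
have zq : `|z| `^ q <= u ^+ m by apply: powz; [exact: ltW|lra].
have z2 : `|z| ^+ 2 <= u ^+ m.
  by rewrite -powR_mulrn//; apply: powz => //; lra.
have z2q : (`|z| ^+ 2) `^ q <= u ^+ m.
  by rewrite -powR_mulrn// -powRrM; apply: powz; lra.
have Np0 : 0 <= N `^ p by exact: powR_ge0.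
have d2N : d2 * N `^ p <= 8^-1 * (Y + Mp).
  rewrite /d2 invfM -mulrA; apply: ler_wpM2l => //.
  by rewrite ler_pdivrMl ?powR_gt0.
have cN : c * N `^ p <= 4^-1 * (Y + Mp).
  rewrite /c -mulrA; apply: ler_wpM2l => //.
  by rewrite ler_pdivrMl ?powR_gt0.
have tQ : tau * (4^-1 * Y - C1) <= tau * Q by apply: ler_wpM2l => //; exact: ltW.
have tcN : c * (tau * N `^ p) <= tau * (4^-1 * (Y + Mp)).
  by rewrite mulrCA; apply: ler_wpM2l => //; exact: ltW.
have sX : 0 <= Num.sqrt X by exact: sqrtr_ge0.
have Kum k : 0 <= k -> k <= k * u ^+ m by move=> k0; rewrite ler_peMr.
rewrite /a; case: ifPn => t1; split.
- rewrite normrM ger0_norm//; apply: (@le_trans _ _ (2 * (Num.sqrt H2 * Num.sqrt X))).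
    exact: ler_wpM2l.
  rewrite mulrA; apply: ler_wpM2r => //.
  by rewrite lerDl mulr_ge0// addr_ge0.
- have r1 : r <= 1 by rewrite -[leRHS](sqrtr1 R) ler_wsqrtr.
  (* Here [tau <= 1] gives [|s| <= |z|]; for large steps the factor [sqrt tau] in [s] would make
     this term exceed order [tau]. *)
  have B3 : - (s * (tau * Q2)) <= tau * (8^-1 * Y + 8 `^ (p - 1) * E * u ^+ m).
    apply: (@le_trans _ _ (tau * (`|z| * `|Q2|))).
      apply: (le_trans (ler_norm _)); rewrite normrN mulrCA !normrM.
      rewrite gtr0_norm//; apply: ler_wpM2l; first exact: ltW.
      apply: ler_wpM2r => //; rewrite sE normrM (gtr0_norm r0).
      by rewrite ler_piMl.
    apply: ler_wpM2l; first exact: ltW.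
    apply: (le_trans (b3 _ (normr_ge0 z))); rewrite lerD2l -mulrA.
    apply: ler_wpM2l; first exact: powR_ge0.
    by rewrite mulrC; apply: ler_wpM2l.
  have B4 : nf * s ^+ 2 <= tau * (8^-1 * (Y + Mp) +
      d2^-1 `^ (p - 1)^-1 * c5 `^ q * u ^+ m).
    have -> : s ^+ 2 = tau * `|z| ^+ 2.
      by rewrite sE exprMn rr real_normK ?num_real.
    rewrite mulrCA; apply: ler_wpM2l; first exact: ltW.
    apply: (@le_trans _ _ (N * (c5 * `|z| ^+ 2))).
      rewrite mulrA [N * c5]mulrC; apply: ler_wpM2r; first exact: sqr_ge0.
      exact: le_trans (ler_norm _) b4.
    have cz0 : 0 <= c5 * `|z| ^+ 2 by rewrite mulr_ge0// sqr_ge0.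
    apply: (le_trans (young_conj p1 d20 N0 cz0)); apply: lerD => //.
    rewrite -mulrA; apply: ler_wpM2l; first exact: powR_ge0.
    rewrite powRM ?sqr_ge0//; apply: ler_wpM2l => //; exact: powR_ge0.
  have B5 : kk * s ^+ 2 <= tau * (H2 * u ^+ m).
    have -> : s ^+ 2 = tau * `|z| ^+ 2.
      by rewrite sE exprMn rr real_normK ?num_real.
    rewrite mulrCA; apply: ler_wpM2l; first exact: ltW.
    by apply: ler_pM => //; exact: sqr_ge0.
  (* The second identity times [s] removes [kv'] from twice the first. *)
  have key : X' = X + 2 * kv * s - 2 * (tau * Q) - s * (tau * Q2) +
      nf * s ^+ 2 + kk * s ^+ 2.
    have -> : kk * s ^+ 2 = ((nf + kk) * s) * s - nf * s ^+ 2 by ring.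
    by rewrite -e2; lra.
  have C1u := Kum _ C10; have Mpu := Kum _ Mp0.
  have T : tau * (C1 + Mp + 8 `^ (p - 1) * E * u ^+ m +
     d2^-1 `^ (p - 1)^-1 * c5 `^ q * u ^+ m + H2 * u ^+ m) <=
     tau * (K1 * u ^+ m).
    by apply: ler_wpM2l; [exact: ltW|rewrite /K1; lra].
  have T2 : (K1 + K1) * tau * u ^+ m <=
      (2 * Num.sqrt H2 + 2 * (K1 + K2)) * tau * u ^+ m.
    apply: ler_wpM2r; first exact: le_trans um.
    apply: ler_wpM2r; first exact: ltW.
    by have := sqrtr_ge0 H2; lra.
  have tC1 : 0 <= tau * C1 by rewrite mulr_ge0// ltW.
  have tMp : 0 <= tau * Mp by rewrite mulr_ge0// ltW.
  have tY : 0 <= tau * Y by rewrite mulr_ge0// ltW.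
  have tC1u : tau * C1 <= tau * (K1 * u ^+ m).
    apply: ler_wpM2l; first exact: ltW.
    apply: (@le_trans _ _ K1); last exact: Kum.
    have := mulr_ge0 (powR_ge0 8 (p - 1)) E0.
    have := mulr_ge0 (powR_ge0 d2^-1 (p - 1)^-1) (powR_ge0 c5 q).
    rewrite /K1; lra.
  move: B3 B4 B5 T T2 tQ tcN; rewrite key; lra.
- rewrite normr0 mulr_ge0//.
have {}t1 : 1 <= tau by rewrite ltW// ltNge.
have r1 : 1 <= r by rewrite -[leLHS](sqrtr1 R) ler_wsqrtr.
have rt : r <= tau by rewrite -rr expr2 ler_peMl// ltW.
(* Now [sqrt tau <= tau], so the increment costs a factor [tau] and Young's inequality applies
   directly to the midpoint term. *)
have B6 : s * (2^-1 * (kv' + kv)) <= tau * (8^-1 * (Y + Mp) +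
    d2^-1 `^ (p - 1)^-1 * c6 `^ q * u ^+ m).
  apply: (@le_trans _ _ (tau * (N * (c6 * `|z|)))).
    apply: (le_trans (ler_norm _)); rewrite normrM sE normrM (gtr0_norm r0) -mulrA.
    have -> : N * (c6 * `|z|) = `|z| * (c6 * N) by ring.
    apply: ler_pM => //; [exact: ltW|exact: ler_wpM2l].
  apply: ler_wpM2l; first exact: ltW.
  have cz0 : 0 <= c6 * `|z| by rewrite mulr_ge0.
  apply: (le_trans (young_conj p1 d20 N0 cz0)); apply: lerD => //.
  rewrite -mulrA; apply: ler_wpM2l; first exact: powR_ge0.
  rewrite powRM//; apply: ler_wpM2l => //; exact: powR_ge0.
have C1u := Kum _ C10; have Mpu := Kum _ Mp0.
have T : tau * (C1 + Mp + d2^-1 `^ (p - 1)^-1 * c6 `^ q * u ^+ m) <=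
   tau * (K2 * u ^+ m).
  by apply: ler_wpM2l; [exact: ltW|rewrite /K2; lra].
have T2 : (K2 + K2) * tau * u ^+ m <=
    (2 * Num.sqrt H2 + 2 * (K1 + K2)) * tau * u ^+ m.
  apply: ler_wpM2r; first exact: le_trans um.
  apply: ler_wpM2r; first exact: ltW.
  by have := sqrtr_ge0 H2; lra.
have tMp : 0 <= tau * Mp by rewrite mulr_ge0// ltW.
have tY : 0 <= tau * Y by rewrite mulr_ge0// ltW.
move: e1 B6 T T2 tQ tcN; rewrite mul0r addr0; lra.
Qed.

(** * The discrete spaces and their stability *)

Section ae_linear_forms.
Context {R : realType} (d : nat) (O : set 'rV[R]_d).
Local Notation point := 'rV[R]_d.
Local Notation mu := (leb R d).
Hypothesis mO : measurable O.
Local Notation ok := (fun f : point -> R => mu.-integrable O (EFin \o f)).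
Local Notation aeO := (fun P : point -> Prop => {ae mu, forall x, O x -> P x}).
Context (X : lmodType R).

Lemma ae_linear0 (U : lmodType R) (F : X -> point -> U) : ae_linear O F ->
  aeO (fun x => F 0 x = 0).
Proof.
move=> lF; apply: ae_on_mp (lF 1 0 0) => x _.
rewrite !scale1r addr0 => /eqP; rewrite -subr_eq0 opprD addrA subrr sub0r.
by rewrite oppr_eq0 => /eqP.
Qed.

Lemma mpair_linear m n (F : X -> point -> 'M[R]_(m, n)) (H : point -> 'M[R]_(m, n)) :
  ae_linear O F -> (forall v, ok (fun x => mdot (H x) (F v x))) ->
  forall a v w, mpair O H (F (a *: v + w)) = a * mpair O H (F v) + mpair O H (F w).
Proof.
move=> lF oF a v w; rewrite /mpair -RintegralZl// -RintegralD//; last exact: okZ.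
apply: (ae_eq_Rintegral mO); first exact: ok_measurable.
  by apply: ok_measurable; apply: okD => //; exact: okZ.
by apply: ae_on_mp (lF a v w) => x _ ->; rewrite mdotDr mdotZr.
Qed.

Lemma mpairC m n (F G : point -> 'M[R]_(m, n)) : mpair O F G = mpair O G F.
Proof. by apply: eq_Rintegral => x _; rewrite mdotC. Qed.

Lemma spair_linear (F : X -> point -> R) (h : point -> R) :
  ae_linear O (F : X -> point -> R^o) -> (forall v, ok (fun x => h x * F v x)) ->
  forall a v w, spair O h (F (a *: v + w)) = a * spair O h (F v) + spair O h (F w).
Proof.
move=> lF oF a v w; rewrite /spair -RintegralZl// -RintegralD//; last exact: okZ.
apply: (ae_eq_Rintegral mO); first exact: ok_measurable.
  by apply: ok_measurable; apply: okD => //; exact: okZ.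
apply: ae_on_mp (lF a v w) => x _ ->.
by rewrite mulrDr; congr (_ + _); rewrite mulrCA.
Qed.

End ae_linear_forms.

Section mnorm_zero.
Context {R : realType} (d : nat) (O : set 'rV[R]_d).
Local Notation point := 'rV[R]_d.
Local Notation mu := (leb R d).
Hypothesis mO : measurable O.
Local Notation aeO := (fun P : point -> Prop => {ae mu, forall x, O x -> P x}).

Lemma mnorm_eq0 m n (r : R) (F : point -> 'M[R]_(m, n)) : 0 < r -> mLp O r%:E F ->
  mnorm O r%:E F = 0 <-> aeO (fun x => F x = 0).
Proof.
move=> r0 Fr; split => [F0|F0].
  have := mnorm_powR mO r0 Fr; rewrite F0 powR0 ?gt_eqF// => /esym I0.
  have := Rintegral_ge0_eq0 mO (ok_mabs_powR mO r0 Fr) (fun x _ => powR_ge0 _ _) I0.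
  by apply: ae_on_mp => x _ /eqP; rewrite powR_eq0 => /andP[/eqP h _]; exact: mabs_eq0.
apply/eqP; have /eqP : mnorm O r%:E F `^ r = 0.
  rewrite (mnorm_powR mO r0 Fr).
  rewrite (@ae_eq_Rintegral _ _ _ mu _ mO _ (cst 0)).
  - by rewrite Rintegral_cst// mul0r.
  - exact: ok_measurable (ok_mabs_powR mO r0 Fr).
  - exact: measurable_cst.
  - by apply: ae_on_mp F0 => x _ ->; rewrite mabs0 powR0// gt_eqF.
by rewrite powR_eq0 => /andP[].
Qed.

End mnorm_zero.

Section discrete.
Context {R : realType} (d : nat) (O : set 'rV[R]_d) (p vol : R).
Local Notation point := 'rV[R]_d.
Local Notation mu := (leb R d).
Hypothesis oO : open O.
Hypothesis volO : mu O = vol%:E.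
Hypothesis p1 : 1 < p.
Variable D : gradDisc O p.
Local Notation X := (gdX D).
Local Notation ok := (fun f : point -> R => mu.-integrable O (EFin \o f)).
Local Notation aeO := (fun P : point -> Prop => {ae mu, forall x, O x -> P x}).
Local Notation q := (conj_exp p).

Let mO : measurable O. Proof. exact: open_measurable_rV. Qed.
Let p0 : 0 < p. Proof. exact: lt_trans p1. Qed.
Let q0 : 0 < q. Proof. exact: lt_trans (conj_exp_gt1 p1). Qed.
Let pq : p^-1 + q^-1 = 1. Proof. exact: conj_expE. Qed.
Let qp : q^-1 + p^-1 = 1. Proof. by rewrite addrC conj_expE. Qed.
Let two0 : 0 < 2 :> R. Proof. by []. Qed.

Let Pi2 (v : X) : mLp O 2%:E (gdPi v). Proof. by case: (gdPi_Lp v). Qed.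
Let Pip (v : X) : mLp O p%:E (gdPi v). Proof. by case: (gdPi_Lp v). Qed.
Let Piq (v : X) : mLp O q%:E (gdPi v). Proof. by case: (gdPi_Lp v). Qed.

(** Semi-definite on the whole space, and an inner product on [gdE0], where [gdPi] is one-to-one. *)
Definition gdb (v w : X) : R := mpair O (gdPi v) (gdPi w).

Lemma ok_gdb (v w : X) : ok (fun x => mdot (gdPi v x) (gdPi w x)).
Proof. exact: (ok_mdot2 mO). Qed.

Lemma gdbC v w : gdb v w = gdb w v. Proof. exact: mpairC. Qed.

Lemma gdb_linr a u v w : gdb w (a *: u + v) = a * gdb w u + gdb w v.
Proof. by apply: (mpair_linear mO) => [|z]; [exact: gdPi_lin|exact: ok_gdb]. Qed.

Lemma gdb_linl a u v w : gdb (a *: u + v) w = a * gdb u w + gdb v w.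
Proof. by rewrite gdbC gdb_linr !(gdbC w). Qed.

Lemma gdb_ge0 v : 0 <= gdb v v.
Proof. by apply: Rintegral_ge0 => x _; exact: mdot_ge0. Qed.

Lemma gdb_norm v : gdb v v = mnorm O 2%:E (gdPi v) ^+ 2.
Proof. by rewrite (mnorm2_sqr mO (Pi2 v)). Qed.

(** [gddiv v] lies in both [L^p] and [L^{p'}], so whichever exponent is the minimum, its conjugate
    is available. *)
Lemma ok_chi_div (y : gdY D) (v : X) : ok (fun x => gdchi y x * gddiv v x).
Proof.
have hq := gdchi_Lp y; have [hp hp'] := gddiv_Lp v.
move: hq; rewrite minEle; case: ifP => _ hq.
  by have [] := sLp_holder mO p0 q0 pq hq hp'.
by have [] := sLp_holder mO q0 p0 qp hq hp.
Qed.

Lemma gdE0_lin a (v w : X) : gdE0 v -> gdE0 w -> gdE0 (a *: v + w).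
Proof.
move=> Ev Ew y Yy.
rewrite (spair_linear mO (@gddiv_lin _ _ _ _ D)); last first.
  by move=> u; exact: ok_chi_div.
by rewrite Ev// Ew// mulr0 addr0.
Qed.

Lemma gdE0_0 : gdE0 (0 : X).
Proof.
move=> y _; rewrite /spair (@ae_eq_Rintegral _ _ _ mu _ mO _ (cst 0)).
- by rewrite Rintegral_cst// mul0r.
- exact: ok_measurable (ok_chi_div y 0).
- exact: measurable_cst.
- apply: ae_on_mp (ae_linear0 (@gddiv_lin _ _ _ _ D)) => x _ ->.
  by rewrite mulr0.
Qed.

Lemma gdb_def (v : X) : gdE0 v -> gdb v v = 0 -> v = 0.
Proof.
move=> Ev; rewrite gdb_norm => /eqP; rewrite sqrf_eq0 => /eqP.
move/(mnorm_eq0 mO two0 (Pi2 v)) => v0.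
apply: (gdPi_inj Ev gdE0_0).
by apply: ae_on_mp2 v0 (ae_linear0 (@gdPi_lin _ _ _ _ D)) => x _ -> ->.
Qed.

Lemma gd_orthonormal_basis : exists n (e : 'I_n -> X),
  [/\ forall i, gdE0 (e i), forall i j, gdb (e i) (e j) = (i == j)%:R &
      forall v, gdE0 v -> v = \sum_i gdb v (e i) *: e i].
Proof.
exact: (exists_orthonormal_basis gdb_linl gdbC gdb_ge0 gdb_def gdE0_0 gdE0_lin).
Qed.

Lemma gdb_riesz (L : X -> R) : (forall a v w, L (a *: v + w) = a * L v + L w) ->
  exists2 w, gdE0 w & forall xi, gdE0 xi -> gdb w xi = L xi.
Proof.
move=> Llin; have [n [e [Ee eb eE]]] := gd_orthonormal_basis.
pose w := \sum_i L (e i) *: e i.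
have L0 : L 0 = 0 by have := Llin 1 0 0; rewrite scaler0 addr0; lra.
have Ew : gdE0 w.
  rewrite /w; elim/big_ind : _ => [|x y Ex Ey|i _]; first exact: gdE0_0.
    by rewrite -[x]scale1r; exact: gdE0_lin.
  by rewrite -[_ *: _]addr0; apply: gdE0_lin => //; exact: gdE0_0.
exists w => // xi Exi.
have sumL (F : 'I_n -> R) (G : X -> R) :
    (forall a v w, G (a *: v + w) = a * G v + G w) -> G 0 = 0 ->
    G (\sum_i F i *: e i) = \sum_i F i * G (e i).
  move=> Glin G0; elim/big_rec2 : _ => [//|i x y _ h].
  by rewrite Glin h.
rewrite [in RHS](eE xi Exi) (sumL _ L)// [in LHS]/w.
rewrite (sumL _ (fun v => gdb v xi)).
- by apply: eq_bigr => i _; rewrite mulrC gdbC.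
- by move=> a v u; exact: gdb_linl.
- by have := gdb_linl 1 0 0 xi; rewrite scaler0 addr0; lra.
Qed.

(** [gdK] is chosen by [xget] with default 0; the Riesz representative of the pairing with [h] shows
    that the choice succeeds. *)
Lemma gdKP (h : point -> 'rV[R]_d) : mLp O 2%:E h ->
  gdE0 (gdK D h) /\
  forall xi, gdE0 xi -> mpair O h (gdPi xi) = gdb (gdK D h) xi.
Proof.
move=> h2; pose L xi := mpair O h (gdPi (xi : X)).
have Llin a v w : L (a *: v + w) = a * L v + L w.
  by apply: (mpair_linear mO) => [|z]; [exact: gdPi_lin|exact: (ok_mdot2 mO)].
have [w Ew wL] := gdb_riesz Llin.
have diff u xi : mpair O (fun x => h x - gdPi u x) (gdPi xi) = L xi - gdb u xi.
  rewrite /mpair; under eq_Rintegral do rewrite mdotBl.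
  by rewrite RintegralB//; [exact: (ok_mdot2 mO)|exact: ok_gdb].
have [|EK KL] := @xgetPex _ 0 [set w : X | gdE0 w /\ forall xi : X, gdE0 xi ->
    mpair O (fun x => h x - gdPi w x) (gdPi xi) = 0].
  by exists w; split => // xi Exi; rewrite diff wL// subrr.
split => // xi Exi; have := KL xi Exi; rewrite diff => /eqP.
by rewrite subr_eq0 => /eqP.
Qed.

Section stability.
Variable Gam : R.
Hypothesis stD : stable D Gam.
Hypothesis Gam1 : 1 <= Gam.

(** Stability bounds only the sum of two suprema; a bound for each ratio follows because the ratios
    are nonnegative. *)
Let ereal_split (x y : \bar R) (a b : R) : (x + y <= Gam%:E)%E ->
  (a%:E <= x)%E -> (b%:E <= y)%E -> 0 <= a -> 0 <= b -> a <= Gam /\ b <= Gam.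
Proof.
move=> xy ax yb a0 b0.
have : (a%:E + b%:E <= Gam%:E)%E by apply: le_trans xy; exact: leeD.
by rewrite -EFinD lee_fin => h; split; lra.
Qed.

(** Definiteness is given for the exponent [p]; vanishing almost everywhere does not depend on the
    exponent, which carries it over to [p']. *)
Let eps_norm_neq0 (v : X) r : (r = p \/ r = q) -> v != 0 ->
  0 < mnorm O r%:E (gdeps v).
Proof.
move=> hr v0; rewrite lt0r mnorm_ge0 andbT; apply: contra v0 => /eqP n0.
have [ep eq'] := gdeps_Lp v.
have e0 : aeO (fun x => gdeps v x = 0).
  by case: hr n0 => -> n0; [exact/(mnorm_eq0 mO p0 ep)|exact/(mnorm_eq0 mO q0 eq')].
apply/eqP/gdeps_norm; exact/(mnorm_eq0 mO p0 ep).
Qed.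

Lemma stab_bound (v : X) r : (r = p \/ r = q) ->
  mnorm O r%:E (gdPi v) <= Gam * mnorm O r%:E (gdeps v) /\
  mnorm O r%:E (gdgrad v) <= Gam * mnorm O r%:E (gdeps v).
Proof.
move=> hr; have [v0|v0] := eqVneq v 0.
  have e0 : mnorm O r%:E (gdPi v) = 0 /\ mnorm O r%:E (gdgrad v) = 0 /\
      mnorm O r%:E (gdeps v) = 0.
    rewrite v0; have z1 := ae_linear0 (@gdPi_lin _ _ _ _ D).
    have z2 := ae_linear0 (@gdgrad_lin _ _ _ _ D).
    have z3 := ae_linear0 (@gdeps_lin _ _ _ _ D).
    have [g1 g2] := gdgrad_Lp (0 : X); have [e1 e2] := gdeps_Lp (0 : X).
    case: hr => ->; split; [exact/(mnorm_eq0 mO p0)|split|exact/(mnorm_eq0 mO q0)|split];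
      by [exact/(mnorm_eq0 mO p0)|exact/(mnorm_eq0 mO q0)].
  by move: e0 => [-> [-> ->]]; rewrite mulr0.
pose ratio s := (mnorm O s%:E (gdPi v) + snorm O s%:E (gddiv v) +
  mnorm O s%:E (gdgrad v)) / mnorm O s%:E (gdeps v).
have ratio0 s : 0 <= ratio s.
  by rewrite divr_ge0 ?addr_ge0 ?mnorm_ge0 ?snorm_ge0.
have rle s : ((ratio s)%:E <= stabC D s)%E.
  by apply: ereal_sup_ubound; exists v.
have [stC _ _] := stD.
have [rp rq] := ereal_split stC (rle p) (rle q) (ratio0 p) (ratio0 q).
have : ratio r <= Gam by case: hr => ->.
rewrite /ratio ler_pdivrMr ?eps_norm_neq0// => h.
have := mnorm_ge0 O r%:E (gdPi v); have := mnorm_ge0 O r%:E (gdgrad v).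
have := snorm_ge0 O r%:E (gddiv v); move=> a1 a2 a3.
by split; lra.
Qed.

(** Fields that vanish almost everywhere are excluded from the supremum; for them [gdK] gives 0 by
    definiteness. Otherwise the [W^{1,r}] norm is positive and the ratio can be cleared. *)
Lemma stab_K (Z : jet R d) r : (r = p \/ r = q) ->
  (forall s, 0 < s -> sobolev O 1 s%:E Z) ->
  mnorm O r%:E (gdeps (gdK D (Z [::]))) <= Gam * W1norm O r%:E Z.
Proof.
move=> hr sZ.
have ZL s : 0 < s -> mLp O s%:E (Z [::]).
  by move=> s0; have [] := sZ s s0 [::] isT.
have [EK KL] := gdKP (ZL 2 two0).
have W0 s : 0 <= W1norm O s%:E Z by rewrite addr_ge0 ?mnorm_ge0.
have r0 : 0 < r by case: hr => ->.
have G0 : 0 <= Gam by apply: le_trans Gam1.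
have [Z0|Z0] := pselect (aeO (fun x => Z [::] x = 0)).
  have K0 : gdK D (Z [::]) = 0.
    apply: gdb_def => //; rewrite -KL// /mpair.
    rewrite (@ae_eq_Rintegral _ _ _ mu _ mO _ (cst 0)).
    - by rewrite Rintegral_cst// mul0r.
    - by apply: ok_measurable; apply: (ok_mdot2 mO) => //; exact: ZL.
    - exact: measurable_cst.
    - apply: ae_on_mp Z0 => x _ ->.
      by rewrite mdotC -(scale0r (0 : 'rV[R]_d)) mdotZr mul0r.
  have e0 : mnorm O r%:E (gdeps (0 : X)) = 0.
    have [e1 e2] := gdeps_Lp (0 : X).
    have z3 := ae_linear0 (@gdeps_lin _ _ _ _ D).
    by case: hr => ->; [exact/(mnorm_eq0 mO p0)|exact/(mnorm_eq0 mO q0)].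
  by rewrite K0 e0 mulr_ge0.
pose ratio s := mnorm O s%:E (gdeps (gdK D (Z [::]))) / W1norm O s%:E Z.
have ratio0 s : 0 <= ratio s by rewrite divr_ge0 ?mnorm_ge0.
have rle s : 0 < s -> ((ratio s)%:E <= stabSob D s)%E.
  by move=> s0; apply: ereal_sup_ubound; exists Z => //; split => //; exact: sZ.
have [_ _ stS] := stD.
have [rp rq] := ereal_split stS (rle p p0) (rle q q0) (ratio0 p) (ratio0 q).
have : ratio r <= Gam by case: hr => ->.
rewrite /ratio ler_pdivrMr//.
rewrite lt0r W0 andbT; apply/eqP => W00; apply: Z0.
apply/(mnorm_eq0 mO r0 (ZL r r0)).
by have := mnorm_ge0 O r%:E (grad Z); have := mnorm_ge0 O r%:E (Z [::]);
  move: W00; rewrite /W1norm; lra.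
Qed.

End stability.
End discrete.

Definition noise_Lr (R : realType) (d : nat) (sigma g : jet R d) (vol r : R) : R :=
  (noise_bound sigma g `^ r * vol) `^ r^-1.

Definition noise_W1r (R : realType) (d : nat) (sigma g : jet R d) (vol r : R) : R :=
  noise_Lr sigma g vol r + (noise_grad_bound sigma g `^ r * vol) `^ r^-1.

(** * Estimates for one Crank-Nicolson step *)

Section step.
Context {R : realType} (d : nat) (O : set 'rV[R]_d) (p vol kappa Gam : R).
Local Notation point := 'rV[R]_d.
Local Notation mu := (leb R d).
Hypothesis oO : open O.
Hypothesis volO : mu O = vol%:E.
Hypothesis p1 : 1 < p.
Hypothesis kappa0 : 0 <= kappa.
Hypothesis Gam1 : 1 <= Gam.
Variables sigma g : jet R d.
Hypotheses (Wg : Wdiv O 2 g) (zg : zero_outside O 2 g).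
Hypotheses (Ws : Wdiv O 1 sigma) (zs : zero_outside O 1 sigma).
Variable D : gradDisc O p.
Hypothesis stD : stable D Gam.
Local Notation X := (gdX D).
Local Notation ok := (fun f : point -> R => mu.-integrable O (EFin \o f)).
Local Notation aeO := (fun P : point -> Prop => {ae mu, forall x, O x -> P x}).
Local Notation q := (conj_exp p).

Let mO : measurable O. Proof. exact: open_measurable_rV. Qed.
Let p0 : 0 < p. Proof. exact: lt_trans p1. Qed.
Let q0 : 0 < q. Proof. exact: lt_trans (conj_exp_gt1 p1). Qed.
Let pq : p^-1 + q^-1 = 1. Proof. exact: conj_expE. Qed.
Let qp : q^-1 + p^-1 = 1. Proof. by rewrite addrC conj_expE. Qed.
Let two0 : 0 < 2 :> R. Proof. by []. Qed.
Let Gam0 : 0 <= Gam. Proof. exact: le_trans Gam1. Qed.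
Let sg : sobolev O 2 +oo%E g. Proof. by case: Wg. Qed.
Let ss : sobolev O 1 +oo%E sigma. Proof. by case: Ws. Qed.
Let vol0 : 0 <= vol. Proof. by rewrite -lee_fin -volO measure_ge0. Qed.

Local Notation h := (noise_jet sigma g).
Local Notation k := (gdK D (h [::])).
Local Notation nf := (@noise_form R d O p D (sigma [::])).
Local Notation Ks := (jet_bound sigma [::]).
Local Notation M := (grad_bound g).

Let Pip (v : X) : mLp O p%:E (gdPi v). Proof. by case: (gdPi_Lp v). Qed.
Let Piq (v : X) : mLp O q%:E (gdPi v). Proof. by case: (gdPi_Lp v). Qed.
Let Gp (v : X) : mLp O p%:E (gdgrad v). Proof. by case: (gdgrad_Lp v). Qed.
Let Gq (v : X) : mLp O q%:E (gdgrad v). Proof. by case: (gdgrad_Lp v). Qed.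
Let ep (v : X) : mLp O p%:E (gdeps v). Proof. by case: (gdeps_Lp v). Qed.
Let eq' (v : X) : mLp O q%:E (gdeps v). Proof. by case: (gdeps_Lp v). Qed.
Let hr s : 0 < s -> mLp O s%:E (h [::]).
Proof. by move=> s0; exact: (@mLp_noise _ _ _ _ oO volO _ _ Wg Ws [::] _ s0 isT). Qed.

Lemma mpair_le m n (F G : point -> 'M[R]_(m, n)) (c : R) (f : point -> R) :
  mmeas O F -> mmeas O G -> ok f ->
  aeO (fun x => mabs (F x) * mabs (G x) <= c * f x) ->
  ok (fun x => mdot (F x) (G x)) /\
  `|mpair O F G| <= c * \int[mu]_(x in O) f x.
Proof.
move=> mF mG of' FG.
have oFG := ok_mdot mO mF mG (okZ mO c of') FG.
split => //; apply: (le_trans (le_normr_Rintegral _ oFG)) => //.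
rewrite -RintegralZl//; apply: (ae_le_Rintegral mO).
- exact: ok_abs.
- exact: okZ.
- by apply: ae_on_mp FG => x _; apply: le_trans; exact: mdot_le.
Qed.

Let sigma_ae : aeO (fun x => mabs (sigma [::] x) <= Ks).
Proof. exact: (@mabs_jet_bound _ _ _ oO 1 sigma [::] ss zs isT). Qed.

Let msigma : mmeas O (sigma [::]).
Proof. exact: (@mmeas_jet _ _ _ oO 1 sigma [::] ss isT). Qed.

Lemma sigma_grad_pair (F : point -> 'rV[R]_d) (A : point -> 'M[R]_d) (r s : R) :
  0 < r -> 0 < s -> r^-1 + s^-1 = 1 -> mLp O r%:E A -> mLp O s%:E F ->
  ok (fun x => mdot (sigma [::] x *m A x) (F x)) /\
  `|mpair O (fun x => sigma [::] x *m A x) F| <=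
    Ks * (mnorm O r%:E A * mnorm O s%:E F).
Proof.
move=> r0 s0 rs Ar Fs.
have mA := mLp_mmeas mO r0 Ar; have mF := mLp_mmeas mO s0 Fs.
have [oAF iAF] := mpair_holder mO r0 s0 rs Ar Fs.
have [|o1 h1] := @mpair_le _ _ (fun x => sigma [::] x *m A x) F Ks
  (fun x => mabs (A x) * mabs (F x)) (mmeas_mulmx msigma mA) mF oAF.
  apply: ae_on_mp sigma_ae => x _ sx; rewrite mulrA; apply: ler_wpM2r.
    exact: mabs_ge0.
  apply: (le_trans (mabs_mulmx _ _)); apply: ler_wpM2r => //; exact: mabs_ge0.
split => //; apply: (le_trans h1); apply: ler_wpM2l => //; exact: (jet_bound_ge0 sigma [::]).
Qed.

Let ok_nf1 (v xi : X) : ok (fun x => mdot (sigma [::] x *m gdgrad v x) (gdPi xi x)).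
Proof. by have [] := sigma_grad_pair p0 q0 pq (Gp v) (Piq xi). Qed.

Let ok_nf2 (v xi : X) : ok (fun x => mdot (gdPi v x) (sigma [::] x *m gdgrad xi x)).
Proof.
have [h1 _] := sigma_grad_pair q0 p0 qp (Gq xi) (Pip v).
by under eq_fun do rewrite mdotC.
Qed.

Let sgrad_lin : ae_linear O (fun (v : X) x => sigma [::] x *m gdgrad v x).
Proof.
move=> a v w; apply: ae_on_mp (gdgrad_lin a v w) => x _ ->.
by rewrite mulmxDr -scalemxAr.
Qed.

Lemma noise_form_linr a u v w : nf w (a *: u + v) = a * nf w u + nf w v.
Proof.
rewrite /noise_form (mpair_linear mO (@gdPi_lin _ _ _ _ D)); last by move=> z; exact: ok_nf1.
rewrite (mpair_linear mO sgrad_lin); last by move=> z; exact: ok_nf2.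
ring.
Qed.

Lemma noise_form_anti u v : nf u v = - nf v u.
Proof.
rewrite /noise_form [mpair O _ (gdPi v)]mpairC [mpair O (gdPi u) _]mpairC.
ring.
Qed.

Lemma noise_form_linl a u v w : nf (a *: u + v) w = a * nf u w + nf v w.
Proof.
by rewrite noise_form_anti noise_form_linr [nf u w]noise_form_anti
  [nf v w]noise_form_anti; ring.
Qed.

Lemma noise_form_self v : nf v v = 0.
Proof. by have := noise_form_anti v v; lra. Qed.

(** In both halves Hoelder puts [p] on [v] and [p'] on [xi], and stability is used twice, hence
    [Gam ^+ 2]. In the application [v] is the midpoint, controlled in [L^p] by the dissipation, and
    [xi] is [k]. *)
Lemma noise_form_le v xi : `|nf v xi| <=
  Ks * Gam ^+ 2 * mnorm O q%:E (gdeps xi) * mnorm O p%:E (gdeps v).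
Proof.
have [_ h1] := sigma_grad_pair p0 q0 pq (Gp v) (Piq xi).
have [_ h2] := sigma_grad_pair q0 p0 qp (Gq xi) (Pip v).
have [s1 s2] := stab_bound oO p1 stD v (or_introl erefl).
have [s3 s4] := stab_bound oO p1 stD xi (or_intror erefl).
have K0 : 0 <= Ks by exact: jet_bound_ge0.
set N := mnorm O p%:E (gdeps v) in s1 s2 *.
set N' := mnorm O q%:E (gdeps xi) in s3 s4 *.
have b1 : `|mpair O (fun x => sigma [::] x *m gdgrad v x) (gdPi xi)| <=
    Ks * Gam ^+ 2 * N' * N.
  apply: (le_trans h1).
  have -> : Ks * Gam ^+ 2 * N' * N = Ks * ((Gam * N) * (Gam * N')) by ring.
  apply: ler_wpM2l => //.
  by apply: ler_pM => //; exact: mnorm_ge0.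
have b2 : `|mpair O (gdPi v) (fun x => sigma [::] x *m gdgrad xi x)| <=
    Ks * Gam ^+ 2 * N' * N.
  rewrite mpairC; apply: (le_trans h2).
  have -> : Ks * Gam ^+ 2 * N' * N = Ks * ((Gam * N') * (Gam * N)) by ring.
  apply: ler_wpM2l => //.
  by apply: ler_pM => //; exact: mnorm_ge0.
rewrite /noise_form; apply: (le_trans (ler_normB _ _)).
rewrite !normrM !(@ger0_norm _ 2^-1)//; lra.
Qed.

Local Notation yv v := (fun x => shear kappa (gdeps v x + symgrad g x)).
Local Notation Sv v := (fun x => stress p kappa (gdeps v x + symgrad g x)).

Let symg_ae : aeO (fun x => mabs (symgrad g x) <= M).
Proof. exact: (mabs_symgrad_bound oO sg zg). Qed.

Let msymg : mmeas O (symgrad g). Proof. exact: (mmeas_symgrad oO sg). Qed.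

Let meps (v : X) : mmeas O (gdeps v). Proof. exact: (mLp_mmeas mO p0 (ep v)). Qed.

Let mB (v : X) : mmeas O (fun x => gdeps v x + symgrad g x).
Proof. exact: mmeasD. Qed.

Let my (v : X) : measurable_fun O (yv v).
Proof.
have -> : yv v = fun x => (kappa + mdot (gdeps v x + symgrad g x)
    (gdeps v x + symgrad g x)) `^ 2^-1.
  by apply/funext => x; rewrite powR12_sqrt// addr_ge0// mdot_ge0.
apply: measurable_fun_powR; apply: measurable_funD => //; exact: mmeas_mdot.
Qed.

Let mS (v : X) : mmeas O (Sv v).
Proof.
move=> i j; rewrite /stress; under eq_fun do rewrite mxE.
apply: measurable_funM; last exact: mB.
apply: measurable_fun_powR; apply: measurable_funD => //.
exact: mmeas_mdot.
Qed.

Let okY (v : X) : ok (fun x => yv v x `^ p).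
Proof.
apply: (@ok_dom _ _ _ mu _ mO _ (fun x => 2 `^ p * (mabs (gdeps v x) `^ p +
    (Num.sqrt kappa + M) `^ p))).
- exact: measurable_fun_powR.
- apply: okZ => //; apply: okD => //; first exact: (ok_mabs_powR mO p0 (ep v)).
  exact: (ok_cst oO volO).
- apply: ae_on_mp symg_ae => x _ gx; rewrite ger0_norm ?powR_ge0//.
  apply: le_trans (powRD_le p0 (mabs_ge0 _) _); last first.
    by rewrite addr_ge0 ?sqrtr_ge0 ?grad_bound_ge0.
  apply: powR_mono; [exact: ltW|exact: shear_ge0|].
  apply: (le_trans (shear_le kappa0 _)); rewrite addrCA lerD2l.
  by apply: (le_trans (mabsD _ _)); rewrite lerD2l.
Qed.

Local Notation Y v := (\int[mu]_(x in O) (yv v x `^ p)).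

Lemma ok_stress (v xi : X) : ok (fun x => mdot (Sv v x) (gdeps xi x)).
Proof.
apply: (ok_mdot mO (mS v) (meps xi) (h := fun x => 1 * yv v x `^ p +
   1^-1 `^ (p - 1) * mabs (gdeps xi x) `^ p)).
  by apply: okD => //; apply: okZ => //; exact: (ok_mabs_powR mO p0 (ep xi)).
apply: ae_onT => x _; apply: (@le_trans _ _ (yv v x `^ (p - 1) * mabs (gdeps xi x))).
  by apply: ler_wpM2r; [exact: mabs_ge0|exact: stress_le].
by apply: young_pm1 => //; [exact: shear_ge0|exact: mabs_ge0].
Qed.

(** [t] goes inside before Young's inequality: it will be the modulus of the scaled increment, and
    the weight [8^-1] is the share of the dissipation reserved for it. *)
Lemma stress_pair_le (v xi : X) (t : R) : 0 <= t ->
  t * `|mpair O (Sv v) (gdeps xi)| <=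
  8^-1 * Y v + 8 `^ (p - 1) * (t `^ p * mnorm O p%:E (gdeps xi) `^ p).
Proof.
move=> t0; rewrite (mnorm_powR mO p0 (ep xi)).
have oS := ok_stress v xi.
apply: (@le_trans _ _ (t * \int[mu]_(x in O) `|mdot (Sv v x) (gdeps xi x)|)).
  by apply: ler_wpM2l => //; exact: le_normr_Rintegral.
have oe := ok_mabs_powR mO p0 (ep xi).
rewrite mulrA -!RintegralZl//; last exact: ok_abs.
rewrite -RintegralD//; [|exact: okZ|exact: okZ].
apply: (ae_le_Rintegral mO).
- by apply: okZ => //; exact: ok_abs.
- by apply: okD => //; exact: okZ.
- apply: ae_onT => x _.
  have y0 := shear_ge0 kappa (gdeps v x + symgrad g x).
  apply: (@le_trans _ _ (yv v x `^ (p - 1) * (t * mabs (gdeps xi x)))).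
    rewrite mulrCA; apply: ler_wpM2l => //; apply: (le_trans (mdot_le _ _)).
    by apply: ler_wpM2r; [exact: mabs_ge0|exact: stress_le].
  have te0 : 0 <= t * mabs (gdeps xi x) by rewrite mulr_ge0 ?mabs_ge0.
  have e8 : 0 < 8^-1 :> R by rewrite invr_gt0.
  apply: (le_trans (young_pm1 p1 e8 y0 te0)).
  by rewrite invrK powRM ?mabs_ge0// mulrA.
Qed.

Definition stress_const : R :=
  (2^-1 * (2 * kappa) `^ (p / 2) + 4 `^ (p - 1) * M `^ p) * vol.

(** The stress is tested with [gdeps v] rather than with its own argument. Coercivity supplies half
    of [Y v], and the difference [symgrad g] costs a quarter by Young's inequality. *)
Lemma stress_energy (v : X) :
  4^-1 * Y v - stress_const <= mpair O (Sv v) (gdeps v).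
Proof.
pose c := 2^-1 * (2 * kappa) `^ (p / 2) + 4 `^ (p - 1) * M `^ p.
have -> : 4^-1 * Y v - stress_const = \int[mu]_(x in O) (4^-1 * yv v x `^ p - c).
  rewrite RintegralB//; [|exact: okZ|exact: (ok_cst oO volO)].
  by rewrite RintegralZl// Rintegral_cst//= volO.
apply: (ae_le_Rintegral mO).
- apply: okB => //; [exact: okZ|exact: (ok_cst oO volO)].
- exact: ok_stress.
- apply: ae_on_mp symg_ae => x _ gx.
  set B := gdeps v x + symgrad g x.
  have -> : gdeps v x = B - symgrad g x by rewrite addrK.
  have e4 : 0 < 4^-1 :> R by rewrite invr_gt0.
  have M0 : 0 <= M by exact: grad_bound_ge0.
  have y0 := shear_ge0 kappa B.
  rewrite mdotBr; have := stress_coercive p1 kappa0 B.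
  have : mdot (stress p kappa B) (symgrad g x) <=
      4^-1 * shear kappa B `^ p + 4 `^ (p - 1) * M `^ p.
    apply: (le_trans (mdot_le_mabs _ _)).
    apply: (@le_trans _ _ (shear kappa B `^ (p - 1) * M)).
      by apply: ler_pM; rewrite ?mabs_ge0 ?stress_le.
    by have := young_pm1 p1 e4 y0 M0; rewrite invrK.
  rewrite /c; lra.
Qed.

Lemma eps_norm_le (v : X) :
  mnorm O p%:E (gdeps v) `^ p <= 2 `^ p * (Y v + M `^ p * vol).
Proof.
have M0 : 0 <= M by exact: grad_bound_ge0.
have -> : Y v + M `^ p * vol = \int[mu]_(x in O) (yv v x `^ p + M `^ p).
  rewrite RintegralD//; last exact: (ok_cst oO volO).
  by rewrite Rintegral_cst//= volO.
have oYM : ok (fun x => yv v x `^ p + M `^ p).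
  by apply: okD => //; exact: (ok_cst oO volO).
rewrite -RintegralZl// (mnorm_powR mO p0 (ep v)).
apply: (ae_le_Rintegral mO); [exact: (ok_mabs_powR mO p0 (ep v))|exact: okZ|].
apply: ae_on_mp symg_ae => x _ gx.
apply: le_trans (powRD_le p0 (shear_ge0 _ _) M0).
apply: powR_mono; [exact: ltW|exact: mabs_ge0|].
have -> : gdeps v x = (gdeps v x + symgrad g x) - symgrad g x by rewrite addrK.
apply: (le_trans (mabsD _ _)); rewrite mabsN subrK.
by apply: lerD => //; exact: mabs_le_shear.
Qed.

(* One Crank-Nicolson step tested with discretely divergence-free functions,
   which eliminates the pressure. *)
Definition step_eq (tau s : R) (v v' : X) : Prop :=
  [/\ gdE0 v, gdE0 v' & forall xi : X, gdE0 xi ->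
    gdb v' xi - gdb v xi + tau * mpair O (Sv (midpoint v v')) (gdeps xi) =
    (nf (midpoint v v') xi + gdb k xi) * s].

(** The scheme constrains only the midpoint; [v' = 2 vh - v] inherits the constraint from [v].
    Against [gdE0] both pressures, being of zero mean, pair to zero, and [(sigma . grad) g] may be
    replaced by its projection [k]. *)
Lemma cn_step_eq (tau s : R) (v v' : X) (pr pr' : gdY D) : gdE0 v -> gdY0 pr ->
  crank_nicolson kappa sigma g tau s v pr v' pr' -> step_eq tau s v v'.
Proof.
move=> Ev Ypr [Ypr' eqn dv].
have Em : gdE0 (midpoint v v').
  move=> y Yy; have := dv y Yy; rewrite /spair => <-.
  by apply: eq_Rintegral => x _; rewrite mulrC.
have v'E : v' = 2 *: midpoint v v' + (-1) *: v.
  by rewrite /midpoint scalerA mulfV// scale1r scaleN1r addrK.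
have Ev' : gdE0 v'.
  rewrite v'E; apply: (gdE0_lin oO p1) => //.
  rewrite -[_ *: v]addr0; apply: (gdE0_lin oO p1) => //; exact: gdE0_0.
split => // xi Exi; have := eqn xi.
have -> : spair O (fun x => gdchi pr' x - gdchi pr x) (gddiv xi) = 0.
  rewrite /spair; under eq_Rintegral do rewrite mulrBl.
  rewrite RintegralB//; [|exact: (ok_chi_div oO p1)|exact: (ok_chi_div oO p1)].
  by have := Exi pr Ypr; have := Exi pr' Ypr'; rewrite /spair => -> ->; rewrite subrr.
have -> : mpair O (fun x => gdPi v' x - gdPi v x) (gdPi xi) = gdb v' xi - gdb v xi.
  rewrite /mpair; under eq_Rintegral do rewrite mdotBl.
  by rewrite RintegralB//; apply: (ok_gdb oO).
rewrite subr0 => ->; congr ((_ + _) * _).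
by have [_ ->] := gdKP oO p1 D (hr two0).
Qed.

Lemma gdb0r w : gdb w (0 : X) = 0.
Proof. by have := gdb_linr oO 1 0 0 w; rewrite scaler0 addr0; lra. Qed.

Lemma gdb_midr w v v' : gdb w (midpoint v v' : X) = 2^-1 * (gdb w v' + gdb w v).
Proof.
rewrite /midpoint -[_ *: _]addr0 (gdb_linr oO) gdb0r addr0; congr (_ * _).
by rewrite -[v']scale1r (gdb_linr oO) mul1r scale1r.
Qed.

Lemma midpoint_gdE0 (v v' : X) : gdE0 v -> gdE0 v' -> gdE0 (midpoint v v').
Proof.
move=> Ev Ev'; rewrite /midpoint -[_ *: _]addr0; apply: (gdE0_lin oO p1).
  by rewrite -[v']scale1r; exact: gdE0_lin.
exact: gdE0_0.
Qed.

Lemma step_energy tau s v v' : step_eq tau s v v' ->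
  2^-1 * (gdb v' v' - gdb v v) +
    tau * mpair O (Sv (midpoint v v')) (gdeps (midpoint v v')) =
  s * (2^-1 * (gdb k v' + gdb k v)).
Proof.
move=> [Ev Ev' eqn]; have := eqn _ (midpoint_gdE0 Ev Ev').
rewrite noise_form_self add0r !gdb_midr (gdbC v' v) mulrC => h.
by rewrite -[RHS]mulrC -h; ring.
Qed.

Lemma mnorm_noise_le r : 0 < r -> mnorm O r%:E (h [::]) <= noise_Lr sigma g vol r.
Proof.
move=> r0; apply: (mnorm_le_bound oO volO) => //; [exact: noise_bound_ge0|exact: hr|].
exact: (mabs_noise_bound oO Wg zg Ws zs).
Qed.

Lemma W1norm_noise_le r : 0 < r -> W1norm O r%:E h <= noise_W1r sigma g vol r.
Proof.
move=> r0; apply: lerD; first exact: mnorm_noise_le.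
apply: (mnorm_le_bound oO volO) => //; last exact: (mabs_noise_grad_bound oO Wg zg Ws zs).
  apply: sumr_ge0 => i _; apply: sumr_ge0 => j _.
  by rewrite addr_ge0 ?mulr_ge0 ?jet_bound_ge0 ?grad_bound_ge0 ?sumr_ge0// => l _;
    exact: jet_bound_ge0.
move=> i j.
rewrite (_ : (fun x => grad h x i j) = fun x => h [:: i] x ord0 j); last first.
  by apply/funext => x; rewrite mxE.
exact: (@mLp_noise _ _ _ _ oO volO _ _ Wg Ws [:: i] _ r0 isT).
Qed.

Lemma eps_K_le r : (r = p \/ r = q) ->
  mnorm O r%:E (gdeps k) <= Gam * noise_W1r sigma g vol r.
Proof.
move=> hrr; have r0 : 0 < r by case: hrr => ->.
apply: (le_trans (stab_K oO p1 stD Gam1 hrr _)).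
  by move=> s s0; exact: (noise_sobolev oO volO Wg Ws s0).
by apply: ler_wpM2l => //; exact: W1norm_noise_le.
Qed.

(** Against [gdE0] the projection can be undone, so norms of the field itself bound the pairing. *)
Lemma gdb_K_le2 w : gdE0 w ->
  `|gdb k w| <= noise_Lr sigma g vol 2 * Num.sqrt (gdb w w).
Proof.
move=> Ew; have [_ /(_ w Ew) <-] := gdKP oO p1 D (hr two0).
have Pi2 : mLp O 2%:E (gdPi w) by case: (gdPi_Lp w).
have h22 : (2^-1 + 2^-1 = 1 :> R) by lra.
have [i1 h1] := mpair_holder mO two0 two0 h22 (hr two0) Pi2.
have := @mpair_le _ _ (h [::]) (gdPi w) 1 (fun x => mabs (h [::] x) * mabs (gdPi w x)).
move=> /(_ (mLp_mmeas mO two0 (hr two0)) (mLp_mmeas mO two0 Pi2) i1).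
case; first by apply: ae_onT => x _; rewrite mul1r.
move=> _; rewrite mul1r => h3; apply: (le_trans h3); apply: (le_trans h1).
rewrite (gdb_norm oO) sqrtr_sqr ger0_norm ?mnorm_ge0//.
by apply: ler_wpM2r; [exact: mnorm_ge0|exact: mnorm_noise_le].
Qed.

Lemma gdb_K_lep w : gdE0 w ->
  `|gdb k w| <= noise_Lr sigma g vol q * Gam * mnorm O p%:E (gdeps w).
Proof.
move=> Ew; have [_ /(_ w Ew) <-] := gdKP oO p1 D (hr two0).
have [i1 h1] := mpair_holder mO q0 p0 qp (hr q0) (Pip w).
have := @mpair_le _ _ (h [::]) (gdPi w) 1 (fun x => mabs (h [::] x) * mabs (gdPi w x)).
move=> /(_ (mLp_mmeas mO q0 (hr q0)) (mLp_mmeas mO p0 (Pip w)) i1).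
case; first by apply: ae_onT => x _; rewrite mul1r.
move=> _; rewrite mul1r => h3; apply: (le_trans h3); apply: (le_trans h1).
rewrite -mulrA; apply: ler_pM; rewrite ?mnorm_ge0 ?mnorm_noise_le//.
by have [] := stab_bound oO p1 stD w (or_introl erefl).
Qed.

Lemma gdb_KK_le : 0 <= gdb k k <= noise_Lr sigma g vol 2 ^+ 2.
Proof.
rewrite gdb_ge0//=; have [Ek _] := gdKP oO p1 D (hr two0).
have := gdb_K_le2 Ek; have k0 := gdb_ge0 k; rewrite ger0_norm//.
have s0 := sqrtr_ge0 (gdb k k); rewrite -{1 3}(sqr_sqrtr k0).
have : 0 <= noise_Lr sigma g vol 2 by exact: powR_ge0.
move: s0; move: (Num.sqrt _) (noise_Lr _ _ _ _) => t B t0 B0 tB.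
rewrite ler_sqr ?nnegrE//; have [//|Bt] := leP t B.
have t1 : 0 < t by lra.
by move: tB; rewrite expr2 ler_pM2r // leNgt Bt.
Qed.

End step.

(** [A], [c] and [m] come out of [step_algebra] before the domain and the discretisation are
    introduced; this order of quantifiers is the uniformity that the final constant needs. *)
Lemma step_estimate (R : realType) d (p kappa Gam vol : R) (sigma g : jet R d) :
  1 < p -> 0 <= kappa -> 1 <= Gam -> 0 <= vol ->
  exists A c (m : nat), [/\ 0 <= A, 0 < c & forall O,
  open O -> leb R d O = vol%:E ->
  Wdiv O 2 g -> zero_outside O 2 g -> Wdiv O 1 sigma -> zero_outside O 1 sigma ->
  forall D : gradDisc O p, stable D Gam ->
  forall (tau s : R) (v v' : gdX D), 0 < tau -> step_eq kappa sigma g tau s v v' ->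
  let a := if tau <= 1 then 2 * gdb (gdK D (noise_jet sigma g [::])) v else 0 in
  `|a| <= A * Num.sqrt (gdb v v) /\
  gdb v' v' + c * (tau * mnorm O p%:E (gdeps (midpoint v v')) `^ p) <=
    gdb v v + a * s + A * tau * (1 + `|s / Num.sqrt tau|) ^+ m].
Proof.
move=> p1 k0 Gam1 vol0.
have Gam0 : 0 <= Gam by exact: le_trans Gam1.
have W0 r : 0 <= noise_W1r sigma g vol r by rewrite addr_ge0 ?powR_ge0.
have [||||||A [c [m [A0 c0 H]]]] := @step_algebra R p
  (stress_const p vol kappa g) (grad_bound g `^ p * vol)
  ((Gam * noise_W1r sigma g vol p) `^ p)
  (jet_bound sigma [::] * Gam ^+ 2 * (Gam * noise_W1r sigma g vol (conj_exp p)))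
  (noise_Lr sigma g vol 2 ^+ 2) (noise_Lr sigma g vol (conj_exp p) * Gam) p1.
- by rewrite mulr_ge0// addr_ge0 ?mulr_ge0 ?powR_ge0.
- by rewrite mulr_ge0 ?powR_ge0.
- exact: powR_ge0.
- by rewrite !mulr_ge0 ?jet_bound_ge0.
- exact: sqr_ge0.
- by rewrite mulr_ge0 ?powR_ge0.
exists A, c, m; split => // O oO volO Wg zg Ws zs D stD tau s v v' tau0 st.
set k := gdK D _; pose vh := midpoint v v'.
have [Ev Ev' eqn] := st.
have Evh : gdE0 vh by exact: (midpoint_gdE0 oO p1).
have hh : mLp O 2%:E (noise_jet sigma g [::]).
  exact: (@mLp_noise _ _ _ _ oO volO _ _ Wg Ws [::] _ _ isT).
have [Ek _] := gdKP oO p1 D hh.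
have e1 := step_energy oO p1 st.
have e2 := eqn k Ek; rewrite (gdbC v' k) (gdbC v k) in e2.
have L0 : 0 <= noise_Lr sigma g vol 2 by exact: powR_ge0.
have p0 : 0 <= p by lra.
pose Y := \int[leb R d]_(x in O)
  (shear kappa (gdeps vh x + symgrad g x) `^ p).
move=> a; rewrite /a {a}.
have /= HH := H tau s (gdb v v) (gdb v' v') _ _ Y (mnorm O p%:E (gdeps vh))
  (gdb k v) (gdb k v') (noise_form (sigma [::]) vh k) (gdb k k)
  tau0 (gdb_ge0 v) _ _ e1 e2.
apply: HH => //.
- by apply: Rintegral_ge0 => x _; exact: powR_ge0.
- exact: mnorm_ge0.
- exact: (stress_energy oO volO p1 k0 Wg zg).
- exact: (eps_norm_le oO volO p1 k0 Wg zg).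
- move=> t t0; apply: (le_trans (stress_pair_le oO volO p1 k0 Wg zg vh k t0)).
  rewrite lerD2l; do 2 (apply: ler_wpM2l; first exact: powR_ge0).
  apply: powR_mono => //; first exact: mnorm_ge0.
  exact: (eps_K_le oO volO p1 Gam1 Wg zg Ws zs stD (or_introl erefl)).
- apply: (le_trans (noise_form_le oO p1 Ws zs stD vh k)).
  apply: ler_wpM2r; first exact: mnorm_ge0.
  apply: ler_wpM2l; first by rewrite mulr_ge0 ?jet_bound_ge0 ?sqr_ge0.
  exact: (eps_K_le oO volO p1 Gam1 Wg zg Ws zs stD (or_intror erefl)).
- exact: (gdb_KK_le oO volO p1 Wg zg Ws zs D).
- rewrite -(gdb_midr oO k v v').
  exact: (gdb_K_lep oO volO p1 Wg zg Ws zs stD Evh).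
- rewrite sqrtr_sqr (ger0_norm L0).
  exact: (gdb_K_le2 oO volO p1 Wg zg Ws zs Ev).
Qed.

(** * Stability of a step and adaptedness *)

Section step_stability.
Context {R : realType} (d : nat) (O : set 'rV[R]_d) (p vol kappa : R).
Local Notation point := 'rV[R]_d.
Local Notation mu := (leb R d).
Hypothesis oO : open O.
Hypothesis volO : mu O = vol%:E.
Hypothesis p1 : 1 < p.
Hypothesis kappa0 : 0 <= kappa.
Variables sigma g : jet R d.
Hypotheses (Wg : Wdiv O 2 g) (zg : zero_outside O 2 g).
Hypotheses (Ws : Wdiv O 1 sigma) (zs : zero_outside O 1 sigma).
Variable D : gradDisc O p.
Local Notation X := (gdX D).
Local Notation k := (gdK D (noise_jet sigma g [::])).
Local Notation nf := (@noise_form R d O p D (sigma [::])).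
Local Notation Sv v := (fun x => stress p kappa (gdeps v x + symgrad g x)).
Local Notation ok := (fun f : point -> R => mu.-integrable O (EFin \o f)).

Let mO : measurable O. Proof. exact: open_measurable_rV. Qed.
Let two0 : 0 < 2 :> R. Proof. by []. Qed.

Lemma mpair_norm2_le (F G : point -> 'rV[R]_d) : mLp O 2%:E F -> mLp O 2%:E G ->
  `|mpair O F G| <= mnorm O 2%:E F * mnorm O 2%:E G.
Proof.
move=> F2 G2; have h22 : (2^-1 + 2^-1 = 1 :> R) by lra.
have [i1 h1] := mpair_holder mO two0 two0 h22 F2 G2.
have [|_] := @mpair_le _ _ _ oO _ _ F G 1 (fun x => mabs (F x) * mabs (G x))
  (mLp_mmeas mO two0 F2) (mLp_mmeas mO two0 G2) i1.
  by apply: ae_onT => x _; rewrite mul1r.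
by rewrite mul1r => h; exact: le_trans h1.
Qed.

Let Pi2 (v : X) : mLp O 2%:E (gdPi v). Proof. by case: (gdPi_Lp v). Qed.

Lemma gdb_le (a b : X) : `|gdb a b| <= Num.sqrt (gdb a a) * Num.sqrt (gdb b b).
Proof.
rewrite !(gdb_norm oO) !sqrtr_sqr !(ger0_norm (mnorm_ge0 _ _ _)).
exact: mpair_norm2_le.
Qed.

Let gdbBl (a b c : X) : gdb (a - b) c = gdb a c - gdb b c.
Proof. by rewrite addrC -scaleN1r (gdb_linl oO); ring. Qed.
Let gdbBr (a b c : X) : gdb c (a - b) = gdb c a - gdb c b.
Proof. by rewrite gdbC gdbBl !(gdbC c). Qed.
Let gdbDl (a b c : X) : gdb (a + b) c = gdb a c + gdb b c.
Proof. by rewrite -[a]scale1r (gdb_linl oO) mul1r scale1r. Qed.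
Let gdbDr (a b c : X) : gdb c (a + b) = gdb c a + gdb c b.
Proof. by rewrite gdbC gdbDl !(gdbC c). Qed.
Let gdbNl (a c : X) : gdb (- a) c = - gdb a c.
Proof. by rewrite -[- a]add0r gdbBl gdbC (gdb0r oO) sub0r. Qed.
Let gdbNr (a c : X) : gdb c (- a) = - gdb c a.
Proof. by rewrite gdbC gdbNl gdbC. Qed.
Let gdbZl t (a c : X) : gdb (t *: a) c = t * gdb a c.
Proof. by rewrite -[t *: a]addr0 (gdb_linl oO) [gdb 0 c]gdbC (gdb0r oO) addr0. Qed.
Let gdbZr t (a c : X) : gdb c (t *: a) = t * gdb c a.
Proof. by rewrite gdbC gdbZl gdbC. Qed.
Let E0B (a b : X) : gdE0 a -> gdE0 b -> gdE0 (a - b).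
Proof. by move=> Ea Eb; rewrite addrC -scaleN1r; exact: gdE0_lin. Qed.
Let E0D (a b : X) : gdE0 a -> gdE0 b -> gdE0 (a + b).
Proof. by move=> Ea Eb; rewrite -[a]scale1r; exact: gdE0_lin. Qed.

Lemma stress_pair_monotone (u v : X) :
  0 <= mpair O (Sv u) (gdeps (u - v)) - mpair O (Sv v) (gdeps (u - v)).
Proof.
have oS := ok_stress oO volO p1 kappa0 Wg zg.
rewrite /mpair -RintegralB//.
rewrite -[leLHS](mul0r (fine (mu O))) -(Rintegral_cst mu mO 0).
apply: (ae_le_Rintegral mO).
- exact: (ok_cst oO volO).
- by apply: okB => //; exact: oS.
- have := gdeps_lin (-1) v u; apply: ae_on_mp => x _.
  rewrite -mdotBl => e.
  have -> : gdeps (u - v) x = (gdeps u x + symgrad g x) - (gdeps v x + symgrad g x).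
    by rewrite addrC -scaleN1r e scaleN1r opprD addrACA subrr addr0 addrC.
  exact: stress_monotone.
Qed.

(** Subtract the steps and test with [u = w' + w], twice the difference of the midpoints. The stress
    difference is monotone and the two noise forms agree by antisymmetry, so
    [|w'|^2 - |w|^2 <= (s1 - s2) (l, u)]. Young's inequality and [|u|^2 <= 2 |w'|^2 + 2 |w|^2] give
    the factors 3 and 2. *)
Lemma step_stability tau s1 s2 (v1 v1' v2 v2' : X) (l : X) : 0 < tau ->
  step_eq kappa sigma g tau s1 v1 v1' -> step_eq kappa sigma g tau s2 v2 v2' ->
  (forall xi, gdE0 xi -> gdb l xi = nf (midpoint v1 v1') xi + gdb k xi) ->
  gdb (v1' - v2') (v1' - v2') <=
    3 * gdb (v1 - v2) (v1 - v2) + 2 * (s1 - s2) ^+ 2 * gdb l l.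
Proof.
move=> tau0 [E1 E1' e1] [E2 E2' e2] lE.
set w := v1 - v2; set w' := v1' - v2'; pose u := w' + w.
have Eu : gdE0 u by apply: E0D; exact: E0B.
set m1 := midpoint v1 v1'; set m2 := midpoint v2 v2'.
have um : u = 2 *: (m1 - m2) + 0.
  rewrite addr0 /m1 /m2 /midpoint -scalerBr scalerA mulfV// scale1r /u /w /w'.
  by rewrite opprD addrACA.
have nfu : nf m1 u - nf m2 u = 0.
  have : nf (m1 - m2) u = 0.
    rewrite um (noise_form_linr oO p1 Ws zs) noise_form_self mulr0 add0r.
    have := noise_form_linr oO p1 Ws zs 1 (0 : X) (0 : X) (m1 - m2).
    by rewrite scaler0 addr0; lra.
  rewrite addrC -scaleN1r (noise_form_linl oO p1 Ws zs); lra.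
have Su : 0 <= mpair O (Sv m1) (gdeps u) - mpair O (Sv m2) (gdeps u).
  have oS := ok_stress oO volO p1 kappa0 Wg zg.
  have lin (v : X) := mpair_linear mO (@gdeps_lin _ _ _ _ D) (oS D v).
  have z (v : X) : mpair O (Sv v) (gdeps (0 : X)) = 0.
    by have := lin v 1 0 0; rewrite scaler0 addr0; lra.
  rewrite um (lin m1 2 (m1 - m2) 0) (lin m2 2 (m1 - m2) 0) !z; have := stress_pair_monotone m1 m2; lra.
have {}e1 := e1 u Eu; have {}e2 := e2 u Eu; have {}lE := lE u Eu.
have key : gdb w' w' - gdb w w <= (s1 - s2) * gdb l u.
  have -> : gdb w' w' - gdb w w = gdb v1' u - gdb v1 u - (gdb v2' u - gdb v2 u).
    rewrite /u /w' /w !(gdbDl, gdbDr, gdbNl, gdbNr) (gdbC v2 v1') (gdbC v2' v1) (gdbC v2 v1)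
      (gdbC v2' v1') (gdbC v1 v1') (gdbC v2 v2'); ring.
  have := mulr_ge0 (ltW tau0) Su; rewrite lE -/m1.
  move: e1 e2 nfu; rewrite -/m1 -/m2.
  move: (gdb v1' u) (gdb v1 u) (gdb v2' u) (gdb v2 u) (mpair O (Sv m1) _)
    (mpair O (Sv m2) _) (nf m1 u) (nf m2 u) (gdb k u) => a b c e M1 M2 n1 n2 K.
  move=> e1 e2 nn; have n21 : n2 = n1 by lra.
  by rewrite n21 in e2; lra.
have y1 := gdb_ge0 ((s1 - s2) *: l - 2^-1 *: u).
have y2 := gdb_ge0 (w' - w).
have uu : gdb u u = gdb w' w' + gdb w w + 2 * gdb w' w.
  by rewrite /u gdbDl !(gdbDr w' w) (gdbC w w'); ring.
have y3 : gdb ((s1 - s2) *: l - 2^-1 *: u) ((s1 - s2) *: l - 2^-1 *: u) =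
    (s1 - s2) ^+ 2 * gdb l l - (s1 - s2) * gdb l u + 4^-1 * gdb u u.
  rewrite gdbBl (gdbBr _ _ (_ *: l)) (gdbBr _ _ (_ *: u)) !gdbZl !gdbZr (gdbC u l).
  lra.
move: y1 y2 key; rewrite y3 gdbBl !(gdbBr w' w) (gdbC w w') uu.
move: (gdb l u) (gdb l l) (gdb w' w') (gdb w w) (gdb w' w) => A B a b c.
rewrite expr2; nra.
Qed.
(** [l] represents the noise of the first step alone, so [del] is uniform over the second. Its
    denominator lets each of the two terms of [step_stability] take half of [e], and [del <= 1]
    bounds a square by its base. *)
Lemma step_continuous tau s1 (v1 v1' : X) (e : R) : 0 < tau -> 0 < e ->
  step_eq kappa sigma g tau s1 v1 v1' ->
  exists2 del : R, 0 < del & forall s2 (v2 v2' : X),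
    step_eq kappa sigma g tau s2 v2 v2' -> gdb (v1 - v2) (v1 - v2) < del ->
    `|s1 - s2| < del -> gdb (v1' - v2') (v1' - v2') < e.
Proof.
move=> tau0 e0 st1.
have [|l _ lE] := @gdb_riesz _ _ _ _ oO p1 D
    (fun xi => nf (midpoint v1 v1') xi + gdb k xi).
  by move=> a v w; rewrite (noise_form_linr oO p1 Ws zs) (gdb_linr oO); ring.
have l0 := gdb_ge0 l; have B0 : 0 < 6 + 4 * gdb l l by lra.
exists (Num.min 1 (e / (6 + 4 * gdb l l))).
  by rewrite lt_min ltr01 divr_gt0.
move=> s2 v2 v2' st2; rewrite !lt_min => /andP[_ d1] /andP[d2 d3].
apply: (le_lt_trans (step_stability tau0 st1 st2 lE)).
have -> : (s1 - s2) ^+ 2 = `|s1 - s2| ^+ 2 by rewrite real_normK ?num_real.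
move: d1 d2 d3; rewrite !ltr_pdivlMr//.
have := normr_ge0 (s1 - s2); have := gdb_ge0 (v1 - v2); move: l0.
move: `|s1 - s2| (gdb (v1 - v2) _) (gdb l l) => t a b b0 a0 t0 h1 t1 h2.
have tt : t ^+ 2 <= t by rewrite expr2 ler_piMr// ltW.
have tb : t ^+ 2 * b <= t * b by apply: ler_wpM2r.
have ab := mulr_ge0 a0 b0.
lra.
Qed.

Lemma gdb_coords n (f : 'I_n -> X) (v : X) : v = \sum_i gdb v (f i) *: f i ->
  gdb v v = \sum_i gdb v (f i) ^+ 2.
Proof.
move=> vE; rewrite {2}vE.
elim/big_rec2 : _ => [|i x y _ <-]; first exact: gdb0r.
by rewrite gdbDr gdbZr.
Qed.

Section adapted.
Context {dO : measure_display} {Om : measurableType dO}.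
Variables (G : nat -> set (set Om)) (dW : nat -> Om -> R) (tau : R).
Variables (v : nat -> Om -> X) (Good : set Om) (c0 : X -> R).
Hypothesis tau0 : 0 < tau.
Hypothesis sG : forall n, sigma_algebra setT (G n).
Hypothesis GS : forall n, G n `<=` G n.+1.
Hypothesis GGood : forall n, G n Good.
Hypothesis mdW : forall n, meas_wrt (G n.+1) (dW n).
Hypothesis step : forall n w, Good w ->
  step_eq kappa sigma g tau (dW n w) (v n w) (v n.+1 w).
Hypothesis init : forall w xi, Good w -> gdE0 xi -> gdb (v 0 w) xi = c0 xi.

(** [v^{n+1}] is defined implicitly, so measurability cannot be read off by composition. Within
    [Good], continuity of the step makes preimages of open sets open in the coordinates of [v^n] and
    the increment, which are measurable by induction. *)
Lemma gdb_adapted n xi : gdE0 xi ->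
  meas_wrt (G n) ((fun w => gdb (v n w) xi) \_ Good).
Proof.
elim: n xi => [|n IH] xi Exi.
  have -> : (fun w => gdb (v 0 w) xi) \_ Good = cst (c0 xi) \_ Good.
    by apply/funext => w; rewrite !patchE; case: ifPn => // /set_mem Gw; exact: init.
  apply/(measurable_restrictT _ _).1; last exact: measurable_cst.
  exact: sub_sigma_algebra.
have mGood : measurable (Good : set (g_sigma_algebraType (G n.+1))).
  exact: sub_sigma_algebra.
have [m [f [Ef _ fE]]] := gd_orthonormal_basis oO p1 D.
apply/(measurable_restrictT _ _).1 => //.
apply: measurable_fun_of_open => // V oV.
pose data (i : 'I_m.+1) : g_sigma_algebraType (G n.+1) -> R :=
  if unlift ord0 i is Some j then (fun w => gdb (v n w) (f j)) \_ Good else dW n.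
apply: (@measurable_open_in_data _ _ (g_sigma_algebraType (G n.+1)) m.+1 data) => //.
  move=> i; rewrite /data; case: unliftP => [j _|_]; last exact: mdW.
  refine (@meas_wrt_sub R _ Om _ _ _ (@GS n) _); exact: (IH (f j) (Ef j)).
move=> w Gw Vw.
have /(@nbhs_ballP _ R)[r /= r0 rV] : nbhs (gdb (v n.+1 w) xi) V by exact: open_nbhs_nbhs.
(* The extra 1 covers [xi] of norm zero. *)
have x0 : 0 < 1 + Num.sqrt (gdb xi xi) by rewrite ltr_pwDl ?sqrtr_ge0.
have e0 : 0 < (r / (1 + Num.sqrt (gdb xi xi))) ^+ 2 by rewrite exprn_gt0 ?divr_gt0.
have [del del0 H] := step_continuous tau0 e0 (step n Gw).
(* The squares of [m] coordinates, each below 1 and below [del / m.+1], add up to less than [del];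
   the same bound serves the increment. *)
exists (Num.min 1 (del / m.+1%:R)); first by rewrite lt_min ltr01 divr_gt0.
move=> w' Gw' hd; apply: rV; rewrite /ball/= -gdbBl.
apply: (le_lt_trans (gdb_le _ _)).
have [E1 _ _] := step n Gw; have [E2 _ _] := step n Gw'.
have hb (i : 'I_m) : `|gdb (v n w - v n w') (f i)| < Num.min 1 (del / m.+1%:R).
  have := hd (lift ord0 i); rewrite /data liftK !patchE !mem_set// => h.
  by rewrite gdbBl distrC.
have h1 : gdb (v n w - v n w') (v n w - v n w') < del.
  rewrite (gdb_coords (fE _ (E0B E1 E2))).
  apply: (@le_lt_trans _ _ (\sum_(i < m) del / m.+1%:R)).
    apply: ler_sum => i _; have := hb i; rewrite lt_min => /andP[a1 a2].
    rewrite -real_normK ?num_real// expr2; apply: le_trans (ltW a2).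
    by rewrite ler_piMr// ltW.
  rewrite sumr_const card_ord -[X in X < _]mulr_natr -mulrA gtr_pMr//.
  by rewrite mulrC ltr_pdivrMr// mul1r ltr_nat.
have h2 : `|dW n w - dW n w'| < del.
  have := hd ord0; rewrite /data unlift_none lt_min distrC => /andP[_ h].
  by apply: (lt_le_trans h); rewrite ler_pdivrMr// ler_peMr ?ler1n// ltW.
have := H _ _ _ (step n Gw') h1 h2.
have b0 := gdb_ge0 (v n.+1 w - v n.+1 w'); rewrite -{1}(sqr_sqrtr b0).
rewrite ltr_pXn2r ?nnegrE ?sqrtr_ge0 ?divr_ge0 ?ltW// ltr_pdivlMr//.
apply: le_lt_trans; apply: ler_wpM2l; first exact: sqrtr_ge0.
by rewrite lerDr.
Qed.

End adapted.
End step_stability.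

(** * Initial velocity and assembly *)

Section initial_velocity.
Context {R : realType} (d : nat) (O : set 'rV[R]_d) (p : R).
Hypothesis oO : open O.
Hypothesis p1 : 1 < p.
Variables (D : gradDisc O p) (vin : 'rV[R]_d -> 'rV[R]_d).
Hypothesis vin2 : mLp O 2%:E vin.

(** Against [gdE0] the initial pressure drops out, so both sides have the same pairings and
    definiteness concludes. In particular the initial velocity is deterministic. *)
Lemma helmholtz_initE (v : gdX D) (pr : gdY D) :
  helmholtz_init vin v pr -> v = gdK D vin.
Proof.
move=> [Ypr eqn dv].
have Ev : gdE0 v.
  move=> y Yy; have := dv y Yy; rewrite /spair => <-.
  by apply: eq_Rintegral => x _; rewrite mulrC.
have [EK KL] := gdKP oO p1 D vin2.
have Ed : gdE0 (v - gdK D vin) by rewrite addrC -scaleN1r; exact: gdE0_lin.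
have vK xi : gdE0 xi -> gdb v xi = gdb (gdK D vin) xi.
  by move=> Exi; rewrite -KL// -eqn Exi// addr0.
apply/eqP; rewrite -subr_eq0; apply/eqP; apply: (gdb_def oO p1 Ed).
by rewrite {1}addrC -{1}scaleN1r (gdb_linl oO) vK//; ring.
Qed.

Lemma gdb_K_self_le : gdb (gdK D vin) (gdK D vin) <= mnorm O 2%:E vin ^+ 2.
Proof.
have [EK KL] := gdKP oO p1 D vin2.
have K2 : mLp O 2%:E (gdPi (gdK D vin)) by case: (gdPi_Lp (gdK D vin)).
have := mpair_norm2_le oO vin2 K2; rewrite KL// (gdb_norm oO) ger0_norm ?sqr_ge0//.
have := mnorm_ge0 O 2%:E (gdPi (gdK D vin)); have := mnorm_ge0 O 2%:E vin.
move: (mnorm _ _ _) (mnorm _ _ _) => b a a0 b0 ba.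
rewrite ler_sqr ?nnegrE//; have [//|ab] := leP b a.
have {}b0 : 0 < b by exact: le_lt_trans ab.
by move: ba; rewrite expr2 ler_pM2r// leNgt ab.
Qed.

End initial_velocity.

Unset Implicit Arguments.

Theorem theorem11 (R : realType) (d : nat) (p kappa q Gam vol : R)
    (sigma g : jet R d) :
  (0 < d)%N -> 1 < p -> 0 <= kappa -> 0 < q -> 1 <= Gam ->
  exists C : R, 0 < C /\
  forall O : set 'rV[R]_d,
    polygonal_domain O -> leb R d O = vol%:E ->
    Wdiv O 2 g -> zero_outside O 2 g ->
    Wdiv O 1 sigma -> zero_outside O 1 sigma ->
  forall D : gradDisc O p, stable D Gam ->
  forall (dO : measure_display) (Om : measurableType dO)
    (P : probability Om R) (F : R -> set (set Om)) (W : R -> Om -> R),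
    usual_filtration P F -> wiener P F W ->
  forall (vin : 'rV[R]_d -> 'rV[R]_d) (tau : R),
    mLp O 2%:E vin -> 0 < tau ->
  forall (v : nat -> Om -> gdX D) (pr : nat -> Om -> gdY D),
    cn_algorithm P kappa sigma g W vin tau v pr ->
  forall N : nat, (0 < N)%N ->
    ('E_P[fun w =>
        (\big[Num.max/0]_(n < N.+1) mnorm O 2%:E (gdPi (v n w)) `^ (2 * q)
        + (\sum_(n < N) tau *
             mnorm O p%:E (gdeps (midpoint (v n w) (v n.+1 w))) `^ p) `^ q)%R]
     <= (C * (mnorm O 2%:E vin `^ (2 * q) + (tau * N%:R) `^ q))%:E)%E.
Proof.
(* [vol] is fixed before the domain; a negative value is the volume of none. *)
move=> _ p1 k0 q0 Gam1; have [vol0|volneg] := leP 0 vol; last first.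
  exists 1; split => // O _ volO.
  suff : 0 <= vol by rewrite leNgt volneg.
  by rewrite -lee_fin -volO measure_ge0.
have [A [c [m [A0 c0 H]]]] := step_estimate sigma g p1 k0 Gam1 vol0.
exists (energy_const q A c m); split; first exact: energy_const_gt0.
move=> O [_ _ [ps OE]] volO Wg zg Ws zs D stD dO Om P F W hF hW vin tau vin2 tau0
  v pr [init cn] N N0.
have oO : open O by rewrite OE; exact: open_interior.
pose dW n w := W (n.+1%:R * tau) w - W (n%:R * tau) w.
(* One event for all steps, its complement a countable union of negligible sets. *)
pose Good : set Om := [set w | forall n,
  crank_nicolson kappa sigma g tau (dW n w) (v n w) (pr n w) (v n.+1 w) (pr n.+1 w)].
have GoodN : P.-negligible (~` Good).
  rewrite (_ : ~` Good = \bigcup_n ~` [set w | crank_nicolson kappa sigma g tau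
      (dW n w) (v n w) (pr n w) (v n.+1 w) (pr n.+1 w)]).
    by apply: negligible_bigcup => n; exact: (cn n).
  by rewrite -setC_bigcap; congr (~` _); apply/seteqP; split => w Gw n; [move=> _|];
    exact: Gw.
have v0E w : v 0%N w = gdK D vin by exact: (helmholtz_initE oO p1 vin2 (init w)).
have [EK _] := gdKP oO p1 D vin2.
have stp n w : Good w -> step_eq kappa sigma g tau (dW n w) (v n w) (v n.+1 w).
  move=> Gw; suff [Ev Ypr] : gdE0 (v n w) /\ gdY0 (pr n w).
    exact: (cn_step_eq oO volO p1 Wg Ws Ev Ypr (Gw n)).
  case: n => [|n]; first by rewrite v0E; split => //; case: (init w).
  elim: n => [|n [Ev Ypr]].
    have Y0 : gdY0 (pr 0%N w) by case: (init w).
    rewrite -(v0E w) in EK.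
    have [_ ? _] := cn_step_eq oO volO p1 Wg Ws EK Y0 (Gw 0%N).
    by split => //; case: (Gw 0%N).
  have [_ ? _] := cn_step_eq oO volO p1 Wg Ws Ev Ypr (Gw n.+1).
  by split => //; case: (Gw n.+1).
(* The usual conditions put negligible sets into [F 0], so restriction to [Good] preserves
   adaptedness. *)
have FGood n : grid_filtration F tau n Good.
  have [_ FC _] := @grid_filtration_sigma _ _ _ P F hF tau tau0 n.
  have := FC _ (@grid_filtration_le _ _ _ P F hF tau tau0 0 n (leq0n n) (~` Good) _).
  rewrite setTD setCK; apply; rewrite /grid_filtration mul0r.
  by have [_ _ _ FN] := hF; exact: FN.
have hh : mLp O 2%:E (noise_jet sigma g [::]).
  exact: (@mLp_noise _ _ _ _ oO volO _ _ Wg Ws [::] _ _ isT).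
have [Ek _] := gdKP oO p1 D hh.
pose k := gdK D (noise_jet sigma g [::]).
(* The coefficient from [step_estimate], extended by zero outside [Good], where [v^n] is
   uncontrolled. *)
pose a n w := if tau <= 1 then 2 * ((fun w => gdb (v n w) k) \_ Good) w else 0.
have ma n : meas_wrt (F (n%:R * tau)) (a n).
  have ma1 : meas_wrt (grid_filtration F tau n) ((fun w => gdb (v n w) k) \_ Good).
    apply: (@gdb_adapted R d O p vol kappa oO volO p1 k0 sigma g Wg zg Ws zs D dO Om
      (grid_filtration F tau) dW tau v Good (fun xi => gdb (gdK D vin) xi) tau0) => //.
    - by move=> i; exact: (@grid_filtration_le _ _ _ P F hF tau tau0 i i.+1 (leqnSn i)).
    - by move=> i; exact: (@increment_meas _ _ _ P F W hF hW tau tau0 i).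
    - by move=> w xi _ _; rewrite v0E.
  rewrite /a; case: (tau <= 1); last by rewrite /meas_wrt; exact: measurable_cst.
  apply: measurable_funM; [exact: measurable_cst|exact: ma1].
have est n w : Good w -> `|a n w| <= A * Num.sqrt (gdb (v n w) (v n w)) /\
    gdb (v n.+1 w) (v n.+1 w) +
      c * (tau * mnorm O p%:E (gdeps (midpoint (v n w) (v n.+1 w))) `^ p) <=
    gdb (v n w) (v n w) + a n w * dW n w +
      A * tau * (1 + `|dW n w / Num.sqrt tau|) ^+ m.
  move=> Gw.
  have := H O oO volO Wg zg Ws zs D stD tau (dW n w) (v n w) (v n.+1 w) tau0 (stp n w Gw).
  by rewrite /= /a patchE mem_set// gdbC.
pose X n w := gdb (v n w) (v n w).
pose E n w := mnorm O p%:E (gdeps (midpoint (v n w) (v n.+1 w))) `^ p.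
have X0 n w : 0 <= X n w by exact: gdb_ge0.
have E0 n w : 0 <= E n w by exact: powR_ge0.
have Xi w : Good w -> X 0%N w = gdb (gdK D vin) (gdK D vin) by move=> _; rewrite /X v0E.
have aX n w : Good w -> `|a n w| <= A * Num.sqrt (X n w).
  by move=> Gw; exact: (proj1 (est n w Gw)).
have eX n w : Good w -> X n.+1 w + c * (tau * E n w) <=
    X n w + a n w * (W (n.+1%:R * tau) w - W (n%:R * tau) w) +
    A * tau * (1 + `|(W (n.+1%:R * tau) w - W (n%:R * tau) w) / Num.sqrt tau|) ^+ m.
  by move=> Gw; exact: (proj2 (est n w Gw)).
have bound := @energy_bound R q A c m q0 A0 c0 dO Om P F W tau _ X E a Good N hF hW tau0
  (gdb_ge0 (gdK D vin)) GoodN ma X0 E0 Xi aX eX N0.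
rewrite unlock.
have sqr_powR (x : R) : 0 <= x -> (x ^+ 2) `^ q = x `^ (2 * q).
  by move=> x0; rewrite -powR_mulrn// -powRrM.
under eq_integral => w _.
  under eq_bigr => n _ do rewrite -sqr_powR ?mnorm_ge0// -(gdb_norm oO).
  over.
apply: (le_trans bound); rewrite lee_fin; apply: ler_wpM2l.
  exact: ltW (energy_const_gt0 _ _ _ _).
rewrite lerD2r -sqr_powR ?mnorm_ge0//.
apply: powR_mono; [exact: ltW|exact: gdb_ge0|exact: gdb_K_self_le].
Qed.
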